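(* Let $(W,S)$ be an irreducible Fuchsian Coxeter system and let $(\Delta,\delta)$ be a locally finite thick regular Fuchsian building of type $(W,S)$, with fixed base chamber $o\in\Delta$. Let $(X_n)_{n\ge 0}$ be an irreducible isotropic random walk on $\Delta$ with bounded range and $X_0=o$, and let $(\overline X_n)_{n\ge0}$, $\overline X_n=\delta(o,X_n)$, be the associated retracted random walk on $W$. Let $\pi_n$ and $\overline\pi_n$ be the distributions of $X_n$ and $\overline X_n$, and let $G$ and $\overline G$ be the Green functions of the two walks. Then: 1. The asymptotic entropy $\overline h:=\lim_{n\to\infty}-\frac1n\mathbb E[\log\overline\pi_n(\overline X_n)]$ exists, and equals the rate of escape of $(\overline X_n)_{n\ge0}$ with respect to the Green distance, that is, $$\overline h=\lim_{n\to\infty}-\frac1n\log\overline G(e,\overline X_n)\quad\text{almost surely.}$$ 2. The asymptotic entropy $h:=\lim_{n\to\infty}-\frac1n\mathbb E[\log\pi_n(X_n)]$ exists, and equals the rate of escape of $(X_n)_{n\ge0}$ with respect to the Green distance, that is, $$h=\lim_{n\to\infty}-\frac1n\log G(o,X_n)\quad\text{almost surely.}$$ Moreover, $$h=\overline h+h_q,\qquad\text{where}\qquad h_q=\lim_{n\to\infty}\frac1n\log q_{\overline X_n}\quad\text{almost surely,}$$ and for $w\in W$ the number $q_w$ is the cardinality of $\{x\in\Delta\mid\delta(o,x)=w\}$.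
   Context: Fuchsian Coxeter system: $S=\{s_1,\dots,s_N\}$ with $N\ge3$, and there are integers $k_1,\dots,k_N\ge2$ with $\sum_{i=1}^N 1/k_i<N-2$ such that $W$ is generated by $S$ subject to $s_i^2=e$ and $(s_is_{i+1})^{k_i}=e$ (indices cyclic, $N+1\equiv1$), with no relation between other pairs of generators. $\ell$ is word length on $W$ with respect to $S$, and $e$ is the neutral element. Building: a Fuchsian building of type $(W,S)$ is a nonempty set $\Delta$ (of chambers) with a map $\delta:\Delta\times\Delta\to W$ such that for all $x,y\in\Delta$: (B1) $\delta(x,y)=e$ iff $x=y$; (B2) if $\delta(x,y)=w$ and $\delta(y,z)=s\in S$, then $\delta(x,z)\in\{w,ws\}$, and $\delta(x,z)=ws$ if $\ell(ws)=\ell(w)+1$; (B3) if $\delta(x,y)=w$ and $s\in S$, there is $z\in\Delta$ with $\delta(y,z)=s$ and $\delta(x,z)=ws$. It is regular if for each $s\in S$ the number $q_s=|\{y\mid\delta(x,y)=s\}|$ is finite and independent of $x\in\Delta$, and thick if $|\{y\mid\delta(x,y)=s\}|\ge2$ for all $x\in\Delta$, $s\in S$. In a regular building $|\{y\mid\delta(x,y)=w\}|=q_w$ is independent of $x$, and $q_w=q_{t_1}\cdots q_{t_m}$ for any reduced expression $w=t_1\cdots t_m$. Random walk: a time-homogeneous random walk (Markov chain) $(X_n)_{n\geq 0}$ on $\Delta$ with transition probabilities $p(x,y)$ is isotropic if $p(x,y)=p(x',y')$ whenever $\delta(x,y)=\delta(x',y')$. Bounded range means there is $L_0$ such that $p(x,y)>0$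 implies $\ell(\delta(x,y))\le L_0$. Denote by $p^{(k)}(x,y)$ the $k$-step transition probabilities. The retracted walk $\overline X_n=\delta(o,X_n)$ is a Markov chain on $W$ started at $e$, with transition probabilities $\overline p(u,v)=\sum_{y:\delta(o,y)=v}p(x,y)$ for any $x$ with $\delta(o,x)=u$ (independent of the choice of $x$), and $k$-step transition probabilities $\overline p^{(k)}(u,v)$. The Green functions are $G(x,y)=\sum_{k\ge0}p^{(k)}(x,y)$ and $\overline G(u,v)=\sum_{k\ge0}\overline p^{(k)}(u,v)$. *)

(* Defs.v *)
From HB Require Import structures.
From mathcomp Require Import all_boot all_order all_algebra.
From mathcomp Require Import finmap.
From mathcomp Require Import all_classical all_reals all_analysis.

Set Implicit Arguments.
Unset Strict Implicit.
Unset Printing Implicit Defensive.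

Import Order.TTheory GRing.Theory Num.Theory.
Import numFieldNormedType.Exports.

Local Open Scope classical_set_scope.
Local Open Scope card_scope.
Local Open Scope ring_scope.

Section Coxeter.
Variables (N : nat) (W : groupType) (s : 'I_N -> W).

Definition fuchsian_relations (k : 'I_N -> nat) (G : groupType)
    (t : 'I_N -> G) : Prop :=
  forall i, (t i ^+ 2 = 1)%g /\ ((t i * t (ordS i)) ^+ k i = 1)%g.

(* The last two clauses express the presentation
   W = < s_i | s_i^2, (s_i s_(i+1))^(k i) >.  Words without inverses suffice
   for generation since the generators are involutions. *)
Definition fuchsian_coxeter_system : Prop :=
  (3 <= N)%N /\
  exists k : 'I_N -> nat,
    [/\ forall i, (2 <= k i)%N,
        \sum_(i < N) ((k i)%:R^-1 : rat) < N%:R - 2,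
        fuchsian_relations k s,
        forall w : W, exists u : seq 'I_N, w = (\prod_(i <- u) s i)%g &
        forall (G : groupType) (t : 'I_N -> G), fuchsian_relations k t ->
          exists f : {multiplicative W -> G}, forall i, f (s i) = t i].

Definition irreducible_coxeter_system : Prop :=
  ~ exists S1 S2 : set W,
      [/\ S1 !=set0, S2 !=set0, S1 `|` S2 = range s, S1 `&` S2 = set0 &
          forall a b, S1 a -> S2 b -> (a * b = b * a)%g].

Definition expressible (w : W) (n : nat) : Prop :=
  exists2 u : seq 'I_N, size u = n & w = (\prod_(i <- u) s i)%g.

Definition word_length (w : W) : nat :=
  xget 0%N [set n | expressible w n /\
                    forall m, expressible w m -> (n <= m)%N].

End Coxeter.

Section Building.
Variables (N : nat) (W : groupType) (s : 'I_N -> W).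
Variables (Delta : choiceType) (delta : Delta -> Delta -> W).

Definition sphere (x : Delta) (w : W) : set Delta := [set y | delta x y = w].

(* Nonemptiness of Delta is supplied by the base chamber. *)
Record building : Prop := Building {
  building_B1 : forall x y, delta x y = 1%g <-> x = y ;
  building_B2 : forall x y z w i, delta x y = w -> delta y z = s i ->
    (delta x z = w \/ delta x z = (w * s i)%g) /\
    (word_length s (w * s i)%g = (word_length s w).+1 ->
       delta x z = (w * s i)%g) ;
  building_B3 : forall x y w i, delta x y = w ->
    exists z, delta y z = s i /\ delta x z = (w * s i)%g
}.

(* Includes local finiteness: q is a natural number. *)
Definition regular_building : Prop :=
  forall i, exists q : nat, forall x, sphere x (s i) #= `I_q.

Definition thick_building : Prop :=
  forall x i, `I_2 #<= sphere x (s i).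

Definition sphere_card (o : Delta) (w : W) : nat := #|` fset_set (sphere o w)|.

End Building.

Section Kernels.
Variables (R : realType) (T : choiceType).

Fixpoint kstep (K : T -> T -> \bar R) (k : nat) (x y : T) : \bar R :=
  match k with
  | 0%N => if x == y then 1%E else 0%E
  | k'.+1 => (\esum_(z in [set: T]) (K x z * kstep K k' z y))%E
  end.

Definition green (K : T -> T -> \bar R) (x y : T) : \bar R :=
  (\sum_(0 <= k <oo) kstep K k x y)%E.

Definition transition_kernel (p : T -> T -> R) : Prop :=
  (forall x y, 0 <= p x y) /\
  forall x, (\esum_(y in [set: T]) (p x y)%:E)%E = 1%E.

Definition irreducible_kernel (p : T -> T -> R) : Prop :=
  forall x y, exists k, (0 < kstep (fun a b => (p a b)%:E) k x y)%E.

Section Chain.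
Variables (d : measure_display) (Omega : measurableType d).
Variable P : probability Omega R.

Definition mass (Y : Omega -> T) (x : T) : R := fine (P (Y @^-1` [set x])).

(* Random variables in T with the discrete sigma-algebra, started at o and
   satisfying, in multiplicative form,
   P(X_(n+1) = y | X_0 = x_0, .., X_n = x_n) = p(x_n, y). *)
Definition markov_chain (p : T -> T -> R) (o : T) (X : nat -> Omega -> T) :
    Prop :=
  [/\ forall n (A : set T), measurable (X n @^-1` A),
      P (X 0%N @^-1` [set o]) = 1%E &
      forall n (x : nat -> T),
        P [set w | forall j, (j <= n.+1)%N -> X j w = x j] =
        (P [set w | forall j, (j <= n)%N -> X j w = x j] *
           (p (x n) (x n.+1))%:E)%E].

Definition mean_entropy (Y : nat -> Omega -> T) (n : nat) : \bar R :=
  ((- n%:R^-1)%:E * 'E_P[fun w => ln (mass (Y n) (Y n w))])%E.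

(* lne is the logarithm on extended reals with lne +oo = +oo, so finiteness of
   the Green function is not presupposed. *)
Definition green_speed (K : T -> T -> \bar R) (x : T) (Y : nat -> Omega -> T)
    (w : Omega) (n : nat) : \bar R :=
  ((- n%:R^-1)%:E * lne (green K x (Y n w)))%E.

End Chain.
End Kernels.

Section IsotropicWalk.
Variables (R : realType) (N : nat) (W : groupType) (s : 'I_N -> W).
Variables (Delta : choiceType) (delta : Delta -> Delta -> W).

Definition isotropic (p : Delta -> Delta -> R) : Prop :=
  forall x y x' y', delta x y = delta x' y' -> p x y = p x' y'.

Definition bounded_range (p : Delta -> Delta -> R) : Prop :=
  exists L0 : nat, forall x y, 0 < p x y -> (word_length s (delta x y) <= L0)%N.

(* sum of p(x, y) over the y with delta(o, y) = v, at a chosen x with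
   delta(o, x) = u; in a regular building with p isotropic the value does not
   depend on this choice, and such an x always exists. *)
Definition retracted_kernel (o : Delta) (p : Delta -> Delta -> R) (u v : W) :
    \bar R :=
  (\esum_(y in sphere delta o v) (p (xget o (sphere delta o u)) y)%:E)%E.

End IsotropicWalk.

(* Main.v *)
(* The number [M(x, y) = sup_k p^(k)(x, y)] depends only on [delta x y] and is
   supermultiplicative, so [- log M(o, X_n)] and [log q_(delta o X_n)] are
   subadditive along the walk.  Isotropy makes successive increments of the walk
   independent as far as [delta] is concerned; a Chernoff bound on blocks for the
   upper rate and a Katznelson-Weiss covering for the lower one give almost sure
   and mean speeds of both functionals.

   The transition probabilities decay exponentially.  Indeed, the reflection
   representation provides a set [J] of two or three generators whose parabolic
   subgroup is infinite, and folding galleries, which is possible by thickness,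
   shows that no element of [W] has all of [J] as descents.  Therefore the mean
   [Q] over the [J]-panels drifts away from [o] within boundedly many steps, which
   gives a weight [f > 0] with [Q f <= rho f] and [rho < 1]; the Schur test bounds
   [Q] on l2, and some power of [p] dominates a multiple of [Q].

   Hence times beyond [K (n + 1)] are irrelevant for points at distance
   [O(n)], which makes [G], [M] and the average of the first [K (n + 1)]
   distributions comparable up to a factor [O(n)].  The Green speed is thus the
   speed of [- log M], and so is the entropy: one inequality is [pi_n <= M], the
   other Gibbs' inequality.  Finally [pibar_n = q pi_n] and [Gbar = q G]. *)

Require Import Defs.
From HB Require Import structures.
From mathcomp Require Import all_boot all_order all_algebra all_fingroup finmap.
From mathcomp Require Import all_classical all_reals all_analysis measurable_realfun.
From mathcomp Require Import zify ring lra.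

Set Implicit Arguments.
Unset Strict Implicit.
Unset Printing Implicit Defensive.

Import Order.TTheory GRing.Theory Num.Theory.
Import numFieldNormedType.Exports.

Local Open Scope classical_set_scope.
Local Open Scope card_scope.
Local Open Scope ring_scope.

(** * Word length and descents *)

(** Their substitute is the Hecke algebra: the sum of a function of [delta x z] over a sphere of
    chambers [z] about [y] depends only on [delta x y]. Hence the law of
    [delta x X_1, ..., delta x X_n] for the walk from [x] is the same for all [x]. [M] rather than
    [G] is the subadditive object because it lies in [[0, 1]], is [1] on the diagonal and is
    supermultiplicative without constants, all before the convergence of [G] is known.

    For [N >= 4] two non-adjacent generators already generate an infinite group. For [N = 3] every
    pair generates a finite group, so [J] has to consist of all three generators, and here the angle
    condition enters. By thickness a descent lowers the length by at most [1/2] on average, while an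
    ascent raises it by [1]. With three generators, two descents may therefore cancel the only
    ascent; the guaranteed one-step drift is then zero, which forces the look-ahead of [r] steps. *)

Section Length.
Variables (N : nat) (W : groupType) (s : 'I_N -> W).
Hypothesis cox : fuchsian_coxeter_system s.

Local Notation ell := (word_length s).
Definition word (u : seq 'I_N) : W := (\prod_(i <- u) s i)%g.

Lemma word_cons i u : word (i :: u) = (s i * word u)%g.
Proof. by rewrite /word big_cons. Qed.

Lemma word_cat u v : word (u ++ v) = (word u * word v)%g.
Proof. by rewrite /word big_cat. Qed.

Lemma word1 i : word [:: i] = s i.
Proof. by rewrite /word big_seq1. Qed.

Lemma word_rcons u i : word (rcons u i) = (word u * s i)%g.
Proof. by rewrite -cats1 word_cat word1. Qed.

Lemma mulss i : (s i * s i = 1)%g.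
Proof.
case: cox => _ [k [_ _ rel _ _]].
by have [+ _] := rel i; rewrite expg2.
Qed.

Lemma mulgss w i : (w * s i * s i)%g = w.
Proof. by rewrite -mulgA mulss mulg1. Qed.

Lemma invs i : ((s i)^-1 = s i)%g.
Proof. by apply: mulg1_eq; rewrite mulss. Qed.

Lemma word_rev u : word (rev u) = ((word u)^-1)%g.
Proof.
elim: u => [|i u IH]; first by rewrite /word !big_nil invg1.
by rewrite rev_cons word_rcons IH word_cons invgM invs.
Qed.

Lemma word_surj w : exists u, w = word u.
Proof. by case: cox => _ [k [_ _ _ gen _]]; exact: gen. Qed.

Lemma ell_spec w :
  expressible s w (ell w) /\ forall m, expressible s w m -> (ell w <= m)%N.
Proof.
rewrite /word_length; case: xgetP => [m _ //|none]; exfalso.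
have [u wE] := word_surj w.
have ex : exists n, `[< expressible s w n >].
  by exists (size u); apply/asboolP; exists u.
have [n /asboolP wn nmin] := ex_minnP ex.
by apply: (none n); split=> // m wm; apply: nmin; apply/asboolP.
Qed.

Lemma ell_reduced w : exists2 u, size u = ell w & w = word u.
Proof. by have [[u]] := ell_spec w; exists u. Qed.

Lemma ell_word u : (ell (word u) <= size u)%N.
Proof. by have [_ min] := ell_spec (word u); apply: min; exists u. Qed.

Lemma ell1 : ell 1%g = 0%N.
Proof. by apply/eqP; rewrite -leqn0; have := ell_word [::]; rewrite /word big_nil. Qed.

Lemma ell_mul v w : (ell (v * w)%g <= ell v + ell w)%N.
Proof.
have [u <- ->] := ell_reduced v; have [u' <- ->] := ell_reduced w.
by rewrite -word_cat -size_cat ell_word.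
Qed.

Lemma ell_s_le1 i : (ell (s i) <= 1)%N.
Proof. by rewrite -(word1 i) ell_word. Qed.

Lemma ell_inv w : ell (w^-1)%g = ell w.
Proof.
apply/eqP; rewrite eqn_leq; apply/andP; split.
  by have [u <- ->] := ell_reduced w; rewrite -word_rev -size_rev ell_word.
rewrite -{1}(invgK w).
by have [u <- ->] := ell_reduced (w^-1)%g; rewrite -word_rev -size_rev ell_word.
Qed.

(** The relators have even length, so the sign character exists; [{perm bool}] serves as the group
    of order two, with [odd_perm] reading off the parity. *)
Lemma sign_hom : exists f : {multiplicative W -> {perm bool}},
  forall i, f (s i) = tperm true false.
Proof.
case: cox => _ [k [_ _ _ _ univ]]; apply: univ => i.
by rewrite expg2 /= tperm2; split=> //; rewrite expg1n.
Qed.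

Lemma word_parity u v : word u = word v -> odd (size u) = odd (size v).
Proof.
have [f fs] := sign_hom.
have fw x : odd_perm (f (word x)) = odd (size x).
  elim: x => [|i x IH].
    have f1 : f 1%g = 1%g.
      by apply: (@mulgI _ (f 1%g)); rewrite -gmulfM !mulg1.
    by rewrite /word big_nil f1 odd_perm1.
  by rewrite word_cons gmulfM odd_permM fs odd_tperm IH.
by move=> /(congr1 f) /(congr1 (@odd_perm _)); rewrite !fw.
Qed.

Lemma ell_parity u : odd (ell (word u)) = odd (size u).
Proof. by have [v <- /word_parity] := ell_reduced (word u). Qed.

Lemma ell_mulsP w i : ell (w * s i)%g = (ell w).+1 \/ ell w = (ell (w * s i)%g).+1.
Proof.
have odE : odd (ell (w * s i)%g) = ~~ odd (ell w).
  have [u su ->] := ell_reduced w.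
  by rewrite -word_rcons !ell_parity size_rcons.
have h1 : (ell (w * s i)%g <= ell w + 1)%N.
  by apply: leq_trans (ell_mul _ _) _; rewrite leq_add2l ell_s_le1.
have h2 : (ell w <= ell (w * s i)%g + 1)%N.
  rewrite -{1}(mulgss w i); apply: leq_trans (ell_mul _ _) _.
  by rewrite leq_add2l ell_s_le1.
lia.
Qed.

Lemma s_neq1 i : s i <> 1%g.
Proof. by move=> si1; have := ell_mulsP 1%g i; rewrite si1 mulg1 ell1; case. Qed.

Lemma ell_s i : ell (s i) = 1%N.
Proof. by have := ell_mulsP 1%g i; rewrite mul1g ell1; case. Qed.

Definition descent w i := (ell (w * s i)%g < ell w)%N.

Lemma descentF w i : descent w i = false -> ell (w * s i)%g = (ell w).+1.
Proof. by rewrite /descent; have := ell_mulsP w i; lia. Qed.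

Lemma descentT w i : descent w i -> ell w = (ell (w * s i)%g).+1.
Proof. by rewrite /descent; have := ell_mulsP w i; lia. Qed.

Lemma descent_muls w i : descent (w * s i)%g i = ~~ descent w i.
Proof. by rewrite /descent mulgss; have := ell_mulsP w i; lia. Qed.

Definition reduced u := ell (word u) == size u.

Lemma reduced_rcons u i : reduced (rcons u i) = reduced u && ~~ descent (word u) i.
Proof.
rewrite /reduced word_rcons size_rcons /descent.
by have := ell_mulsP (word u) i; have := ell_word u; lia.
Qed.

Lemma reduced_rev u : reduced (rev u) = reduced u.
Proof. by rewrite /reduced word_rev ell_inv size_rev. Qed.

Lemma reduced_cons i u : reduced (i :: u) -> reduced u.
Proof.
by rewrite -reduced_rev rev_cons reduced_rcons reduced_rev => /andP[].
Qed.

Lemma red_word w : exists2 u, reduced u & w = word u.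
Proof. by have [u su wE] := ell_reduced w; exists u; rewrite // /reduced -wE su. Qed.

Lemma reduced_ind (P : W -> Prop) : P 1%g ->
  (forall w i, ~~ descent w i -> P w -> P (w * s i)%g) -> forall w, P w.
Proof.
move=> P1 PS w; have [u ru ->] := red_word w.
elim/last_ind: u ru => [|u i IH]; first by rewrite /word big_nil.
by rewrite reduced_rcons word_rcons => /andP[/IH Pu di]; apply: PS.
Qed.

End Length.

(** * Galleries and the exchange condition in a thick building *)

Section BuildingBasics.
Variables (N : nat) (W : groupType) (s : 'I_N -> W).
Hypothesis cox : fuchsian_coxeter_system s.
Variables (Delta : choiceType) (delta : Delta -> Delta -> W).
Hypothesis bld : building s delta.

Local Notation ell := (word_length s).
Local Notation word := (word s).
Local Notation descent := (descent s).
Local Notation reduced := (reduced s).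

Lemma delta1P x y : delta x y = 1%g <-> x = y.
Proof. by case: bld => B1 _ _; exact: B1. Qed.

Lemma delta_refl x : delta x x = 1%g.
Proof. exact/delta1P. Qed.

Lemma delta_sym1 x y i : delta x y = s i -> delta y x = s i.
Proof.
move=> xy; have [z [yz xz]] := building_B3 bld i xy.
by move: xz; rewrite (mulss cox) => /delta1P ->.
Qed.

Lemma delta_step x y z i : delta y z = s i ->
  delta x z = delta x y \/ delta x z = (delta x y * s i)%g.
Proof. by move=> yz; have [+ _] := building_B2 bld (erefl (delta x y)) yz. Qed.

Lemma delta_ascent x y z i : delta y z = s i -> ~~ descent (delta x y) i ->
  delta x z = (delta x y * s i)%g.
Proof.
move=> yz /negbTE/(descentF cox) asc.
by have [_ ->] := building_B2 bld (erefl (delta x y)) yz.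
Qed.

Lemma panel_trans x y z i : delta x y = s i -> delta y z = s i ->
  z = x \/ delta x z = s i.
Proof.
move=> xy yz; have := delta_step x yz; rewrite xy (mulss cox).
by case=> [|/delta1P] ->; [right|left].
Qed.

Lemma delta_back x y i : exists z, delta y z = s i /\ delta x z = (delta x y * s i)%g.
Proof. exact: (building_B3 bld i (erefl (delta x y))). Qed.

Fixpoint gallery x (u : seq 'I_N) y : Prop :=
  if u is i :: u' then exists z, delta x z = s i /\ gallery z u' y else x = y.

Lemma gallery_cat x u v y :
  gallery x (u ++ v) y <-> exists z, gallery x u z /\ gallery z v y.
Proof.
elim: u x => [|i u IH] x /=; first by split=> [g|[z [-> //]]]; exists x.
split=> [[z [xz /IH [t [g1 g2]]]]|[t [[z [xz g1]] g2]]].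
  by exists t; split=> //; exists z.
by exists z; split=> //; apply/IH; exists t.
Qed.

Lemma gallery_rcons x u i y :
  gallery x (rcons u i) y <-> exists z, gallery x u z /\ delta z y = s i.
Proof.
rewrite -cats1 gallery_cat /=; split=> -[z [g1 g2]]; exists z; split=> //.
  by case: g2 => t [? <-].
by exists y.
Qed.

Lemma gallery_rev x u y : gallery x u y -> gallery y (rev u) x.
Proof.
elim: u x => [|i u IH] x /=; first by move=> ->.
case=> z [xz /IH g]; rewrite rev_cons gallery_rcons; exists z; split=> //.
exact: delta_sym1.
Qed.

Lemma gallery_ex x y u : delta x y = word u -> gallery x u y.
Proof.
elim/last_ind: u y => [|u i IH] y.
  by rewrite /word big_nil => /delta1P.
rewrite word_rcons => xy; have [z [yz xz]] := delta_back x y i.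
apply/gallery_rcons; exists z; split; last exact: delta_sym1.
by apply: IH; rewrite xz xy (mulgss cox).
Qed.

Lemma gallery_reduced x u y : reduced u -> gallery x u y -> delta x y = word u.
Proof.
elim/last_ind: u y => [|u i IH] y.
  by move=> _ /= ->; rewrite delta_refl /word big_nil.
rewrite (reduced_rcons cox) word_rcons => /andP[ru asc] /gallery_rcons[z [g zy]].
by have xz := IH _ ru g; rewrite (delta_ascent zy) xz.
Qed.

Lemma delta_inv x y : delta y x = ((delta x y)^-1)%g.
Proof.
have [u ru xy] := red_word cox (delta x y).
have := gallery_rev (gallery_ex xy).
move/(gallery_reduced _) => ->; first by rewrite (word_rev cox) xy.
by rewrite (reduced_rev cox).
Qed.

Lemma delta_stepl x y z i : delta x z = s i ->
  delta x y = delta z y \/ delta x y = (s i * delta z y)%g.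
Proof.
move=> /delta_sym1 zx; have := delta_step y zx.
rewrite (delta_inv x y) (delta_inv z y) => -[/invg_inj|]; [by left|right].
by apply: (@invg_inj W); rewrite invgM (invs cox).
Qed.

Lemma ell_gallery x u y : gallery x u y -> (ell (delta x y) <= size u)%N.
Proof.
elim: u x => [|i u IH] x /=; first by move=> ->; rewrite delta_refl (ell1 cox).
case=> z [xz /IH g]; have [->|->] := delta_stepl y xz; first by lia.
by apply: leq_trans (ell_mul cox _ _) _; have := ell_s_le1 cox i; lia.
Qed.

Lemma ell_delta_triangle x y z :
  (ell (delta x z) <= ell (delta x y) + ell (delta y z))%N.
Proof.
have [u <- xy] := ell_reduced cox (delta x y).
have [v <- yz] := ell_reduced cox (delta y z).
rewrite -size_cat; apply: ell_gallery; apply/gallery_cat; exists y.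
by split; apply: gallery_ex.
Qed.

Lemma sphere_nonempty x w : exists y, delta x y = w.
Proof.
have [u ->] := word_surj cox w; elim/last_ind: u => [|u i [y xy]].
  by exists x; rewrite delta_refl /word big_nil.
by have [z [_ xz]] := delta_back x y i; exists z; rewrite xz xy word_rcons.
Qed.

(** Uniqueness of the gate, the chamber of a panel nearest to [x]: two gates would be [i]-adjacent,
    and passing from one to the other would be an ascent, so their distances from [x] would
    differ. *)
Lemma descent_uniq x y i z1 z2 : descent (delta x y) i ->
  delta y z1 = s i -> delta y z2 = s i ->
  delta x z1 = (delta x y * s i)%g -> delta x z2 = (delta x y * s i)%g -> z1 = z2.
Proof.
move=> d yz1 yz2 xz1 xz2.
have [->//|z12] := panel_trans (delta_sym1 yz1) yz2.
have := delta_ascent (x := x) z12; rewrite xz1 (descent_muls cox) d => /(_ isT).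
rewrite xz2 mulgss // => e; exfalso.
have := descentT cox d; rewrite e.
lia.
Qed.

Hypothesis reg : regular_building s delta.

Lemma sphere_finite x w : finite_set (sphere delta x w).
Proof.
have [u ->] := word_surj cox w; elim/last_ind: u => [|u i IH].
  apply: (sub_finite_set (B := [set x])); last exact: finite_set1.
  by move=> y /=; rewrite /sphere /word big_nil /= => /delta1P.
apply: (sub_finite_set
  (B := \bigcup_(z in sphere delta x (word u)) sphere delta z (s i))).
  move=> y; rewrite /sphere /= => xy.
  have [z [yz xz]] := delta_back x y i.
  exists z; rewrite /sphere /=; last exact: delta_sym1.
  by rewrite xz xy word_rcons (mulgss cox).
apply: bigcup_finite => // z _; have [q /(_ z) qz] := reg i.
by exists q.
Qed.

Definition sph x w : seq Delta := enum_fset (fset_set (sphere delta x w)).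

Lemma mem_sph x w y : (y \in sph x w) = (delta x y == w).
Proof.
have := in_fset_set (sphere_finite x w) y.
rewrite /sph => ->; apply/idP/eqP; by rewrite inE.
Qed.

Lemma sph_uniq x w : uniq (sph x w).
Proof. exact: fset_uniq. Qed.

Definition qpar i : nat := xget 0%N [set q | forall x, sphere delta x (s i) #= `I_q].

Lemma size_sph1 x i : size (sph x (s i)) = qpar i.
Proof.
rewrite /qpar; case: xgetP => [q _ /= Hq|none]; last first.
  by have [q Hq] := reg i; case: (none q).
exact: card_fset_set (Hq x).
Qed.

Hypothesis thick : thick_building s delta.

Lemma qpar_ge2 (x : Delta) i : (2 <= qpar i)%N.
Proof.
rewrite -(size_sph1 x i); apply: leq_card_fset_set; first exact: sphere_finite.
exact: thick.
Qed.

Lemma panel_third x y i : delta x y = s i ->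
  exists z, [/\ delta x z = s i, delta y z = s i & z <> y].
Proof.
move=> xy; have : (1 < size (sph x (s i)))%N by rewrite size_sph1 (qpar_ge2 x).
have := sph_uniq x (s i); have : forall z, z \in sph x (s i) -> delta x z = s i.
  by move=> z; rewrite mem_sph => /eqP.
case: (sph x (s i)) => [|a [|b l]] //= mem /and3P[+ _ _] _.
rewrite inE negb_or => /andP[/eqP ab _].
have [z xz zy] : exists2 z, delta x z = s i & z <> y.
  have [ay|] := eqVneq a y; last by move/eqP; exists a => //; apply: mem; rewrite inE eqxx.
  by exists b; [apply: mem; rewrite !inE eqxx orbT|rewrite -ay => /esym].
exists z; split=> //.
by have [|//] := panel_trans (delta_sym1 xy) xz.
Qed.

(** Of the panel only the gate is at distance [delta x y * s i]; a third chamber, supplied by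
    thickness, is neither [y] nor the gate and so keeps the distance of [y]. *)
Lemma fold_back x y i : descent (delta x y) i ->
  exists z, delta y z = s i /\ delta x z = delta x y.
Proof.
move=> d; have [z [yz xz]] := delta_back x y i.
have [t [yt zt tz]] := panel_third yz.
exists t; split=> //; have [//|xt] := delta_step x yt.
by case: tz; apply: descent_uniq d _ _ xt xz.
Qed.

(** The distance to [y] is followed backwards along the gallery. If the letter [j] does not show up
    in it, then [delta z y = delta t y = word u * s i], while (B2) allows only [delta z x] or
    [delta z x * s i]. Equality with [delta z x] means [s j * word u = word u * s i], and this is
    the deletion of [j]. *)
Lemma gallery_deletion z u x y i : reduced u -> gallery z u x -> delta x y = s i ->
  delta z y = (word u * s i)%g \/
  exists u1 j u2, u = u1 ++ j :: u2 /\ (word u * s i)%g = word (u1 ++ u2).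
Proof.
elim: u z => [|j u IH] z ru g xy.
  by left; rewrite (g : z = x) /word big_nil mul1g.
have zx := gallery_reduced ru g.
case: g => t [zt g].
have [ty|[u1 [l [u2 [-> uE]]]]] := IH t (reduced_cons cox ru) g xy; last first.
  right; exists (j :: u1), l, u2; split=> //.
  by rewrite word_cons -mulgA uE -word_cons.
have [zy|zy] := delta_stepl y zt; last by left; rewrite zy ty word_cons mulgA.
have := delta_step z xy; rewrite zx => -[e|]; last by left.
right; exists [::], j, u; split=> //=.
by rewrite -e zy ty (mulgss cox).
Qed.

(* Thickness allows one to fold a gallery of type [u] back at a descent [i], so
   the first alternative of [gallery_deletion] fails for the folded gallery. *)
Lemma exchange (o : Delta) u i : reduced u -> descent (word u) i ->
  exists u1 j u2, u = u1 ++ j :: u2 /\ (word u * s i)%g = word (u1 ++ u2).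
Proof.
move=> ru d; have [x ox] := sphere_nonempty o (word u).
have [y [xy oy]] : exists y, delta x y = s i /\ delta o y = delta o x.
  by apply: fold_back; rewrite ox.
have [e|//] := gallery_deletion ru (gallery_ex ox) xy.
exfalso; apply: (s_neq1 cox (i := i)); apply: (@mulgI _ (word u)).
by rewrite -e oy ox mulg1.
Qed.

(* A shortest word in letters from [J] is reduced, by the exchange condition. *)
Lemma parabolic_reduced (o : Delta) (J : pred 'I_N) u : all J u ->
  exists v, [/\ all J v, reduced v & word v = word u].
Proof.
have [n] := ubnP (size u); elim: n u => // n IH u; rewrite ltnS => un Ju.
have [ru|nru] := boolP (reduced u); first by exists u.
suff [v [Jv vu ->]] : exists v, [/\ all J v, (size v < size u)%N & word u = word v].
  have [w [Jw rw <-]] := IH v (leq_trans vu un) Jv.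
  by exists w.
elim/last_ind: u {un} Ju nru => [_|u i IHu].
  by rewrite /reduced /word big_nil (ell1 cox).
rewrite all_rcons (reduced_rcons cox) => /andP[Ji Ju].
have [ru /=|nru _] := boolP (reduced u); last first.
  have [v [Jv vu uE]] := IHu Ju nru; exists (rcons v i).
  by rewrite all_rcons Ji Jv !size_rcons ltnS vu !word_rcons uE.
rewrite negbK => d; have [u1 [j [u2 [uE wE]]]] := exchange o ru d.
exists (u1 ++ u2); split; last by rewrite word_rcons.
  by move: Ju; rewrite uE !all_cat /= => /and3P[-> _ ->].
by rewrite uE size_rcons !size_cat /=; lia.
Qed.

(* If all letters of [J] are descents of [w], a reduced gallery in [J] starting
   at distance [w] from [o] can be folded so as to stay at distance [w]; its
   endpoints are then within [2 ell w] of each other. *)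
Lemma descents_bound (o : Delta) (J : pred 'I_N) w u :
  (forall i, J i -> descent w i) -> all J u -> (ell (word u) <= 2 * ell w)%N.
Proof.
move=> dJ /(parabolic_reduced o)[v [Jv rv <-]].
have [x ox] := sphere_nonempty o w.
suff [y [oy xy]] : exists y, delta o y = w /\ delta x y = word v.
  rewrite -xy mul2n -addnn; apply: leq_trans (ell_delta_triangle x o y) _.
  by rewrite (delta_inv o x) (ell_inv cox) ox oy.
elim/last_ind: v rv Jv => [_ _|v i IH].
  by exists x; rewrite delta_refl /word big_nil.
rewrite (reduced_rcons cox) all_rcons => /andP[rv asc] /andP[Ji Jv].
have [y [oy xy]] := IH rv Jv.
have [|z [yz oz]] := @fold_back o y i; first by rewrite oy; exact: dJ.
exists z; rewrite oz oy (delta_ascent yz) xy ?word_rcons //.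
Qed.

End BuildingBasics.

(** * Spheres and their cardinalities *)

Section Hecke.
Variables (N : nat) (W : groupType) (s : 'I_N -> W).
Hypothesis cox : fuchsian_coxeter_system s.
Variables (Delta : choiceType) (delta : Delta -> Delta -> W).
Hypothesis bld : building s delta.
Hypothesis reg : regular_building s delta.
Variable R : realType.

Local Notation ell := (word_length s).
Local Notation word := (word s).
Local Notation descent := (descent s).
Local Notation reduced := (reduced s).
Local Notation sph := (sph delta).
Local Notation qpar := (qpar s delta).

(** A generator of the Hecke algebra acting on functions of the Weyl distance. At a descent the
    panel contributes its gate once and the other [q - 1] chambers at the old distance. *)
Definition hecke1 i (g : W -> R) (w : W) : R :=
  if descent w i then g (w * s i)%g + (qpar i)%:R * g w - g w
  else (qpar i)%:R * g (w * s i)%g.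

Lemma hecke1P x y i (g : W -> R) :
  \sum_(z <- sph y (s i)) g (delta x z) = hecke1 i g (delta x y).
Proof.
rewrite /hecke1; case: ifP => [d|/negbT asc]; last first.
  rewrite big_seq (eq_bigr (fun=> g (delta x y * s i)%g)) => [|z]; last first.
    by rewrite (mem_sph cox bld reg) => /eqP yz; rewrite (delta_ascent cox bld yz asc).
  rewrite -big_seq big_const_seq count_predT iter_addr_0.
  by rewrite (size_sph1 reg) mulr_natl.
have [z0 [yz0 xz0]] := delta_back bld x y i.
have z0in : z0 \in sph y (s i) by rewrite (mem_sph cox bld reg) yz0.
rewrite (perm_big _ (perm_to_rem z0in)) big_cons xz0 -addrA; congr (_ + _).
rewrite big_seq (eq_bigr (fun=> g (delta x y))) => [|z]; last first.
  rewrite mem_rem_uniq ?sph_uniq // inE (mem_sph cox bld reg) => /andP[/eqP zz0 /eqP yz].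
  have [->//|xz] := delta_step bld x yz.
  by case: zz0; apply: descent_uniq d yz yz0 xz xz0.
rewrite -big_seq big_const_seq count_predT iter_addr_0 size_rem //.
rewrite (size_sph1 reg).
have q0 : (0 < qpar i)%N.
  by rewrite -(size_sph1 reg y) lt0n size_eq0; apply/eqP => e; rewrite e in z0in.
by rewrite -(prednK q0) /= -addn1 natrD mulrDl mul1r addrK mulr_natl.
Qed.

(** Along an ascent each chamber of the larger sphere has exactly one [i]-neighbour in the smaller
    one, namely the gate of its panel. *)
Lemma sph_split y v i (h : Delta -> R) : ~~ descent v i ->
  \sum_(z <- sph y (v * s i)%g) h z =
  \sum_(t <- sph y v) \sum_(z <- sph t (s i)) h z.
Proof.
move=> asc.
have st t : t \in sph y v -> \sum_(z <- sph t (s i)) h z =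
    \sum_(z <- sph y (v * s i)%g | delta t z == s i) h z.
  rewrite (mem_sph cox bld reg) => /eqP yt; rewrite -[RHS]big_filter; apply: perm_big.
  apply: uniq_perm; rewrite ?filter_uniq ?sph_uniq // => z.
  rewrite mem_filter !(mem_sph cox bld reg); case: eqP => //= tz.
  by rewrite (delta_ascent cox bld tz) yt ?eqxx.
rewrite [RHS]big_seq (eq_bigr _ st) -big_seq.
rewrite (exchange_big_dep predT) //= big_seq [RHS]big_seq; apply: eq_bigr => z.
rewrite (mem_sph cox bld reg) => /eqP yz.
have [t [zt yt]] := delta_back bld y z i; move: yt; rewrite yz (mulgss cox) => yt.
have tin : t \in sph y v by rewrite (mem_sph cox bld reg) yt.
rewrite -big_filter (_ : [seq _ <- _ | _] = [:: t]) ?big_seq1 //.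
apply: perm_small_eq => //; apply: uniq_perm; rewrite ?filter_uniq ?sph_uniq // => t'.
rewrite mem_filter (mem_sph cox bld reg) inE; apply/andP/eqP => [[/eqP tz /eqP yt']|->].
  apply: (@descent_uniq _ _ _ cox _ _ bld y z i) => //; rewrite ?yz ?(mulgss cox) //.
    by rewrite (descent_muls cox).
  exact: (delta_sym1 cox bld).
by rewrite yt (delta_sym1 cox bld zt).
Qed.

(** The shape of [tau] is irrelevant below; what matters is that the sum depends on [x] and [y]
    through [delta x y] only. Isotropy is exploited in this form. *)
Lemma heckeP v : exists tau : (W -> R) -> W -> R, forall x y g,
  \sum_(z <- sph y v) g (delta x z) = tau g (delta x y).
Proof.
elim/(reduced_ind cox): v => [|v i asc [tau tauP]].
  exists id => x y g; rewrite (_ : sph y 1%g = [:: y]) ?big_seq1 //.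
  apply: perm_small_eq => //; apply: uniq_perm; rewrite ?sph_uniq // => z.
  rewrite (mem_sph cox bld reg) inE.
  by apply/eqP/eqP => [/(delta1P bld) ->//|->]; rewrite (delta_refl bld).
exists (fun g => tau (hecke1 i g)) => x y g.
by rewrite sph_split // -tauP; apply: eq_bigr => t _; exact: hecke1P.
Qed.

Lemma size_sph_mul x w i : ~~ descent w i ->
  size (sph x (w * s i)%g) = (size (sph x w) * qpar i)%N.
Proof.
move=> asc; have := sph_split x (fun=> 1) asc.
rewrite big_const_seq count_predT iter_addr_0.
under eq_bigr do rewrite big_const_seq count_predT iter_addr_0 (size_sph1 reg).
rewrite big_const_seq count_predT iter_addr_0 -mulrnA => /eqP.
by rewrite eqr_nat => /eqP ->; rewrite mulnC.
Qed.

Lemma sph_1 x : sph x 1%g = [:: x].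
Proof.
apply: perm_small_eq => //; apply: uniq_perm; rewrite ?sph_uniq // => z.
rewrite (mem_sph cox bld reg) inE.
by apply/eqP/eqP => [/(delta1P bld) ->//|->]; rewrite (delta_refl bld).
Qed.

Lemma size_sph_word x u : reduced u ->
  size (sph x (word u)) = (\prod_(i <- u) qpar i)%N.
Proof.
elim/last_ind: u => [|u i IH]; first by rewrite /word !big_nil sph_1.
rewrite (reduced_rcons cox) word_rcons => /andP[ru asc].
by rewrite size_sph_mul // IH // -cats1 big_cat /= big_seq1.
Qed.

Lemma size_sph_inv x w : size (sph x (w^-1)%g) = size (sph x w).
Proof.
have [u ru ->] := red_word cox w; rewrite -(word_rev cox) !size_sph_word //.
  by apply: perm_big; rewrite perm_rev.
by rewrite (reduced_rev cox).
Qed.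

Lemma size_sph_gt0 x w : (0 < size (sph x w))%N.
Proof.
have [y xy] := sphere_nonempty cox bld x w.
have : y \in sph x w by rewrite (mem_sph cox bld reg) xy.
by case: (sph x w).
Qed.

Lemma size_sph_step x w i :
  (size (sph x (w * s i)%g) <= size (sph x w) * qpar i)%N.
Proof.
have [d|/size_sph_mul -> //] := boolP (descent w i).
have q0 : (0 < qpar i)%N by rewrite -(size_sph1 reg x) size_sph_gt0.
have -> : size (sph x w) = (size (sph x (w * s i)%g) * qpar i)%N.
  by rewrite -size_sph_mul ?(mulgss cox) // (descent_muls cox) d.
by rewrite -mulnA leq_pmulr // muln_gt0 q0.
Qed.

Lemma size_sph_triangle o x y z :
  (size (sph o (delta x z)) <= size (sph o (delta x y)) * size (sph o (delta y z)))%N.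
Proof.
have [u ru yz] := red_word cox (delta y z).
rewrite yz; move: (gallery_ex cox bld yz) => {yz}.
elim/last_ind: u ru z => [|u i IH] ru z.
  by move=> /= <-; rewrite /word big_nil sph_1 muln1.
move: ru; rewrite (reduced_rcons cox) => /andP[ru asc].
move/gallery_rcons => [t [g tz]]; rewrite word_rcons size_sph_mul // mulnA.
have tle := IH ru t g.
have q0 : (0 < qpar i)%N by rewrite -(size_sph1 reg x) size_sph_gt0.
have [->|->] := delta_step bld x tz.
  by apply: leq_trans tle _; rewrite leq_pmulr.
by apply: leq_trans (size_sph_step _ _ _) _; rewrite leq_mul2r tle orbT.
Qed.

Fixpoint ballW n : seq W :=
  if n is n'.+1 then
    undup (ballW n' ++ [seq (w * s i)%g | w <- ballW n', i <- enum 'I_N])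
  else [:: 1%g].

Lemma mem_ballW n w : (w \in ballW n) = (ell w <= n)%N.
Proof.
apply/idP/idP.
  elim: n w => [|n IH] w /=; first by rewrite inE => /eqP ->; rewrite (ell1 cox).
  rewrite mem_undup mem_cat => /orP[/IH/leqW//|/allpairsP[[v i] /= [/IH vn _ ->]]].
  by apply: leq_trans (ell_mul cox _ _) _; rewrite (ell_s cox); lia.
have [u <- ->] := ell_reduced cox w.
elim: n u => [|n IH] u; first by rewrite leqn0 => /eqP/size0nil ->; rewrite /word big_nil inE.
case/lastP: u => [|u i]; rewrite /= mem_undup mem_cat.
  by move=> _; rewrite IH.
rewrite size_rcons ltnS => /IH un; apply/orP; right.
by apply/allpairsP; exists (word u, i); rewrite /= mem_enum word_rcons; split.
Qed.

Lemma ballW_uniq n : uniq (ballW n).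
Proof. by case: n => //= n; rewrite undup_uniq. Qed.

Definition cball n x : seq Delta := flatten [seq sph x w | w <- ballW n].

Lemma mem_cball n x y : (y \in cball n x) = (ell (delta x y) <= n)%N.
Proof.
rewrite -mem_ballW; apply/flatten_mapP/idP => [[w wn]|xyn].
  by rewrite (mem_sph cox bld reg) => /eqP ->.
by exists (delta x y); rewrite // (mem_sph cox bld reg).
Qed.

Lemma cball_uniq n x : uniq (cball n x).
Proof.
rewrite /cball; elim: (ballW n) (ballW_uniq n) => [|w l IH] //= /andP[wl /IH ul].
rewrite cat_uniq sph_uniq ul andbT; apply/hasPn => y /flatten_mapP[v vl].
rewrite !(mem_sph cox bld reg) => /eqP ->; apply: contra wl => /eqP <-; exact: vl.
Qed.

Lemma big_cball n x (h : Delta -> R) :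
  \sum_(y <- cball n x) h y = \sum_(w <- ballW n) \sum_(y <- sph x w) h y.
Proof. by rewrite /cball big_flatten /= big_map. Qed.

End Hecke.

(** * Infinite parabolic subgroups via the reflection representation *)

Section UnitMatrixGroup.
Variables (R : realType) (n : nat).

(** The target of the reflection representation: the universal property of the presentation asks for
    a [groupType]. *)
Definition unit_matrix := {A : 'M[R]_n | A \in unitmx}.

HB.instance Definition _ := Choice.on unit_matrix.

Fact unit_matrix_mulP (A B : unit_matrix) : val A *m val B \in unitmx.
Proof. by rewrite unitmx_mul (valP A) (valP B). Qed.

Fact unit_matrix_invP (A : unit_matrix) : invmx (val A) \in unitmx.
Proof. by rewrite unitmx_inv (valP A). Qed.

Definition unit_matrix_one : unit_matrix :=
  exist (fun M : 'M[R]_n => M \in unitmx) _ (unitmx1 R n).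
Definition unit_matrix_mul A B : unit_matrix :=
  exist (fun M : 'M[R]_n => M \in unitmx) _ (unit_matrix_mulP A B).
Definition unit_matrix_inv A : unit_matrix :=
  exist (fun M : 'M[R]_n => M \in unitmx) _ (unit_matrix_invP A).

Fact unit_matrix_mulA : associative unit_matrix_mul.
Proof. by move=> A B C; apply: val_inj; rewrite /= mulmxA. Qed.
Fact unit_matrix_mul1 : left_id unit_matrix_one unit_matrix_mul.
Proof. by move=> A; apply: val_inj; rewrite /= mul1mx. Qed.
Fact unit_matrix_1mul : right_id unit_matrix_one unit_matrix_mul.
Proof. by move=> A; apply: val_inj; rewrite /= mulmx1. Qed.
Fact unit_matrix_mulV : left_inverse unit_matrix_one unit_matrix_inv unit_matrix_mul.
Proof. by move=> A; apply: val_inj; rewrite /= mulVmx ?(valP A). Qed.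
Fact unit_matrix_Vmul : right_inverse unit_matrix_one unit_matrix_inv unit_matrix_mul.
Proof. by move=> A; apply: val_inj; rewrite /= mulmxV ?(valP A). Qed.

HB.instance Definition _ := isGroup.Build unit_matrix unit_matrix_mulA
  unit_matrix_mul1 unit_matrix_1mul unit_matrix_mulV unit_matrix_Vmul.

Lemma val_unit_mul (A B : unit_matrix) : val (A * B)%g = val A *m val B.
Proof. by []. Qed.

Lemma val_unit_one : val (1%g : unit_matrix) = 1%:M.
Proof. by []. Qed.

End UnitMatrixGroup.

Section Reflections.
Variables (R : realType) (n : nat).

Definition mxrefl (a : 'cV[R]_n) (alpha : 'rV[R]_n) : 'M[R]_n :=
  1%:M - 2 *: (a *m alpha).

Lemma mxrefl2 a alpha : alpha *m a = 1%:M -> mxrefl a alpha *m mxrefl a alpha = 1%:M.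
Proof.
move=> aa; rewrite /mxrefl mulmxBr mulmx1 mulmxBl mul1mx -!scalemxAl -scalemxAr.
rewrite -mulmxA (mulmxA alpha) aa mul1mx.
by apply/matrixP => i j; rewrite !mxE; ring.
Qed.

Variables (a b : 'cV[R]_n) (alpha beta : 'rV[R]_n) (t : R).
Hypothesis aa : alpha *m a = 1%:M.
Hypothesis bb : beta *m b = 1%:M.
Hypothesis ab : alpha *m b = (- cos t)%:M.
Hypothesis ba : beta *m a = (- cos t)%:M.

(** Products of the two reflections stay in the span of [1] and these four rank-one matrices, so
    iterating them becomes a recursion on four scalars. *)
Let E (x y z u : R) : 'M[R]_n := 1%:M + x *: (a *m alpha) + y *: (a *m beta) +
  z *: (b *m alpha) + u *: (b *m beta).

Let Ea x y z u : E x y z u *m mxrefl a alpha =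
  E (- x - 2 + 2 * cos t * y) y (- z + 2 * cos t * u) u.
Proof.
rewrite /mxrefl mulmxBr mulmx1 -scalemxAr mulmxA.
have -> : E x y z u *m a = (1 + x - cos t * y) *: a + (z - cos t * u) *: b.
  rewrite /E !mulmxDl -!scalemxAl -!mulmxA aa ba mul1mx !mul_mx_scalar.
  by apply/matrixP => i j; rewrite !mxE; ring.
rewrite mulmxDl -!scalemxAl /E.
by apply/matrixP => i j; rewrite !mxE !big_ord1; ring.
Qed.

Let Eb x y z u : E x y z u *m mxrefl b beta =
  E x (- y + 2 * cos t * x) z (- u - 2 + 2 * cos t * z).
Proof.
rewrite /mxrefl mulmxBr mulmx1 -scalemxAr mulmxA.
have -> : E x y z u *m b = (y - cos t * x) *: a + (1 + u - cos t * z) *: b.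
  rewrite /E !mulmxDl -!scalemxAl -!mulmxA bb ab mul1mx !mul_mx_scalar.
  by apply/matrixP => i j; rewrite !mxE; ring.
rewrite mulmxDl -!scalemxAl /E.
by apply/matrixP => i j; rewrite !mxE !big_ord1; ring.
Qed.

(* In the plane spanned by [a] and [b] the product of the two reflections is
   the rotation by [2 t]. *)
Lemma mxrefl_iter m : sin t != 0 ->
  iter m (fun M => M *m (mxrefl a alpha *m mxrefl b beta)) 1%:M =
  let c := cos (m%:R * (2 * t)) in let s := sin (m%:R * (2 * t)) in
  E ((c - 1) / sin t ^+ 2) ((cos t * (c - 1) - sin t * s) / sin t ^+ 2)
    ((cos t * (c - 1) + sin t * s) / sin t ^+ 2) ((c - 1) / sin t ^+ 2).
Proof.
move=> s0; elim: m => [|m IH] /=.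
  rewrite mul0r cos0 sin0 /E subrr !mulr0 subrr addr0 !mul0r.
  by rewrite !scale0r !addr0.
rewrite IH /= mulmxA Ea Eb.
have s2 : sin t * sin t = 1 - cos t * cos t.
  by rewrite -!expr2 -(cos2Dsin2 t) addrC addKr.
have c2t : cos (2 * t) = 1 - 2 * sin t ^+ 2.
  by rewrite (_ : 2 * t = t + t) ?cosD ?expr2; [rewrite s2; ring|ring].
have s2t : sin (2 * t) = 2 * sin t * cos t.
  by rewrite (_ : 2 * t = t + t) ?sinD; ring.
rewrite (_ : m.+1%:R * (2 * t) = m%:R * (2 * t) + 2 * t); last first.
  by rewrite -natr1; ring.
rewrite cosD sinD c2t s2t.
set c := cos (m%:R * _); set s := sin (m%:R * _).
have K0 : cos t ^+ 2 + sin t ^+ 2 - 1 = 0 by rewrite cos2Dsin2 subrr.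
move: s0 K0 {s2 c2t s2t IH}; set C := cos t; set S := sin t => s0 K0.
(* The remaining identities hold only modulo [C ^+ 2 + S ^+ 2 = 1]; each is certified by giving the
   multiple [X] of this relation explicitly. *)
have eqK (X p q : R) : p - q = (C ^+ 2 + S ^+ 2 - 1) * X / S ^+ 2 -> p = q.
  by rewrite K0 !mul0r => /subr0_eq.
pose x1 := (c * (1 - 2 * S ^+ 2) - s * (2 * S * C) - 1) / S ^+ 2.
pose z1 := (C * (c * (1 - 2 * S ^+ 2) - s * (2 * S * C) - 1) +
  S * (s * (1 - 2 * S ^+ 2) + c * (2 * S * C))) / S ^+ 2.
have -> : - ((c - 1) / S ^+ 2) - 2 + 2 * C * ((C * (c - 1) - S * s) / S ^+ 2) = x1.
  by apply: (eqK (2 * (c - 1))); rewrite /x1; field.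
have -> : - ((C * (c - 1) + S * s) / S ^+ 2) + 2 * C * ((c - 1) / S ^+ 2) = z1.
  by apply: (eqK (2 * s * S)); rewrite /z1; field.
congr (E _ _ _ _); rewrite /x1 /z1.
  by apply: (eqK (- 2 * s * S)); field.
by apply: (eqK (2 * (c * (1 - 2 * S ^+ 2) - s * (2 * S * C) + 2 * c * S ^+ 2 - 1))); field.
Qed.

Lemma mxrefl_order k : (2 <= k)%N -> t = pi / k%:R ->
  iter k (fun M => M *m (mxrefl a alpha *m mxrefl b beta)) 1%:M = 1%:M.
Proof.
move=> k2 tE; rewrite mxrefl_iter /=.
  rewrite (_ : k%:R * (2 * t) = pi + pi); last first.
    by rewrite tE; field; rewrite pnatr_eq0; lia.
  rewrite cosD sinD sinpi cospi !mulr0 mul0r addr0 subr0 mulrNN mulr1 subrr.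
  by rewrite !mulr0 subrr addr0 !mul0r /E !scale0r !addr0.
apply: lt0r_neq0; apply: sin_gt0_pi.
rewrite tE divr_gt0 ?pi_gt0 //=; last by rewrite ltr0n; lia.
by rewrite ltr_pdivrMr ?ltr0n; [rewrite ltr_pMr ?pi_gt0 // ltr1n|]; lia.
Qed.
End Reflections.

Lemma seq_argmax (R : realType) (T : eqType) (f : T -> R) (l : seq T) x0 :
  x0 \in l -> exists2 x, x \in l & forall y, y \in l -> f y <= f x.
Proof.
elim: l x0 => // a l IH x0 _.
have [l0|[b bl]] : l = [::] \/ exists b, b \in l.
- by case: l {IH} => [|b l]; [left|right; exists b; rewrite inE eqxx].
- by exists a; rewrite l0 ?inE // => y; rewrite inE => /eqP ->.
have [x xl max] := IH b bl.
have [xa|ax] := leP (f x) (f a).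
  exists a; rewrite ?inE ?eqxx // => y; rewrite inE => /predU1P[->//|/max yx].
  exact: le_trans yx xa.
exists x; rewrite ?inE ?xl ?orbT // => y; rewrite inE => /predU1P[->|/max //].
exact: ltW.
Qed.

Section ReflectionRepresentation.
Variables (R : realType) (N : nat) (W : groupType) (s : 'I_N -> W).
Hypothesis cox : fuchsian_coxeter_system s.
Variable k : 'I_N -> nat.
Hypothesis k2 : forall i, (2 <= k i)%N.
Hypothesis univ : forall (G : groupType) (t : 'I_N -> G), fuchsian_relations k t ->
  exists f : {multiplicative W -> G}, forall i, f (s i) = t i.

Local Notation ell := (word_length s).
Local Notation word := (word s).

Let N3 : (3 <= N)%N. Proof. by case: cox. Qed.

Lemma ordS_neq (i : 'I_N) : (i == ordS i) = false.
Proof.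
apply/negbTE/eqP => /(congr1 val) /=; have := ltn_ord i.
rewrite leq_eqVlt => /predU1P[iN|iN]; last by rewrite modn_small //; lia.
by rewrite iN modnn; lia.
Qed.

Lemma ordSS_neq (i : 'I_N) : (i == ordS (ordS i)) = false.
Proof.
apply/negbTE/eqP => /(congr1 val) /=; have := ltn_ord i.
rewrite leq_eqVlt => /predU1P[iN|iN]; first by rewrite iN modnn modn_small; lia.
rewrite (modn_small iN); move: iN; rewrite leq_eqVlt => /predU1P[iN|iN].
  by rewrite iN modnn; lia.
by rewrite modn_small; lia.
Qed.

(* The Tits form, with an arbitrary value [< -1] for pairs of generators
   without relation. *)
Definition tits_form : 'M[R]_N := \matrix_(i, j)
  if i == j then 1 else if j == ordS i then - cos (pi / (k i)%:R)
  else if i == ordS j then - cos (pi / (k j)%:R) else - 2.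

Local Notation B := tits_form.

Definition simple_root i : 'cV[R]_N := delta_mx i 0.

Lemma row_tits i j : row i B *m simple_root j = (B i j)%:M.
Proof.
apply/matrixP => x y; rewrite !ord1 -colE !mxE.
by rewrite eqxx mulr1n.
Qed.

Definition tits_refl i := mxrefl (simple_root i) (row i B).

Lemma tits_refl2 i : tits_refl i *m tits_refl i = 1%:M.
Proof. by apply: mxrefl2; rewrite row_tits !mxE eqxx. Qed.

Fact tits_refl_unit i : tits_refl i \in unitmx.
Proof. by have [] := mulmx1_unit (tits_refl2 i). Qed.

Definition tits_gen i : unit_matrix R N :=
  exist (fun M : 'M[R]_N => M \in unitmx) _ (tits_refl_unit i).

Lemma tits_relations : fuchsian_relations k tits_gen.
Proof.
move=> i; split; apply: val_inj; rewrite val_unit_one.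
  by rewrite expg2 val_unit_mul /= tits_refl2.
rewrite -[RHS](@mxrefl_order R N (simple_root i) (simple_root (ordS i)) (row i B)
  (row (ordS i) B) (pi / (k i)%:R) _ _ _ _ (k i)) //.
- elim: (k i) => [|n IH] //.
  by rewrite expgSr val_unit_mul IH.
- by rewrite row_tits !mxE eqxx.
- by rewrite row_tits !mxE eqxx.
- by rewrite row_tits !mxE ordS_neq eqxx.
- by rewrite row_tits !mxE eq_sym ordS_neq ordSS_neq eqxx.
Qed.

(* If [x] is positive on [J], zero elsewhere and [B x] is negative on [J], then
   [L w = 1^T (w x)] satisfies [sum_J m_i (L (w s_i) - L w) = L w] for suitable
   [m_i > 0]; this contradicts the maximum principle on a finite parabolic. *)
Lemma parabolic_unbounded (J : pred 'I_N) (x : 'cV[R]_N) :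
  (exists i, J i) -> (forall i, J i -> 0 < x i 0) ->
  (forall i, ~~ J i -> x i 0 = 0) -> (forall i, J i -> (B *m x) i 0 < 0) ->
  forall n, exists2 u, all J u & (n < ell (word u))%N.
Proof.
move=> [i0 Ji0] xpos x0 Bx n; apply: contrapT => bound.
have {}bound u : all J u -> (ell (word u) <= n)%N.
  by move=> Ju; rewrite leqNgt; apply/negP => nu; apply: bound; exists u.
have [f fs] := univ tits_relations.
have f1 : f 1%g = 1%g by apply: (@mulgI _ (f 1%g)); rewrite -gmulfM !mulg1.
pose L (w : W) : R := (const_mx 1 *m val (f w) *m x : 'M[R]_1) 0 0.
pose l := [seq w <- ballW s n | `[< exists2 u, all J u & w = word u >]].
have l1 : 1%g \in l.
  rewrite mem_filter (mem_ballW cox) (ell1 cox) andbT; apply/asboolP.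
  by exists [::]; rewrite // /word big_nil.
have [w wl max] := seq_argmax L l1.
have lS i : J i -> (w * s i)%g \in l.
  move=> Ji; move: wl; rewrite !mem_filter !(mem_ballW cox) => /andP[/asboolP[u Ju ->] _].
  rewrite -word_rcons bound ?all_rcons ?Ji // andbT; apply/asboolP.
  by exists (rcons u i); rewrite ?all_rcons ?Ji.
have L1 : 0 < L 1%g.
  rewrite /L f1 val_unit_one mulmx1 mxE (bigD1 i0) //= mxE mul1r.
  rewrite ltr_pwDl ?xpos // sumr_ge0 // => j _; rewrite mxE mul1r.
  by have [/xpos/ltW|/x0 ->] := boolP (J j).
(* The weights come from [L (w s_i) - L w = - 2 (B x)_i (1^T w e_i)] and from writing [x] as the
   combination of the [e_i] with coefficients [x_i]; they are positive because [(B x)_i < 0]. *)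
have LE : L w = \sum_(i | J i) (- x i 0 / (2 * (B *m x) i 0)) * (L (w * s i)%g - L w).
  have LS i : L (w * s i)%g - L w =
      - 2 * (B *m x) i 0 * (const_mx 1 *m val (f w) *m simple_root i : 'M[R]_1) 0 0.
    rewrite /L gmulfM fs val_unit_mul /= /tits_refl /mxrefl mulmxA mulmxBr mulmx1 mulmxBl.
    rewrite -scalemxAr -scalemxAl -!mulmxA -row_mul.
    rewrite [row i _ in LHS](_ : _ = ((B *m x) i 0)%:M); last first.
      by apply/matrixP => a b; rewrite !ord1 !mxE eqxx mulr1n.
    by rewrite mul_mx_scalar -!scalemxAr !mulmxA !mxE; ring.
  transitivity
    ((const_mx 1 *m val (f w) *m (\sum_(i | J i) x i 0 *: simple_root i) : 'M[R]_1) 0 0).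
    rewrite /L; congr (fun y : 'cV[R]_N => (_ *m y : 'M[R]_1) 0 0).
    apply/matrixP => a b; rewrite !ord1 summxE.
    have [Ja|nJa] := boolP (J a).
      rewrite (bigD1 a) //= big1 => [|j /andP[_ ja]]; rewrite !mxE ?eqxx ?mulr1 ?addr0 //.
      by rewrite eq_sym (negbTE ja) mulr0.
    rewrite x0 // big1 // => j Jj; rewrite !mxE.
    by case: eqP Jj nJa => [-> ->|_ _ _] //; rewrite mulr0.
  rewrite mulmx_sumr summxE; apply: eq_bigr => i Ji; rewrite LS -scalemxAr mxE.
  have := lt_eqF (Bx i Ji); set b := (B *m x) i 0 => /negbT b0.
  by field.
have Lpos : 0 < L w by apply: lt_le_trans L1 (max _ l1).
suff : L w <= 0 by rewrite leNgt Lpos.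
rewrite LE sumr_le0 // => i Ji; rewrite mulr_ge0_le0 ?subr_le0 ?max ?lS //.
by rewrite mulNr -mulrN -invrN -mulrN divr_ge0 ?ltW ?xpos // mulr_gt0 ?oppr_gt0 ?Bx.
Qed.
End ReflectionRepresentation.

Lemma ordS3 (i : 'I_3) : ordS (ordS (ordS i)) = i.
Proof. by case: i => m hm; apply: val_inj => /=; move: m hm => [|[|[|m]]]. Qed.

Lemma ord3P (i : 'I_3) : [\/ i = ord0, i = ordS ord0 | i = ordS (ordS ord0)].
Proof.
by case: i => [[|[|[|m]]] hm] //; [apply: Or31|apply: Or32|apply: Or33]; exact: val_inj.
Qed.

Section InfiniteParabolic.
Variables (R : realType) (N : nat) (W : groupType) (s : 'I_N -> W).
Hypothesis cox : fuchsian_coxeter_system s.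

Local Notation ell := (word_length s).
Local Notation word := (word s).
Local Notation descent := (descent s).

(** For [N >= 4] the generators [0] and [2] are not cyclically adjacent, so their entry in the form
    is [- 2]; on [x = e_i + e_j] both coordinates of [B x] are [1 - 2]. *)
Lemma infinite_pair : (4 <= N)%N -> exists i j : 'I_N, i != j /\
  forall n, exists2 u, all (mem [:: i; j]) u & (n < ell (word u))%N.
Proof.
move=> N4; case: (cox) => _ [k [k2 _ rel gen univ]].
have h0 : (0 < N)%N by lia.
have h2 : (2 < N)%N by lia.
pose i := Ordinal h0; pose j := Ordinal h2; exists i, j; split=> // n.
have Bij : tits_form R k i j = - 2.
  by rewrite mxE -!val_eqE /= (@modn_small 1) 1?(@modn_small 3) //; lia.
have Bji : tits_form R k j i = - 2.
  by rewrite mxE -!val_eqE /= (@modn_small 1) 1?(@modn_small 3) //; lia.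
have Bii a : tits_form R k a a = 1 by rewrite mxE eqxx.
have mulB a : (tits_form R k *m (simple_root R i + simple_root R j)) a 0 =
    tits_form R k a i + tits_form R k a j.
  by rewrite mulmxDr mxE -!colE !mxE.
apply: (@parabolic_unbounded R N W s cox k k2 univ (mem [:: i; j])
  (simple_root R i + simple_root R j)).
- by exists i; rewrite /= inE eqxx.
- move=> a; rewrite /= !inE => /orP[] /eqP ->; rewrite !mxE !eqxx /=;
    by rewrite ?addr0 ?add0r ltr01.
- by move=> a; rewrite /= !inE negb_or !mxE => /andP[/negbTE -> /negbTE ->]; rewrite addr0.
- move=> a; rewrite mulB /= !inE => /orP[] /eqP ->; rewrite Bii ?Bij ?Bji; lra.
Qed.

(* The sides of a Euclidean triangle satisfy [a = b cos C + c cos B]; shrinking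
   the angles to those of the hyperbolic triangle makes the right side larger. *)
Lemma infinite_triangle : N = 3%N ->
  forall n, exists2 u, all predT u & (n < ell (word u))%N.
Proof.
move=> N3; move: s cox; rewrite N3 => t coxt n.
case: (coxt) => _ [k [k2 ksum rel gen univ]].
pose th i : R := pi / (k i)%:R.
have th_gt0 i : 0 < th i.
  by rewrite divr_gt0 ?pi_gt0 // ltr0n; have := k2 i; lia.
pose i0 : 'I_3 := ord0; pose i1 : 'I_3 := ordS i0; pose i2 : 'I_3 := ordS i1.
have i20 : ordS i2 = i0 by apply: val_inj.
have th_sum : th i0 + th i1 + th i2 < pi.
  have : ratr (\sum_(i < 3) (k i)%:R^-1 : rat) < ratr (3%:R - 2) :> R by rewrite ltr_rat.
  rewrite !big_ord_recl big_ord0 addr0 !rmorphD /= !fmorphV /= !ratr_nat rmorphN /= ratr_nat.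
  have -> : lift ord0 ord0 = i1 by apply: val_inj.
  have -> : lift ord0 (lift ord0 ord0) = i2 by apply: val_inj.
  rewrite -/i0 /th => h; rewrite -!mulrDr -ltr_pdivlMl ?pi_gt0 //.
  by rewrite mulVf ?gt_eqF ?pi_gt0 // addrA in h *; lra.
(* The angular defect is shared equally, which turns the hyperbolic triangle into a Euclidean one
   with angles [A]. [A i] is opposite to side [i], so by the law of sines [sin (A i)] is
   proportional to the length of that side. *)
pose d := (pi - (th i0 + th i1 + th i2)) / 3.
have d0 : 0 < d by rewrite divr_gt0 // subr_gt0.
pose A i := th (ordS i) + d.
have A_gt0 i : 0 < A i by rewrite addr_gt0.
have Asum i : A i + A (ordS i) + A (ordS (ordS i)) = pi.
  have -> : A i + A (ordS i) + A (ordS (ordS i)) = A i0 + A i1 + A i2.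
    by have [->|->|->] := ord3P i; rewrite ?i20 -/i1 -/i2 ?i20; ring.
  by rewrite /A i20 -/i1 -/i2 /d; field.
have A_ltpi i : A i < pi.
  by rewrite -(Asum i) -addrA ltrDl addr_gt0.
have cosA i : cos (A (ordS (ordS i))) < cos (th i).
  have iE := ordS3 i.
  have ltA : th i < A (ordS (ordS i)) by rewrite /A iE ltrDl.
  rewrite ltr_cos // in_itv /= ?(ltW (A_gt0 _)) ?(ltW (A_ltpi _)) ?(ltW (th_gt0 _)) //.
  by rewrite (ltW (lt_trans ltA (A_ltpi _))).
have sinA i : 0 < sin (A i) by apply: sin_gt0_pi; rewrite A_gt0 A_ltpi.
apply: (@parabolic_unbounded R 3 W t coxt k k2 univ predT (\col_i sin (A i))).
- by exists i0.
- by move=> i _; rewrite mxE.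
- by [].
move=> i _.
have -> : (tits_form R k *m \col_i0 sin (A i0)) i 0 =
    sin (A i) - cos (th i) * sin (A (ordS i)) -
    cos (th (ordS (ordS i))) * sin (A (ordS (ordS i))).
  rewrite mxE (bigD1 i) //= (bigD1 (ordS i)) /= ?(eq_sym (ordS i)) ?(ordS_neq coxt) //.
  rewrite (bigD1 (ordS (ordS i))) /=; last first.
    by rewrite !(eq_sym (ordS (ordS i))) (ordSS_neq coxt) (ordS_neq coxt).
  rewrite big1 => [|j /andP[/andP[ji ji1] ji2]]; last first.
    by exfalso; move: ji ji1 ji2; have [->|->|->] := ord3P i; have [->|->|->] := ord3P j.
  rewrite !mxE !eqxx !(ordS_neq coxt) (ordSS_neq coxt).
  have iE := ordS3 i.
  rewrite iE eqxx (inj_eq (@ordS_inj 3)) eq_sym (ordS_neq coxt) /th.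
  ring.
have -> : sin (A i) = sin (A (ordS i) + A (ordS (ordS i))).
  rewrite (_ : A i = - (A (ordS i) + A (ordS (ordS i))) + pi); last first.
    by rewrite -(Asum i); ring.
  by rewrite sinDpi sinN opprK.
have iE := ordS3 i.
have c1 := cosA i; have c2 := cosA (ordS (ordS i)); rewrite iE in c2.
rewrite sinD.
have := sinA (ordS i); have := sinA (ordS (ordS i)).
move: c1 c2; set a := cos (th i); set b := cos (th _); set c1 := cos _; set c2 := cos _.
nra.
Qed.
End InfiniteParabolic.

(** * Descent sets and the superharmonic weight *)

Section DescentStructure.
Variables (R : realType) (N : nat) (W : groupType) (s : 'I_N -> W).
Hypothesis cox : fuchsian_coxeter_system s.
Variables (Delta : choiceType) (delta : Delta -> Delta -> W).
Hypothesis bld : building s delta.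
Hypothesis reg : regular_building s delta.
Hypothesis thick : thick_building s delta.
Variable o : Delta.

Local Notation ell := (word_length s).
Local Notation word := (word s).
Local Notation descent := (descent s).

Lemma ascent_ex (J : pred 'I_N) w :
  (forall n, exists2 u, all J u & (n < ell (word u))%N) ->
  exists2 i, J i & ~~ descent w i.
Proof.
move=> unb; apply: contrapT => none.
have [u Ju] := unb (2 * ell w)%N; rewrite ltnNge; apply/negP; rewrite negbK.
apply: (descents_bound cox bld reg thick o) Ju => i Ji.
by apply/negPn/negP => d; apply: none; exists i.
Qed.

(** Among three generators any two are cyclically adjacent, and the product of all [k i] is an
    exponent that serves every pair. *)
Lemma pair_order : N = 3%N -> exists K, (0 < K)%N /\
  forall a b : 'I_N, a != b -> ((s a * s b) ^+ K = 1)%g.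
Proof.
move=> N3; case: (cox) => _ [k [k2 _ rel _ _]].
exists (\prod_i k i)%N; split.
  by apply: prodn_gt0 => i; exact: ltnW.
have kK i x : (x ^+ k i = 1 -> x ^+ (\prod_j k j) = 1 :> W)%g.
  by move=> xk; rewrite (bigD1 i) //= expgnA xk expg1n.
have main a : ((s a * s (ordS a)) ^+ (\prod_j k j) = 1)%g.
  by apply: (kK a); have [_ ->] := rel a.
move=> a b ab.
have [->|->] : b = ordS a \/ a = ordS b; first last.
- by apply: invg_inj; rewrite -expVgn invgM !(invs cox) main invg1.
- exact: main.
move: a b ab {main}; rewrite N3 => a b.
by have [->|->|->] := ord3P a; have [->|->|->] := ord3P b;
  rewrite ?eqxx //; [left|right|right|left|left|right]; rewrite ?ordS3.
Qed.

Definition alternate (a b : 'I_N) n := mkseq (fun j => if odd j then b else a) n.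

Lemma alternateS a b n :
  alternate a b n.+1 = rcons (alternate a b n) (if odd n then b else a).
Proof. by rewrite /alternate mkseqS. Qed.

Lemma word_alternate a b n : word (alternate a b n.*2) = ((s a * s b) ^+ n)%g.
Proof.
elim: n => [|n IH]; first by rewrite /word big_nil.
rewrite doubleS !alternateS !word_rcons IH odd_double /= odd_double /=.
by rewrite expgSr mulgA.
Qed.

(* Descending alternately along [a] and [b] must stop, since [(s a s b)^K = 1]
   brings the walk back. *)
Lemma dihedral_descent w a b K : (0 < K)%N -> ((s a * s b) ^+ K = 1)%g ->
  descent w a -> exists m, [/\ (m <= K.*2)%N,
    ~~ descent (w * word (alternate a b m))%g a &
    ~~ descent (w * word (alternate a b m))%g b].
Proof.
move=> K0 abK wa; pose l j := if odd j then b else a.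
pose v j := (w * word (alternate a b j))%g.
have vS j : v j.+1 = (v j * s (l j))%g by rewrite /v alternateS word_rcons mulgA.
have ex : exists m, (m <= K.*2)%N && ~~ descent (v m) (l m).
  apply: contrapT => none.
  have d m : (m <= K.*2)%N -> descent (v m) (l m).
    by move=> mK; apply/negPn/negP => d; apply: none; exists m; rewrite mK.
  have vE m : (m <= K.*2)%N -> (ell (v m) + m = ell w)%N.
    elim: m => [|m IH] mK; first by rewrite addn0 /v /word big_nil mulg1.
    by rewrite -(IH (ltnW mK)) vS (descentT cox (d m (ltnW mK))); lia.
  have := vE _ (leqnn _); rewrite /v word_alternate abK mulg1.
  by lia.
have [m /andP[mK dm] min] := ex_minnP ex.
have m0 : (0 < m)%N.
  rewrite lt0n; apply: contra dm => /eqP ->.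
  by rewrite /v /word big_nil mulg1.
(* The last step into [v m] went down along [l m.-1], so that going back is an ascent; by minimality
   of [m] the letter [l m] is one too, and these two letters are [a] and [b]. *)
have dm' : ~~ descent (v m) (l m.-1).
  have -> : v m = (v m.-1 * s (l m.-1))%g by rewrite -vS prednK.
  rewrite (descent_muls cox) negbK; apply/negPn/negP => d.
  by have := min m.-1; rewrite d andbT; lia.
exists m; split=> //; move: dm dm'; rewrite -/(v m) /l -{2}(prednK m0) /=;
  by case: (odd m.-1).
Qed.

Lemma count_le_pair (J : seq 'I_N) (P : pred 'I_N) a b : uniq J -> a != b ->
  a \in J -> b \in J -> ~~ P a -> ~~ P b -> (count P J + 2 <= size J)%N.
Proof.
move=> uJ ab aJ bJ Pa Pb.
have -> : 2%N = (count (pred1 a) J + count (pred1 b) J)%N.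
  by rewrite !count_uniq_mem // aJ bJ.
have I1 : count (predI (pred1 a) (pred1 b)) J = 0%N.
  apply/eqP; rewrite -leqn0 leqNgt -has_count; apply/hasPn => x _ /=.
  by apply/negP => /andP[/eqP -> /eqP e]; rewrite e eqxx in ab.
rewrite -(count_predUI (pred1 a)) I1 addn0.
have I2 : count (predI P (predU (pred1 a) (pred1 b))) J = 0%N.
  apply/eqP; rewrite -leqn0 leqNgt -has_count; apply/hasPn => x _ /=.
  by apply/negP => /andP[Px /orP[]/eqP e]; move: Px; rewrite e; apply/negP.
by rewrite -count_predUI I2 addn0 count_size.
Qed.

(** The first bound makes the drift nonnegative everywhere, the second makes it positive at some
    place nearby. For a pair, [r = 0] works because fewer than two descents means at most one. For
    three generators, descending in the finite dihedral group of a pair frees two letters of being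
    descents. *)
Lemma descent_structure : exists (J : seq 'I_N) (r : nat),
  [/\ uniq J, (size J = 2 \/ size J = 3)%N &
   forall w, (count (descent w) J < size J)%N /\
     exists u, [/\ all (mem J) u, (size u <= r)%N &
                   (count (descent (w * word u)%g) J <= 1)%N]].
Proof.
have ltJ (J : seq 'I_N) w : (exists2 i, i \in J & ~~ descent w i) ->
    (count (descent w) J < size J)%N.
  move=> [i iJ di]; rewrite -(count_predC (descent w) J) -addn1 leq_add2l -has_count.
  by apply/hasP; exists i.
have [N4|N3] : (4 <= N)%N \/ N = 3%N by case: (cox) => ? _; lia.
  have [i [j [ij unb]]] := infinite_pair R cox N4.
  exists [:: i; j], 0%N; split=> [|//|w]; first by rewrite /= inE ij.
    by left.
  have lt2 : (count (descent w) [:: i; j] < 2)%N.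
    by apply: (ltJ [:: i; j]); apply: ascent_ex unb.
  split=> //; exists [::]; split=> //.
  by rewrite /word big_nil mulg1.
have unb := infinite_triangle R cox N3.
have [K [K0 ordK]] := pair_order N3.
exists (enum 'I_N), K.*2; split; first exact: enum_uniq.
  by right; rewrite size_enum_ord.
move=> w; split.
  apply: ltJ; have [i _ di] := ascent_ex w unb.
  by exists i; rewrite // mem_enum.
have [le1|gt1] := leqP (count (descent w) (enum 'I_N)) 1.
  by exists [::]; split=> //; rewrite /word big_nil mulg1.
have [a [b [ab wa]]] : exists a b, a != b /\ descent w a.
  move: gt1; rewrite -size_filter.
  have := filter_uniq (descent w) (enum_uniq 'I_N).
  have : forall x, x \in [seq x <- enum 'I_N | descent w x] -> descent w x.
    by move=> x; rewrite mem_filter => /andP[].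
  case: [seq _ <- _ | _] => [|a [|b l]] //= mem /andP[+ _] _.
  rewrite inE negb_or => /andP[ab _]; exists a, b; split=> //.
  by apply: mem; rewrite inE eqxx.
have [m [mK da db]] := dihedral_descent K0 (ordK _ _ ab) wa.
exists (alternate a b m); split.
- by apply/allP => x _; rewrite /= mem_enum.
- by rewrite size_mkseq.
have := count_le_pair (enum_uniq 'I_N) ab (mem_enum _ _) (mem_enum _ _) da db.
by rewrite size_enum_ord; move: (count _ _) N3 => c; lia.
Qed.
End DescentStructure.

(** From [exp x <= 1 / (1 - x)] and [(1 + x + 2 x^2) (1 - x) = 1 + x^2 (1 - 2 x)]. *)
Lemma expR_le_quadratic (R : realType) (x : R) : x <= 2^-1 -> expR x <= 1 + x + 2 * x ^+ 2.
Proof.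
move=> x2; have := expR_ge1Dx (- x); rewrite expRN => h.
have x1 : 0 < 1 - x by lra.
have : expR x <= (1 - x)^-1.
  by rewrite -[leLHS]invrK lef_pV2 ?posrE ?invr_gt0 ?expR_gt0.
move/le_trans; apply; rewrite -[leLHS]mul1r ler_pdivrMr //; nra.
Qed.

Lemma sum_cst_seq (R : pzRingType) (T : Type) (l : seq T) (a : R) :
  \sum_(i <- l) a = (size l)%:R * a.
Proof. by rewrite big_const_seq count_predT iter_addr_0 mulr_natl. Qed.

(** * Drift of the mean over the [J]-panels *)

Section Lyapunov.
Variables (R : realType) (N : nat) (W : groupType) (s : 'I_N -> W).
Hypothesis cox : fuchsian_coxeter_system s.
Variables (Delta : choiceType) (delta : Delta -> Delta -> W).
Hypothesis bld : building s delta.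
Hypothesis reg : regular_building s delta.
Hypothesis thick : thick_building s delta.
Variable o : Delta.

Local Notation ell := (word_length s).
Local Notation word := (word s).
Local Notation descent := (descent s).
Local Notation sph := (sph delta).
Local Notation qpar := (qpar s delta).

Let q2 i : (2 <= qpar i)%N. Proof. exact: qpar_ge2 reg thick o i. Qed.

(** The proportion of the [q_i] neighbours of a chamber at distance [w] that lie at distance
    [w * s i]: all of them at an ascent, only the gate at a descent. *)
Definition step_weight w i : R := if descent w i then (qpar i)%:R^-1 else 1.

Definition mean_op (J : seq 'I_N) (F : W -> R) (w : W) : R :=
  (size J)%:R^-1 * \sum_(i <- J) (F w + step_weight w i * (F (w * s i)%g - F w)).

Lemma step_weight_le1 w i : step_weight w i <= 1.
Proof.
rewrite /step_weight; case: ifP => // _.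
by rewrite invf_le1 ?ltr0n ?ler1n; have := q2 i; lia.
Qed.

Definition min_weight : R := (\prod_(i < N) qpar i)%:R^-1.

Lemma min_weight_gt0 : 0 < min_weight.
Proof.
by rewrite invr_gt0 ltr0n; apply: prodn_gt0 => i; exact: ltnW.
Qed.

Lemma min_weight_le w i : min_weight <= step_weight w i.
Proof.
have prod_pos (P : pred 'I_N) : (0 < \prod_(i | P i) qpar i)%N.
  by apply: prodn_cond_gt0 => j _; exact: ltnW.
rewrite /step_weight /min_weight; case: ifP => _.
  rewrite lef_pV2 ?posrE ?ltr0n ?prod_pos //; last by have := q2 i; lia.
  by rewrite ler_nat (bigD1 i) //= leq_pmulr.
by rewrite invf_le1 ?ler1n ?ltr0n; exact: prod_pos.
Qed.

Lemma step_weight_gt0 w i : 0 < step_weight w i.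
Proof. exact: lt_le_trans min_weight_gt0 (min_weight_le _ _). Qed.

Lemma mean_opE J (F : W -> R) x :
  mean_op J F (delta o x) =
  (size J)%:R^-1 * \sum_(i <- J) (qpar i)%:R^-1 * \sum_(y <- sph x (s i)) F (delta o y).
Proof.
rewrite /mean_op; congr (_ * _); apply: eq_bigr => i _.
have q0 : (qpar i)%:R != 0 :> R by rewrite pnatr_eq0; have := q2 i; lia.
rewrite (hecke1P cox bld reg o x i) /hecke1 /step_weight; case: ifP => _; by field.
Qed.

Lemma ler_mean_op J F G w : (forall v, F v <= G v) -> mean_op J F w <= mean_op J G w.
Proof.
move=> FG; rewrite ler_wpM2l ?invr_ge0 //; apply: ler_sum => i _.
have := FG w; have := FG (w * s i)%g; have := step_weight_le1 w i.
have := step_weight_gt0 w i; nra.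
Qed.

Lemma mean_op_linear J F G a w :
  mean_op J (fun v => F v + a * G v) w = mean_op J F w + a * mean_op J G w.
Proof.
rewrite /mean_op mulrCA -mulrDr; congr (_ * _); rewrite mulr_sumr -big_split /=.
by apply: eq_bigr => i _; ring.
Qed.

Section Potential.
Variables (J : seq 'I_N) (r : nat).
Hypothesis uJ : uniq J.
Hypothesis sJ : (size J = 2 \/ size J = 3)%N.
Hypothesis ds : forall w, (count (descent w) J < size J)%N /\
   exists u, [/\ all (mem J) u, (size u <= r)%N &
     (count (descent (w * word u)%g) J <= 1)%N].

Let sJ0 : 0 < (size J)%:R :> R. Proof. by case: sJ => ->; rewrite ltr0n. Qed.

Lemma mean_op_cst a w : mean_op J (fun=> a) w = a.
Proof.
rewrite /mean_op (eq_bigr (fun=> a)) => [|i _]; last by rewrite subrr mulr0 addr0.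
by rewrite sum_cst_seq mulKf // gt_eqF.
Qed.

Lemma mean_op_sub F w : mean_op J F w - F w =
  (size J)%:R^-1 * \sum_(i <- J) step_weight w i * (F (w * s i)%g - F w).
Proof.
rewrite {1}/mean_op big_split /= sum_cst_seq.
by rewrite mulrDr mulKf ?gt_eqF // addrAC subrr add0r.
Qed.

Let L w : R := (ell w)%:R.
Let g w : R := mean_op J L w - L w.

(** An ascent contributes [1] and a descent [- 1 / q_i >= - 1/2]; with [n] descents in [J] the sum
    is at least [(|J| - n) - n / 2]. *)
Lemma drift_ge w : (2 * (size J)%:R)^-1 * (2 * (size J)%:R - 3 * (count (descent w) J)%:R) <= g w.
Proof.
rewrite /g mean_op_sub.
have -> : (2 * (size J)%:R)^-1 * (2 * (size J)%:R - 3 * (count (descent w) J)%:R) =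
    (size J)%:R^-1 * ((2 * (size J)%:R - 3 * (count (descent w) J)%:R) / 2) :> R.
  by field; rewrite gt_eqF.
rewrite ler_pM2l ?invr_gt0 // ler_pdivrMr //.
have : forall l, (size l)%:R * 2 - 3 * (count (descent w) l)%:R <=
    (\sum_(i <- l) step_weight w i * (L (w * s i)%g - L w)) * 2 :> R.
  elim=> [|i l IH]; first by rewrite big_nil /= mul0r mulr0 subrr.
  rewrite big_cons /= natrD -(natr1 (size l)).
  move: IH; set S := \sum_(_ <- _) _; move=> IH; rewrite /step_weight /L.
  have [d|/negbTE/(descentF cox) ->] := boolP (descent w i); last first.
    by rewrite -(natr1 (ell w)) mulr0n; lra.
  rewrite (descentT cox d) -(natr1 (ell _)).
  have : (qpar i)%:R^-1 <= 2^-1 :> R.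
    by rewrite lef_pV2 ?posrE ?ler_nat // ltr0n; have := q2 i; lia.
  by rewrite mulr1n; lra.
by move/(_ J); rewrite (mulrC 2).
Qed.

Lemma drift_ge0 w : 0 <= g w.
Proof.
apply: le_trans (drift_ge w); rewrite mulr_ge0 ?invr_ge0 ?mulr_ge0 // subr_ge0.
by rewrite -!natrM ler_nat; have [+ _] := ds w; case: sJ => ->; lia.
Qed.

Lemma drift_good w : (count (descent w) J <= 1)%N -> (2 * (size J)%:R)^-1 <= g w.
Proof.
move=> c1; apply: le_trans (drift_ge w); rewrite ler_peMr ?invr_ge0 ?mulr_ge0 //.
rewrite lerBrDr -!natrM nat1r ler_nat; case: sJ => ->; lia.
Qed.

Lemma mean_op_le (H : W -> R) w h :
  (forall i, H w + step_weight w i * (H (w * s i)%g - H w) <= h) -> mean_op J H w <= h.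
Proof.
move=> le; rewrite -(mean_op_cst h w) /mean_op ler_pM2l ?invr_gt0 //.
by apply: ler_sum => i _; rewrite subrr mulr0 addr0.
Qed.

Lemma mean_op_ge (H : W -> R) w h :
  (forall i, h <= H w + step_weight w i * (H (w * s i)%g - H w)) -> h <= mean_op J H w.
Proof.
move=> le; rewrite -(mean_op_cst h w) /mean_op ler_pM2l ?invr_gt0 //.
by apply: ler_sum => i _; rewrite subrr mulr0 addr0.
Qed.

Let F j := iter j (mean_op J) L.

Lemma iter_mean_ge0 j (G : W -> R) w : (forall v, 0 <= G v) -> 0 <= iter j (mean_op J) G w.
Proof.
move=> G0; elim: j w => [|j IH] w //=.
by rewrite -(mean_op_cst 0 w); apply: ler_mean_op.
Qed.

(** In the walk behind [mean_op J] a prescribed letter of [J] is followed with probability at least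
    [min_weight / |J|]. *)
Lemma iter_mean_path (G : W -> R) u w : (forall v, 0 <= G v) -> all (mem J) u ->
  (min_weight / (size J)%:R) ^+ size u * G (w * word u)%g <=
  iter (size u) (mean_op J) G w.
Proof.
move=> G0; elim: u w => [|i u IH] w /=; first by rewrite /word big_nil mulg1 mul1r.
move=> /andP[iJ Ju]; set H := iter _ _ G.
have H0 v : 0 <= H v by exact: iter_mean_ge0.
rewrite word_cons mulgA exprS -mulrA.
have := IH (w * s i)%g Ju; rewrite -/H => h.
apply: (@le_trans _ _ (min_weight / (size J)%:R * H (w * s i)%g)).
  by rewrite ler_wpM2l // divr_ge0 // ltW // min_weight_gt0.
rewrite mulrAC mulrC /mean_op ler_pM2l ?invr_gt0 //.
rewrite (perm_big _ (perm_to_rem iJ)) big_cons /=.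
have pos j : 0 <= H w + step_weight w j * (H (w * s j)%g - H w).
  have := H0 w; have := H0 (w * s j)%g; have := step_weight_le1 w j.
  have := step_weight_gt0 w j; nra.
have : 0 <= \sum_(j <- rem i J) (H w + step_weight w j * (H (w * s j)%g - H w)).
  by apply: sumr_ge0 => j _; exact: pos.
have := min_weight_le w i; have := H0 w; have := H0 (w * s i)%g.
have := step_weight_le1 w i; set S := \sum_(_ <- _) _; nra.
Qed.

Lemma iter_mean_sub j w : F j.+1 w - F j w = iter j (mean_op J) g w.
Proof.
elim: j w => [|j IH] w //=.
rewrite -[RHS](_ : mean_op J (fun v => F j.+1 v + (- 1) * F j v) w = _).
  by rewrite mean_op_linear mulN1r.
rewrite /mean_op; congr (_ * _); apply: eq_bigr => i _.
by rewrite !mulN1r !IH.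
Qed.

(* From every [w] some chamber with at most one descent in [J], where [L] has
   positive drift, is reached in at most [r] steps; hence the sum of the first
   [r + 1] means of [L] has drift at least [c > 0] everywhere. *)
Definition potential w := \sum_(j < r.+1) F j w.

Let c := (min_weight / (size J)%:R) ^+ r * (2 * (size J)%:R)^-1.

Lemma mean_op_sum (n : nat) (H : nat -> W -> R) w :
  mean_op J (fun v => \sum_(j < n) H j v) w = \sum_(j < n) mean_op J (H j) w.
Proof.
elim: n => [|n IH].
  by under [in LHS]eq_fun do rewrite big_ord0; rewrite mean_op_cst big_ord0.
rewrite big_ord_recr /= -IH.
have -> : (fun v => \sum_(j < n.+1) H j v) = (fun v => \sum_(j < n) H j v + 1 * H n v).
  by apply/funext => v; rewrite big_ord_recr mul1r.
by rewrite mean_op_linear mul1r.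
Qed.

Lemma min_ratio_le1 : min_weight / (size J)%:R <= 1.
Proof.
rewrite ler_pdivrMr // mul1r; apply: (@le_trans _ _ 1).
  have i0 : 'I_N.
    have N3 : (3 <= N)%N by case: cox.
    by apply: (@Ordinal N 0); lia.
  exact: le_trans (min_weight_le 1%g i0) (step_weight_le1 _ _).
by rewrite ler1n; case: sJ => ->.
Qed.

Lemma potential_drift w : c <= mean_op J potential w - potential w.
Proof.
rewrite /potential mean_op_sum -sumrB.
under eq_bigr => j _ do rewrite -[mean_op J (F j) w]/(F j.+1 w) iter_mean_sub.
have [_ [u [Ju ur good]]] := ds w.
have ur' : (size u < r.+1)%N by [].
rewrite (bigD1 (Ordinal ur')) //=.
rewrite -[leLHS]addr0 lerD //; last first.
  by apply: sumr_ge0 => j _; apply: iter_mean_ge0; exact: drift_ge0.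
apply: le_trans (iter_mean_path w drift_ge0 Ju).
have m0 : 0 < min_weight / (size J)%:R by rewrite divr_gt0 ?min_weight_gt0.
apply: ler_pM; last exact: drift_good.
- by rewrite exprn_ge0 // ltW.
- by rewrite invr_ge0 mulr_ge0 // ltW.
- by rewrite ler_wiXn2l ?min_ratio_le1 // ltW.
Qed.

Lemma iter_mean_near j w : `|F j w - L w| <= j%:R.
Proof.
elim: j w => [|j IH] w; first by rewrite subrr normr0.
have L1 v i : `|L (v * s i)%g - L v| <= 1.
  rewrite /L; case: (ell_mulsP cox v i) => ->; rewrite -natr1.
    by rewrite addrAC subrr add0r normr1.
  by rewrite opprD addrA subrr add0r normrN normr1.
have near1 : `|mean_op J L w - L w| <= 1.
  rewrite ler_distl; apply/andP; split; [apply: mean_op_ge|apply: mean_op_le] => i;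
    have := L1 w i; rewrite ler_norml => /andP[];
    have := step_weight_le1 w i; have := step_weight_gt0 w i; nra.
have up : F j.+1 w <= mean_op J (fun v => L v + j%:R * 1) w.
  by apply: ler_mean_op => v; have := IH v; rewrite mulr1 ler_distl => /andP[].
have lo : mean_op J (fun v => L v + - j%:R * 1) w <= F j.+1 w.
  by apply: ler_mean_op => v; have := IH v; rewrite mulr1 ler_distl => /andP[].
move: up lo near1; rewrite !mean_op_linear mean_op_cst !ler_distl -natr1.
set x := F _ _; set y := mean_op _ _ _; move=> up lo /andP[h1 h2].
by apply/andP; split; lra.
Qed.

(** [F j] is within [j] of the 1-Lipschitz [L], hence moves by at most [2 j + 1 <= 2 (r + 1)] in one
    step; there are [r + 1] summands. *)
Lemma potential_lip w i : `|potential (w * s i)%g - potential w| <= (r.+1 * r.+1.*2)%:R.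
Proof.
rewrite /potential -sumrB; apply: le_trans (ler_norm_sum _ _ _) _.
rewrite natrM -[in X in _ <= X * _](card_ord r.+1) mulr_natl -sumr_const; apply: ler_sum => j _.
have L1 : `|L (w * s i)%g - L w| <= 1.
  rewrite /L; case: (ell_mulsP cox w i) => ->; rewrite -natr1.
    by rewrite addrAC subrr add0r normr1.
  by rewrite opprD addrA subrr add0r normrN normr1.
have := iter_mean_near j w; have := iter_mean_near j (w * s i)%g.
have jr : j%:R + 1 + j%:R <= r.+1.*2%:R :> R.
  by rewrite natr1 -natrD ler_nat; have := ltn_ord j; lia.
move: L1 jr; rewrite !ler_norml => /andP[a1 a2] jr /andP[b1 b2] /andP[c1 c2].
by apply/andP; split; lra.
Qed.

(** The weight is [exp (- e * potential)]: to second order its mean is at most [1 - e c + 2 e^2 C^2]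
    times itself, with [c] the drift and [C] the Lipschitz constant of [potential]. *)
Lemma superharmonic_weight : exists (f : W -> R) (rho : R),
  [/\ forall w, 0 < f w, 0 < rho < 1 & forall w, mean_op J f w <= rho * f w].
Proof.
pose C : R := (r.+1 * r.+1.*2)%:R.
have C1 : 1 <= C by rewrite ler1n muln_gt0.
have m0 : 0 < min_weight / (size J)%:R by rewrite divr_gt0 ?min_weight_gt0.
have c0 : 0 < c by rewrite mulr_gt0 ?exprn_gt0 // invr_gt0 mulr_gt0.
have c1 : c <= 1.
  apply: mulr_ile1.
  - by rewrite exprn_ge0 // ltW.
  - by rewrite invr_ge0 mulr_ge0 // ltW.
  - by rewrite exprn_ile1 ?min_ratio_le1 // ltW.
  - by rewrite invf_le1 ?mulr_gt0 // -natrM ler1n; case: sJ => ->.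
(* With this [e] the quadratic error [2 e^2 C^2] is half of the gain [e c], which gives [rho], and
   [e C <= 1/4] keeps the exponents in the range of [expR_le_quadratic]. *)
pose e := c / (4 * C ^+ 2).
have C2 : 0 < 4 * C ^+ 2 by rewrite mulr_gt0 // exprn_gt0 //; lra.
have e0 : 0 < e by rewrite divr_gt0.
have eC : e * (4 * C ^+ 2) = c by rewrite /e mulfVK // gt_eqF.
have eC1 : e * C <= 4^-1.
  by nra.
exists (fun w => expR (- e * potential w)), (1 - e * c / 2); split.
- by move=> w; exact: expR_gt0.
- have ec : e * c <= 1 by nra.
  by apply/andP; split; nra.
move=> w; set E := expR (- e * potential w).
have E0 : 0 < E by exact: expR_gt0.
have bnd i : E + step_weight w i * (expR (- e * potential (w * s i)%g) - E) <=
    E * (1 + 2 * e ^+ 2 * C ^+ 2) -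
    E * e * (step_weight w i * (potential (w * s i)%g - potential w)).
  set d := potential (w * s i)%g - potential w.
  have -> : expR (- e * potential (w * s i)%g) = E * expR (- e * d).
    by rewrite -expRD /d; congr expR; ring.
  have dC : `|d| <= C by exact: potential_lip.
  have /expR_le_quadratic : - e * d <= 2^-1.
    by move: dC; rewrite ler_norml => /andP[]; nra.
  have d2 : d ^+ 2 <= C ^+ 2.
    by move: dC; rewrite ler_norml => /andP[]; nra.
  have w1 := step_weight_le1 w i; have w0 := step_weight_gt0 w i.
  set X := expR _; set p := step_weight _ _ => h.
  have h' : X - 1 <= - e * d + 2 * e ^+ 2 * C ^+ 2.
    have : 2 * (- e * d) ^+ 2 <= 2 * e ^+ 2 * C ^+ 2.
      by rewrite exprMn sqrrN -mulrA ler_pM2l // ler_pM2l // exprn_gt0.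
    lra.
  have h2 : p * (X - 1) <= - e * (p * d) + 2 * e ^+ 2 * C ^+ 2.
    have Y0 : 0 <= 2 * e ^+ 2 * C ^+ 2 by have := sqr_ge0 (e * C); nra.
    have : p * (X - 1) <= p * (- e * d + 2 * e ^+ 2 * C ^+ 2) by rewrite ler_pM2l.
    have := ler_piMl Y0 w1; rewrite -/p mulrDr; lra.
  have := ler_wpM2l (ltW E0) h2; lra.
have key : mean_op J (fun v => expR (- e * potential v)) w <=
    E * (1 + 2 * e ^+ 2 * C ^+ 2) - E * e * (mean_op J potential w - potential w).
  rewrite mean_op_sub.
  have -> : E * (1 + 2 * e ^+ 2 * C ^+ 2) = (size J)%:R^-1 *
      \sum_(i <- J) (E * (1 + 2 * e ^+ 2 * C ^+ 2)).
    by rewrite sum_cst_seq mulKf ?gt_eqF.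
  rewrite [E * e * (_ * _)]mulrCA -mulrBr ler_pM2l ?invr_gt0 // [E * e * _]mulr_sumr -sumrB.
  by apply: ler_sum => i _; exact: bnd.
apply: le_trans key _.
have := potential_drift w; set D := _ - _ => Dc.
have h : 2 * e ^+ 2 * C ^+ 2 = e * c / 2 by rewrite -eC; field.
have : E * e * c <= E * e * D by rewrite ler_pM2l // mulr_gt0.
rewrite h; lra.
Qed.

End Potential.
End Lyapunov.

Lemma esum_seq (R : realType) (T : choiceType) (l : seq T) (f : T -> \bar R) :
  uniq l -> (forall x, 0 <= f x)%E -> (forall x, x \notin l -> f x = 0%E) ->
  (\esum_(x in [set: T]) f x = \sum_(x <- l) f x)%E.
Proof.
move=> ul f0 fl; rewrite fsbig_seq // -esum_fset //.
rewrite [RHS]esum_mkcond; apply: eq_esum => x _.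
by case: ifPn => //; rewrite notin_setE /= => /negP/fl.
Qed.

Lemma big_supp (R : pzRingType) (T : eqType) (l1 l2 : seq T) (f : T -> R) :
  uniq l1 -> uniq l2 -> (forall x, x \in l1 -> f x != 0 -> x \in l2) ->
  (forall x, x \in l2 -> f x != 0 -> x \in l1) ->
  \sum_(x <- l1) f x = \sum_(x <- l2) f x.
Proof.
move=> u1 u2 h1 h2.
have nz l : \sum_(x <- l) f x = \sum_(x <- [seq x <- l | f x != 0]) f x.
  rewrite big_filter [RHS]big_mkcond; apply: eq_bigr => x _.
  by case: eqP => //= ->.
rewrite nz [RHS]nz; apply: perm_big; apply: uniq_perm; rewrite ?filter_uniq // => x.
rewrite !mem_filter; have [|fx] := eqVneq (f x) 0; first by [].
by apply/idP/idP => /= xl; [exact: h1|exact: h2].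
Qed.

(** * Isotropic kernels and the spectral gap *)

Section IsotropicKernel.
Variables (R : realType) (N : nat) (W : groupType) (s : 'I_N -> W).
Hypothesis cox : fuchsian_coxeter_system s.
Variables (Delta : choiceType) (delta : Delta -> Delta -> W).
Hypothesis bld : building s delta.
Hypothesis reg : regular_building s delta.
Variables (o : Delta) (p : Delta -> Delta -> R) (L0 : nat).
Hypothesis kern : transition_kernel p.
Hypothesis iso : isotropic delta p.
Hypothesis range : forall x y, 0 < p x y -> (word_length s (delta x y) <= L0)%N.

Local Notation ell := (word_length s).
Local Notation sph := (sph delta).
Local Notation cball := (cball s delta).
Local Notation ballW := (ballW s).

Lemma p_ge0 x y : 0 <= p x y. Proof. by case: kern. Qed.

Lemma p_supp x y : p x y != 0 -> (ell (delta x y) <= L0)%N.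
Proof. by move=> p0; apply: range; rewrite lt_def p0 p_ge0. Qed.

Lemma ell_delta_sym x y : ell (delta x y) = ell (delta y x).
Proof. by rewrite (delta_inv cox bld y x) (ell_inv cox). Qed.

Lemma p_row x : \sum_(y <- cball L0 x) p x y = 1.
Proof.
have [_ /(_ x)] := kern; rewrite (@esum_seq _ _ (cball L0 x)).
- by rewrite sumEFin => -[].
- exact: (cball_uniq cox bld reg).
- by move=> y; rewrite lee_fin p_ge0.
- move=> y; rewrite (mem_cball cox bld reg) => h; congr EFin.
  by apply/eqP/negPn/negP => /p_supp; apply/negP.
Qed.

(** By bounded range all [k]-step sums are finite; [kstep_pk] identifies these reals with
    [kstep]. *)
Fixpoint pk k x y : R :=
  if k is k'.+1 then \sum_(z <- cball L0 x) p x z * pk k' z y else (x == y)%:R.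

Lemma pk_ge0 k x y : 0 <= pk k x y.
Proof.
elim: k x => [|k IH] x /=; first exact: ler0n.
by apply: sumr_ge0 => z _; rewrite mulr_ge0 ?p_ge0.
Qed.

Lemma pk_supp k x y : pk k x y != 0 -> (ell (delta x y) <= k * L0)%N.
Proof.
elim: k x => [|k IH] x /=.
  by case: (x =P y) => [-> _|_]; rewrite ?eqxx // (delta_refl bld) (ell1 cox).
move=> nz; have [z /andP[zin h]] : exists z, (z \in cball L0 x) && (pk k z y != 0).
  apply: contrapT => none; move: nz; rewrite big_seq big1 ?eqxx // => z zin.
  by apply/eqP; rewrite mulf_eq0; apply/orP; right; apply/negPn/negP => h;
    apply: none; exists z; rewrite zin.
apply: leq_trans (ell_delta_triangle cox bld x z y) _.
by move: zin; rewrite (mem_cball cox bld reg) mulSn => h1; rewrite leq_add ?IH.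
Qed.

Lemma mem_cball_sym n x y : (y \in cball n x) = (x \in cball n y).
Proof. by rewrite !(mem_cball cox bld reg) ell_delta_sym. Qed.

Lemma pk_add m n x z :
  pk (m + n) x z = \sum_(y <- cball (n * L0) z) pk m x y * pk n y z.
Proof.
elim: m x => [|m IH] x.
  rewrite add0n; have [xin|xout] := boolP (x \in cball (n * L0) z).
    rewrite (perm_big _ (perm_to_rem xin)) big_cons /= eqxx mul1r big_seq big1 ?addr0 //.
    move=> y; rewrite mem_rem_uniq ?(cball_uniq cox bld reg) // inE => /andP[yx _].
    by rewrite eq_sym (negbTE yx) mul0r.
  rewrite big_seq big1 => [|y yin] /=; last first.
    by case: (x =P y) yin xout => [-> -> //|_ _ _]; rewrite mul0r.
  apply/eqP/negPn/negP => /pk_supp; rewrite -(mem_cball cox bld reg) mem_cball_sym.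
  exact/negP.
rewrite addSn /=; under eq_bigr do rewrite IH mulr_sumr.
rewrite exchange_big; apply: eq_bigr => y _ /=.
by rewrite mulr_suml; apply: eq_bigr => t _; rewrite mulrA.
Qed.

Lemma pk1 x y : pk 1 x y = p x y.
Proof.
rewrite /=; have [yin|yout] := boolP (y \in cball L0 x).
  rewrite (perm_big _ (perm_to_rem yin)) big_cons /= eqxx mulr1 big_seq big1 ?addr0 //.
  move=> z; rewrite mem_rem_uniq ?(cball_uniq cox bld reg) // inE => /andP[/negbTE -> _].
  by rewrite mulr0.
rewrite big_seq big1 => [|z zin] /=; last first.
  by case: (z =P y) yout => [<-|_ _]; [rewrite zin|rewrite mulr0].
apply/esym/eqP/negPn/negP => /p_supp; rewrite -(mem_cball cox bld reg).
exact/negP.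
Qed.

Lemma pkSr k x z : pk k.+1 x z = \sum_(y <- cball L0 z) pk k x y * p y z.
Proof.
rewrite -addn1 pk_add mul1n; apply: eq_bigr => y _; by rewrite pk1.
Qed.

Lemma pk_mul m n x y z : pk m x y * pk n y z <= pk (m + n) x z.
Proof.
have [yin|yout] := boolP (y \in cball (n * L0) z).
  rewrite pk_add (perm_big _ (perm_to_rem yin)) big_cons lerDl.
  by apply: sumr_ge0 => t _; rewrite mulr_ge0 ?pk_ge0.
suff -> : pk n y z = 0 by rewrite mulr0 pk_ge0.
apply/eqP/negPn/negP => /pk_supp; rewrite -(mem_cball cox bld reg) mem_cball_sym.
exact/negP.
Qed.

Definition chamber_at w : Delta := xget o (sphere delta o w).

Lemma delta_chamber_at w : delta o (chamber_at w) = w.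
Proof.
rewrite /chamber_at; case: xgetP => [y _ //|none].
by have [y oy] := sphere_nonempty cox bld o w; case: (none y).
Qed.

Definition pw w := p o (chamber_at w).

Lemma pwE x y : p x y = pw (delta x y).
Proof. by apply: iso; rewrite delta_chamber_at. Qed.

(** The law of [delta x' X_1] for the walk at [x] depends only on [delta x' x]. This makes the
    retraction a Markov chain and is the isotropy hypothesis of the subadditive part. *)
Lemma sum_isotropic (G : W -> R) x1 x1' x2 x2' : delta x1' x1 = delta x2' x2 ->
  \sum_(y <- cball L0 x1) p x1 y * G (delta x1' y) =
  \sum_(y <- cball L0 x2) p x2 y * G (delta x2' y).
Proof.
move=> e; rewrite !big_cball; apply: eq_bigr => w _.
have [tau tauP] := heckeP cox bld reg R w.
have E x x' : \sum_(y <- sph x w) p x y * G (delta x' y) = pw w * tau G (delta x' x).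
  rewrite -tauP mulr_sumr big_seq [RHS]big_seq; apply: eq_bigr => y.
  by rewrite (mem_sph cox bld reg) => /eqP xy; rewrite pwE xy.
by rewrite !E e.
Qed.

Lemma pk_iso k x y x' y' : delta x y = delta x' y' -> pk k x y = pk k x' y'.
Proof.
elim: k x y x' y' => [|k IH] x y x' y' e.
  rewrite /=; congr (nat_of_bool _)%:R; apply/eqP/eqP => xy.
    by apply/(delta1P bld); rewrite -e xy (delta_refl bld).
  by apply/(delta1P bld); rewrite e xy (delta_refl bld).
(* Splitting off the last step centres the spheres at [y]; the other factor is by induction a
   function of [delta x z], to which [heckeP] applies. *)
rewrite !pkSr !big_cball; apply: eq_bigr => w _.
have [tau tauP] := heckeP cox bld reg R w.
have E a b : \sum_(z <- sph b w) pk k a z * p z b =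
    pw (w^-1)%g * tau (fun v => pk k o (chamber_at v)) (delta a b).
  rewrite -tauP mulr_sumr big_seq [RHS]big_seq; apply: eq_bigr => z.
  rewrite (mem_sph cox bld reg) => /eqP bz; rewrite pwE (delta_inv cox bld b z) bz mulrC.
  by congr (_ * _); apply: IH; rewrite delta_chamber_at.
by rewrite !E e.
Qed.

Lemma perm_ballW_inv n : perm_eq [seq (w^-1)%g | w <- ballW n] (ballW n).
Proof.
apply: uniq_perm; [|exact: ballW_uniq|].
  by rewrite map_inj_uniq ?ballW_uniq //; exact: invg_inj.
move=> w; apply/mapP/idP => [[v + ->]|wn]; first by rewrite !(mem_ballW cox) (ell_inv cox).
by exists (w^-1)%g; rewrite ?invgK // (mem_ballW cox) (ell_inv cox) -(mem_ballW cox).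
Qed.

(** Counting measure is stationary: seen from [y], the column runs over the inverse distances, whose
    spheres have the same cardinality. The Schur test needs columns as well as rows. *)
Lemma p_col y : \sum_(x <- cball L0 y) p x y = 1.
Proof.
rewrite -(p_row y) !big_cball -(perm_big _ (perm_ballW_inv L0)) big_map.
apply: eq_bigr => w _.
have E1 : \sum_(x <- sph y (w^-1)%g) p x y = (size (sph y (w^-1)%g))%:R * pw w.
  rewrite mulr_natl -iter_addr_0 -(count_predT (sph _ _)) -big_const_seq.
  rewrite big_seq [RHS]big_seq; apply: eq_bigr => x; rewrite (mem_sph cox bld reg) => /eqP yx.
  by rewrite pwE (delta_inv cox bld y x) yx invgK.
have E2 : \sum_(x <- sph y w) p y x = (size (sph y w))%:R * pw w.
  rewrite mulr_natl -iter_addr_0 -(count_predT (sph _ _)) -big_const_seq.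
  rewrite big_seq [RHS]big_seq; apply: eq_bigr => x; rewrite (mem_sph cox bld reg) => /eqP yx.
  by rewrite pwE yx.
by rewrite E1 E2 (size_sph_inv cox bld reg R).
Qed.

Lemma pk_row k n x : (k * L0 <= n)%N -> \sum_(y <- cball n x) pk k x y = 1.
Proof.
elim: k n x => [|k IH] n x kn.
  rewrite (big_supp (l2 := [:: x])) ?(cball_uniq cox bld reg) //.
  - by rewrite big_seq1 /= eqxx.
  - by move=> y _ /=; rewrite inE (eq_sym y); case: (x =P y); rewrite ?eqxx.
  - by move=> y; rewrite inE => /eqP -> _;
    rewrite (mem_cball cox bld reg) (delta_refl bld) (ell1 cox).
rewrite /= exchange_big /= -[RHS](p_row x) big_seq [RHS]big_seq.
apply: eq_bigr => z zin; rewrite -mulr_sumr -[RHS]mulr1; congr (_ * _).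
rewrite -(IH (k * L0)%N z) //; apply: big_supp; rewrite ?(cball_uniq cox bld reg) //.
  by move=> y _ /pk_supp; rewrite (mem_cball cox bld reg).
move=> y _ /pk_supp h; rewrite (mem_cball cox bld reg).
apply: leq_trans (ell_delta_triangle cox bld x z y) (leq_trans _ kn).
by rewrite mulSn leq_add // -(mem_cball cox bld reg).
Qed.

Lemma pk_col k n y : (k * L0 <= n)%N -> \sum_(x <- cball n y) pk k x y = 1.
Proof.
elim: k n y => [|k IH] n y kn.
  rewrite (big_supp (l2 := [:: y])) ?(cball_uniq cox bld reg) //.
  - by rewrite big_seq1 /= eqxx.
  - by move=> x _ /=; rewrite inE; case: (x =P y); rewrite ?eqxx.
  - by move=> x; rewrite inE => /eqP -> _;
    rewrite (mem_cball cox bld reg) (delta_refl bld) (ell1 cox).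
under eq_bigr do rewrite pkSr.
rewrite exchange_big /= -[RHS](p_col y) big_seq [RHS]big_seq.
apply: eq_bigr => z zin; rewrite -mulr_suml -[RHS]mul1r; congr (_ * _).
rewrite -(IH (k * L0)%N z) //; apply: big_supp; rewrite ?(cball_uniq cox bld reg) //.
  by move=> x _ /pk_supp; rewrite (mem_cball cox bld reg) ell_delta_sym.
move=> x _ /pk_supp h; rewrite (mem_cball cox bld reg).
apply: leq_trans (ell_delta_triangle cox bld y z x) (leq_trans _ kn).
rewrite mulSn leq_add //; first by rewrite -(mem_cball cox bld reg).
by rewrite ell_delta_sym.
Qed.

Lemma kstep_pk k x y : kstep (fun a b => (p a b)%:E) k x y = (pk k x y)%:E.
Proof.
elim: k x => [|k IH] x; first by rewrite /=; case: (x =P y).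
rewrite /= (@esum_seq _ _ (cball L0 x)) ?(cball_uniq cox bld reg) //.
- by rewrite -sumEFin; apply: eq_bigr => z _; rewrite IH EFinM.
- by move=> z; rewrite IH -EFinM lee_fin mulr_ge0 ?p_ge0 ?pk_ge0.
- move=> z; rewrite (mem_cball cox bld reg) => h.
  suff -> : p x z = 0 by rewrite mul0e.
  by apply/eqP/negPn/negP => /p_supp; apply/negP.
Qed.

End IsotropicKernel.

(** Cauchy-Schwarz in the form of the Schur test, summed from [2 a u <= a^2 g + u^2 / g] with the
    optimal [a = S / M]. *)
Lemma weighted_cauchy (R : realType) (T : Type) (l : seq T) (w u g : T -> R) (M : R) :
  0 < M -> (forall z, 0 <= w z) -> (forall z, 0 < g z) ->
  \sum_(z <- l) w z * g z <= M ->
  (\sum_(z <- l) w z * u z) ^+ 2 <= M * \sum_(z <- l) w z * (u z ^+ 2 / g z).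
Proof.
move=> M0 w0 g0 wg; set S := \sum_(z <- l) w z * u z; set T' := \sum_(z <- l) _.
pose a := S / M.
have h : 2 * a * S <= a ^+ 2 * M + T'.
  apply: (@le_trans _ _ (a ^+ 2 * (\sum_(z <- l) w z * g z) + T')).
    rewrite !mulr_sumr -big_split; apply: ler_sum => z _ /=.
    have -> : 2 * a * (w z * u z) = w z * (2 * a * u z) by ring.
    have -> : a ^+ 2 * (w z * g z) + w z * (u z ^+ 2 / g z) =
        w z * (a ^+ 2 * g z + u z ^+ 2 / g z) by ring.
    apply: ler_wpM2l => //; rewrite -subr_ge0.
    have -> : a ^+ 2 * g z + u z ^+ 2 / g z - 2 * a * u z = (a * g z - u z) ^+ 2 / g z.
      by field; rewrite gt_eqF.
    by rewrite divr_ge0 ?sqr_ge0 // ltW.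
  by rewrite lerD2r ler_wpM2l // sqr_ge0.
have aM : S = a * M by rewrite /a mulfVK // gt_eqF.
move: h; rewrite aM => h.
have : M * (2 * a * (a * M)) <= M * (a ^+ 2 * M + T') by rewrite ler_pM2l.
nra.
Qed.

Lemma le_sum_supp (R : realType) (T : eqType) (B C : seq T) (f : T -> R) :
  uniq B -> uniq C -> (forall x, 0 <= f x) ->
  (forall x, x \in B -> f x != 0 -> x \in C) ->
  \sum_(x <- B) f x <= \sum_(x <- C) f x.
Proof.
move=> uB uC f0 BC.
rewrite (@big_supp _ _ B [seq x <- C | x \in B]) ?filter_uniq //; first last.
- by move=> x; rewrite mem_filter => /andP[].
- by move=> x xB fx; rewrite mem_filter xB BC.
rewrite big_filter big_mkcond; apply: ler_sum => x _.
by case: ifP.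
Qed.

(** * Contraction in l2 and decay of the transition probabilities *)

Section SpectralGap.
Variables (R : realType) (N : nat) (W : groupType) (s : 'I_N -> W).
Hypothesis cox : fuchsian_coxeter_system s.
Variables (Delta : choiceType) (delta : Delta -> Delta -> W).
Hypothesis bld : building s delta.
Hypothesis reg : regular_building s delta.
Hypothesis thick : thick_building s delta.
Variables (o : Delta) (p : Delta -> Delta -> R) (L0 : nat).
Hypothesis kern : transition_kernel p.
Hypothesis iso : isotropic delta p.
Hypothesis range : forall x y, 0 < p x y -> (word_length s (delta x y) <= L0)%N.
Hypothesis irr : irreducible_kernel p.

Local Notation ell := (word_length s).
Local Notation sph := (sph delta).
Local Notation cball := (cball s delta).
Local Notation pk := (pk s delta p L0).
Local Notation qpar := (qpar s delta).

Let pk_ge0 := pk_ge0 s delta L0 kern.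

(* In a thick panel a path [x -> y] can be rerouted [x -> z -> y], so that the
   possible transition times between adjacent chambers are closed under
   addition. *)
Lemma common_time : exists m, (0 < m)%N /\
  forall i x y, delta x y = s i -> 0 < pk m x y.
Proof.
have /choice[k kP] : forall i, exists k, 0 < pk k o (chamber_at delta o (s i)).
  move=> i; have [k] := irr o (chamber_at delta o (s i)).
  rewrite (kstep_pk cox bld reg kern range) lte_fin.
  by exists k.
have kpos i x y : delta x y = s i -> 0 < pk (k i) x y.
  move=> xy; rewrite (pk_iso cox bld reg o kern iso range (k i)
    (x' := o) (y' := chamber_at delta o (s i))) //.
  by rewrite xy (delta_chamber_at cox bld).
have k0 i : (0 < k i)%N.
  rewrite lt0n; apply/eqP => ki; have := kP i; rewrite ki /=.
  case: (o =P _) => [e|_]; last by rewrite ltxx.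
  have := delta_chamber_at cox bld o (s i); rewrite -e (delta_refl bld).
  by move/esym/(s_neq1 cox).
have mult i m x y : delta x y = s i -> 0 < pk (m.+1 * k i) x y.
  elim: m x y => [|m IH] x y xy; first by rewrite mul1n; apply: kpos.
  have [z [xz yz _]] := panel_third cox bld reg thick xy.
  rewrite mulSn; apply: (lt_le_trans _ (pk_mul cox bld reg L0 kern (k i) (m.+1 * k i) x z y)).
  by rewrite mulr_gt0 ?kpos ?IH //; apply: (delta_sym1 cox bld).
exists (\prod_i k i)%N; split; first by apply: prodn_gt0.
move=> i x y xy; rewrite (bigD1 i) //= mulnC.
have : (0 < \prod_(j | j != i) k j)%N by apply: prodn_cond_gt0.
by case: (\prod_(j | j != i) k j)%N => // m _; apply: mult.
Qed.

Variables (J : seq 'I_N) (f : W -> R) (rho : R) (m : nat).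
Hypothesis J0 : (0 < size J)%N.
Hypothesis f0 : forall w, 0 < f w.
Hypothesis rho01 : 0 < rho < 1.
Hypothesis fsuper : forall w, mean_op s delta J f w <= rho * f w.
Hypothesis mpos : forall i x y, delta x y = s i -> 0 < pk m x y.

Let n0 : 0 < (size J)%:R :> R. Proof. by rewrite ltr0n. Qed.
Let q2 i : (2 <= qpar i)%N. Proof. exact: qpar_ge2 reg thick o i. Qed.

Let Q x z : R :=
  (size J)%:R^-1 * \sum_(i <- J) (qpar i)%:R^-1 * (delta x z == s i)%:R.

Let Q_ge0 x z : 0 <= Q x z.
Proof. by rewrite mulr_ge0 ?invr_ge0 //; apply: sumr_ge0 => i _; rewrite mulr_ge0 ?invr_ge0. Qed.

Let Q_sym x z : Q x z = Q z x.
Proof.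
rewrite /Q; congr (_ * _); apply: eq_bigr => i _; congr (_ * (nat_of_bool _)%:R).
by apply/eqP/eqP => /(delta_sym1 cox bld).
Qed.

Lemma sum_Q B x (h : Delta -> R) : uniq B -> (forall z, 0 <= h z) ->
  \sum_(z <- B) Q x z * h z <=
  (size J)%:R^-1 * \sum_(i <- J) (qpar i)%:R^-1 * \sum_(z <- sph x (s i)) h z.
Proof.
move=> uB h0; under eq_bigr do rewrite /Q -mulrA.
rewrite -mulr_sumr ler_pM2l ?invr_gt0 //.
under eq_bigr do rewrite mulr_suml.
rewrite exchange_big; apply: ler_sum => i _ /=.
under eq_bigr do rewrite -mulrA.
rewrite -mulr_sumr ler_wpM2l ?invr_ge0 //.
apply: (@le_trans _ _ (\sum_(z <- sph x (s i)) (delta x z == s i)%:R * h z)).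
  apply: le_sum_supp => //; rewrite ?sph_uniq // => z.
    by rewrite mulr_ge0.
  rewrite (mem_sph cox bld reg) => _; case: (delta x z == s i) => //.
  by rewrite mul0r eqxx.
by apply: ler_sum => z _; case: eqP => _; rewrite ?mul1r ?mul0r.
Qed.

Let Q_f B x : uniq B -> \sum_(z <- B) Q x z * f (delta o z) <= rho * f (delta o x).
Proof.
move=> uB; apply: le_trans (sum_Q x uB _) _; first by move=> z; rewrite ltW.
by rewrite -(mean_opE cox bld reg thick).
Qed.

Let Q_row n x : (0 < n)%N -> \sum_(z <- cball n x) Q x z = 1.
Proof.
move=> n1; rewrite -mulr_sumr exchange_big /=.
rewrite (eq_bigr (fun=> 1)) => [|i _].
  by rewrite sum_cst_seq mulr1 mulVf // gt_eqF.
rewrite -mulr_sumr (@big_supp _ _ _ (sph x (s i))) ?(cball_uniq cox bld reg) ?sph_uniq //.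
- rewrite big_seq (eq_bigr (fun=> 1)) => [|z]; last first.
    by rewrite (mem_sph cox bld reg) => ->.
  rewrite -big_seq sum_cst_seq mulr1 (size_sph1 reg) mulVf // pnatr_eq0.
  by have := q2 i; lia.
- move=> z _; rewrite (mem_sph cox bld reg); case: (delta x z == s i) => //.
  by rewrite eqxx.
- move=> z; rewrite (mem_sph cox bld reg) (mem_cball cox bld reg) => /eqP -> _.
  by rewrite (ell_s cox).
Qed.

Lemma pk_le1 k x y : pk k x y <= 1.
Proof.
have [->|nz] := eqVneq (pk k x y) 0; first exact: ler01.
rewrite -(pk_row cox bld reg kern range x (leqnn (k * L0))).
have yin : y \in cball (k * L0) x.
  by rewrite (mem_cball cox bld reg); exact: (pk_supp cox bld reg nz).
rewrite (perm_big _ (perm_to_rem yin)) big_cons lerDl.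
by apply: sumr_ge0 => z _; apply: pk_ge0.
Qed.

(** [Q] lives on pairs of adjacent chambers, where [pk m] takes finitely many positive values
    [a i <= 1]; their product bounds all of them from below. The factor [1/2] keeps [1 - c] positive
    for the remainder [K]. *)
Lemma minorization : exists c, 0 < c <= 2^-1 /\ forall x z, c * Q x z <= pk m x z.
Proof.
pose a i := pk m o (chamber_at delta o (s i)).
have a_gt0 i : 0 < a i by apply: (mpos (i := i)); rewrite (delta_chamber_at cox bld).
exists (2^-1 * \prod_i a i); split.
  rewrite mulr_gt0 ?invr_gt0 ?prodr_gt0 //= ler_piMr //.
  by apply: prodr_ile1 => i; rewrite ltW //= pk_le1.
move=> x z; have [[i xz]|none] := pselect (exists i, delta x z = s i); last first.
  suff -> : Q x z = 0 by rewrite mulr0 pk_ge0.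
  rewrite /Q big1 ?mulr0 // => i _; case: eqP => [e|_]; last by rewrite mulr0.
  by case: none; exists i.
have Q1 : Q x z <= 1.
  rewrite /Q ler_pdivrMl // mulr1 -[leRHS]mulr1 -(sum_cst_seq J (1 : R)).
  apply: ler_sum => j _; apply: (@le_trans _ _ ((qpar j)%:R^-1)).
    by rewrite ler_piMr ?invr_ge0 // lern1 leq_b1.
  by rewrite invf_le1 ?ltr0n ?ler1n; have := q2 j; lia.
have -> : pk m x z = a i.
  by apply: (pk_iso cox bld reg o kern iso range); rewrite (delta_chamber_at cox bld).
have pa : \prod_j a j <= a i.
  rewrite (bigD1 i) //= ler_piMr ?(ltW (a_gt0 i)) //.
  suff : 0 <= \prod_(j | j != i) a j <= 1 by case/andP.
  apply: (big_ind (fun y : R => 0 <= y <= 1)) => [|y z0 /andP[y0 y1] /andP[z00 z1]|j _];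
    rewrite ?lexx ?ler01 //.
    by rewrite mulr_ge0 // mulr_ile1.
  by rewrite ltW //= pk_le1.
have pa0 : 0 <= \prod_j a j by apply: prodr_ge0 => j _; exact: ltW.
have := Q_ge0 x z; nra.
Qed.

Section L2.
Variable c : R.
Hypothesis c01 : 0 < c <= 2^-1.
Hypothesis minor : forall x z, c * Q x z <= pk m x z.

Let K x z := pk m x z - c * Q x z.
Let K_ge0 x z : 0 <= K x z. Proof. by rewrite subr_ge0. Qed.

Let Q_supp x z : Q x z != 0 -> (ell (delta x z) <= 1)%N.
Proof.
move=> nz; suff [i ->] : exists i, delta x z = s i by rewrite (ell_s cox).
apply: contrapT => none; move: nz; rewrite /Q big1 ?mulr0 ?eqxx // => i _.
by case: eqP => [e|_]; [case: none; exists i|rewrite mulr0].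
Qed.

Let K_supp x z : K x z != 0 -> (ell (delta x z) <= (m * L0).+1)%N.
Proof.
move=> nz; have [p0|] := eqVneq (pk m x z) 0; last first.
  by move/(pk_supp cox bld reg)/leqW.
have [Q0|/Q_supp] := eqVneq (Q x z) 0; last by lia.
by move: nz; rewrite /K p0 Q0 mulr0 subrr eqxx.
Qed.

Let K_row B x : uniq B -> \sum_(z <- B) K x z <= 1 - c.
Proof.
move=> uB; apply: (@le_trans _ _ (\sum_(z <- cball (m * L0).+1 x) K x z)).
  apply: le_sum_supp; rewrite ?(cball_uniq cox bld reg) // => z _ /K_supp.
  by rewrite (mem_cball cox bld reg).
by rewrite sumrB -mulr_sumr Q_row // (pk_row cox bld reg kern range) // mulr1.
Qed.

Let K_col B z : uniq B -> \sum_(x <- B) K x z <= 1 - c.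
Proof.
move=> uB; apply: (@le_trans _ _ (\sum_(x <- cball (m * L0).+1 z) K x z)).
  apply: le_sum_supp; rewrite ?(cball_uniq cox bld reg) // => x _ /K_supp.
  by rewrite (mem_cball cox bld reg) (ell_delta_sym cox bld).
rewrite sumrB -mulr_sumr (pk_col cox bld reg o kern iso range) //.
by under eq_bigr do rewrite Q_sym; rewrite Q_row // mulr1.
Qed.

Let eta := 1 - c * (1 - rho ^+ 2).

(* Split [pk m = c Q + K]; the Schur test with weight [f] bounds [Q], and [K]
   has row and column sums [1 - c]. *)
Lemma l2_contraction B B' (v : Delta -> R) : uniq B -> uniq B' ->
  \sum_(x <- B') (\sum_(z <- B) pk m x z * v z) ^+ 2 <= eta * \sum_(z <- B) v z ^+ 2.
Proof.
move=> uB uB'; case/andP: rho01 => r0 r1; case/andP: c01 => c0 c2.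
pose fo z := f (delta o z).
have fo0 z : 0 < fo z by exact: f0.
have pt x : (\sum_(z <- B) pk m x z * v z) ^+ 2 <=
    c * (rho * fo x * \sum_(z <- B) Q x z * (v z ^+ 2 / fo z)) +
    \sum_(z <- B) K x z * v z ^+ 2.
  have -> : \sum_(z <- B) pk m x z * v z =
      c * (\sum_(z <- B) Q x z * v z) + \sum_(z <- B) K x z * v z.
    rewrite mulr_sumr -big_split; apply: eq_bigr => z _ /=; rewrite /K; ring.
  have := @weighted_cauchy R _ B (Q x) v fo (rho * fo x) _ _ _ (Q_f x uB).
  move/(_ (mulr_gt0 r0 (fo0 x)) (Q_ge0 x) fo0).
  have := @weighted_cauchy R _ B (K x) v (fun=> 1) (1 - c) _ (K_ge0 x) (fun=> ltr01).
  have c1 : 0 < 1 - c by lra.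
  under eq_bigr do rewrite mulr1.
  move/(_ c1 (K_row x uB)).
  under [in X in _ <= X]eq_bigr do rewrite divr1.
  set A := \sum_(z <- B) Q x z * v z; set D := \sum_(z <- B) K x z * v z.
  set A' := \sum_(z <- B) _; set D' := \sum_(z <- B) _ => hD hA.
  (* Convexity of the square: [c A + D] is the mean of [A] and [D / (1 - c)] with weights [c] and
     [1 - c]. *)
  apply: (@le_trans _ _ (c * A ^+ 2 + D ^+ 2 / (1 - c))).
    rewrite -subr_ge0.
    have -> : c * A ^+ 2 + D ^+ 2 / (1 - c) - (c * A + D) ^+ 2 =
        c * ((1 - c) * A - D) ^+ 2 / (1 - c) by field; rewrite gt_eqF.
    apply: divr_ge0; last exact: ltW.
    by rewrite mulr_ge0 ?sqr_ge0 // ltW.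
  apply: lerD; first by rewrite ler_pM2l.
  by rewrite ler_pdivrMr // mulrC.
apply: (@le_trans _ _ (\sum_(x <- B') (c * (rho * fo x * \sum_(z <- B) Q x z * (v z ^+ 2 / fo z)) +
    \sum_(z <- B) K x z * v z ^+ 2))); first by apply: ler_sum => x _; exact: pt.
rewrite big_split /=.
have h1 : \sum_(x <- B') c * (rho * fo x * \sum_(z <- B) Q x z * (v z ^+ 2 / fo z)) <=
    c * rho ^+ 2 * \sum_(z <- B) v z ^+ 2.
  rewrite -mulr_sumr -mulrA ler_pM2l //.
  under eq_bigr do rewrite mulr_sumr.
  rewrite exchange_big mulr_sumr; apply: ler_sum => z _ /=.
  have -> : \sum_(x <- B') rho * fo x * (Q x z * (v z ^+ 2 / fo z)) =
      rho * (v z ^+ 2 / fo z) * \sum_(x <- B') Q z x * fo x.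
    by rewrite mulr_sumr; apply: eq_bigr => x _; rewrite (Q_sym z); ring.
  have := Q_f z uB'; rewrite -/(fo z) => h.
  apply: (@le_trans _ _ (rho * (v z ^+ 2 / fo z) * (rho * fo z))).
    apply: ler_wpM2l => //; apply: mulr_ge0; first exact: ltW.
    by apply: divr_ge0; rewrite ?sqr_ge0 // ltW.
  rewrite le_eqVlt; apply/orP; left; apply/eqP.
  by field; rewrite gt_eqF.
have h2 : \sum_(x <- B') \sum_(z <- B) K x z * v z ^+ 2 <=
    (1 - c) * \sum_(z <- B) v z ^+ 2.
  rewrite exchange_big mulr_sumr; apply: ler_sum => z _ /=.
  by rewrite -mulr_suml ler_wpM2r ?sqr_ge0 // K_col.
apply: le_trans (lerD h1 h2) _; rewrite -mulrDl /eta.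
by rewrite le_eqVlt; apply/orP; left; apply/eqP; ring.
Qed.

Lemma eta_bounds : 0 < eta < 1.
Proof.
case/andP: rho01 => r0 r1; case/andP: c01 => c0 c2; rewrite /eta.
have r2 : rho ^+ 2 < 1 by rewrite expr_lt1 // ltW.
have h1 : 0 < c * (1 - rho ^+ 2) by rewrite mulr_gt0 // subr_gt0.
have h2 : 0 <= c * rho ^+ 2 by rewrite mulr_ge0 ?sqr_ge0 // ltW.
by apply/andP; split; lra.
Qed.

Lemma pk_l2 k B y : uniq B -> \sum_(x <- B) pk (k * m) x y ^+ 2 <= eta ^+ k.
Proof.
elim: k B => [|k IH] B uB.
  rewrite mul0n expr0; apply: (@le_trans _ _ (\sum_(x <- [:: y]) pk 0 x y ^+ 2)).
    apply: le_sum_supp => // x; first by rewrite sqr_ge0.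
    by move=> _ /=; rewrite inE; case: (x == y) => //; rewrite expr0n eqxx.
  by rewrite big_seq1 /= eqxx expr1n.
rewrite mulSn; under eq_bigr do rewrite (pk_add cox bld reg).
apply: le_trans (l2_contraction _ _ _) _; rewrite ?(cball_uniq cox bld reg) //.
case/andP: eta_bounds => e0 _.
by rewrite exprS ler_pM2l // IH // (cball_uniq cox bld reg).
Qed.

(** A single entry is at most the l2 norm of its column at the time [j * m]; the other [k %% m]
    steps only average such entries. *)
Lemma pk_decay_sq k x y : pk k x y ^+ 2 <= eta ^+ (k %/ m).
Proof.
case/andP: eta_bounds => e0 e1.
set j := (k %/ m)%N; set t := (k %% m)%N.
have bnd z : pk (j * m) z y <= Num.sqrt (eta ^+ j).
  rewrite -(ger0_norm (pk_ge0 _ _ _)) -sqrtr_sqr ler_sqrt ?exprn_ge0 ?(ltW e0) //.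
  by have := @pk_l2 j [:: z] y isT; rewrite big_seq1.
have : pk k x y <= Num.sqrt (eta ^+ j).
  rewrite (divn_eq k m) -/j -/t addnC (pk_add cox bld reg).
  apply: (@le_trans _ _ (\sum_(z <- cball (j * m * L0) y) pk t x z * Num.sqrt (eta ^+ j))).
    by apply: ler_sum => i _; apply: ler_wpM2l; [exact: pk_ge0|exact: bnd].
  rewrite -mulr_suml ler_piMl ?sqrtr_ge0 //.
  rewrite -(pk_row cox bld reg kern range x (leqnn (t * L0))).
  apply: le_sum_supp; rewrite ?(cball_uniq cox bld reg) // => z.
  by move=> _ /(pk_supp cox bld reg); rewrite (mem_cball cox bld reg).
rewrite -ler_sqr ?nnegrE ?sqrtr_ge0 ?pk_ge0 //.
by rewrite sqr_sqrtr // exprn_ge0 // ltW.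
Qed.
End L2.
End SpectralGap.

Section Decay.
Variables (R : realType) (N : nat) (W : groupType) (s : 'I_N -> W).
Hypothesis cox : fuchsian_coxeter_system s.
Variables (Delta : choiceType) (delta : Delta -> Delta -> W).
Hypothesis bld : building s delta.
Hypothesis reg : regular_building s delta.
Hypothesis thick : thick_building s delta.
Variables (o : Delta) (p : Delta -> Delta -> R) (L0 : nat).
Hypothesis kern : transition_kernel p.
Hypothesis iso : isotropic delta p.
Hypothesis range : forall x y, 0 < p x y -> (word_length s (delta x y) <= L0)%N.
Hypothesis irr : irreducible_kernel p.

Lemma pk_decay : exists (eta : R) (m : nat), [/\ 0 < eta < 1, (0 < m)%N &
  forall k x y, pk s delta p L0 k x y ^+ 2 <= eta ^+ (k %/ m)].
Proof.
have [J [r [uJ sJ ds]]] := descent_structure R cox bld reg thick o.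
have [f [rho [f0 rho01 fsuper]]] := superharmonic_weight R cox bld reg thick o uJ sJ ds.
have [m [m0 mpos]] := common_time cox bld reg thick o kern iso range irr.
have J0 : (0 < size J)%N by case: sJ => ->.
have [c [c01 minor]] := minorization cox bld reg thick o kern iso range J0 rho01 mpos.
exists (1 - c * (1 - rho ^+ 2)), m; split=> //; first exact: eta_bounds.
move=> k x y.
exact: (pk_decay_sq cox bld reg thick o kern iso range J0 f0 rho01 fsuper c01 minor).
Qed.
End Decay.

(** * Subadditive functionals of isotropic walks *)

Section PathExpectation.
Variables (R : realType) (T : choiceType) (nb : T -> seq T) (p : T -> T -> R).
Hypothesis p0 : forall x y, 0 <= p x y.
Hypothesis p1 : forall x, \sum_(y <- nb x) p x y = 1.

(** The expectation of [F [:: X_1; ...; X_n]] for the walk from [x]. As a finite iterated sum it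
    lets the subadditive theory be developed without a probability space. *)
Fixpoint Eop n x (F : seq T -> R) : R :=
  if n is n'.+1 then \sum_(y <- nb x) p x y * Eop n' y (fun l => F (y :: l))
  else F [::].

Definition nbr : rel T := [rel x y | y \in nb x].

Lemma ler_Eop n x F G :
  (forall l, size l = n -> path nbr x l -> F l <= G l) -> Eop n x F <= Eop n x G.
Proof.
elim: n x F G => [|n IH] x F G FG /=; first exact: FG.
rewrite big_seq [leRHS]big_seq; apply: ler_sum => y yx.
apply: ler_wpM2l => //; apply: IH => l sl pl; apply: FG; first by rewrite /= sl.
by apply/andP.
Qed.

Lemma eq_Eop n x F G :
  (forall l, size l = n -> path nbr x l -> F l = G l) -> Eop n x F = Eop n x G.
Proof.
by move=> FG; apply/eqP; rewrite eq_le !ler_Eop // => l sl pl; rewrite FG.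
Qed.

Lemma Eop_cst n x a : Eop n x (fun=> a) = a.
Proof.
elim: n x => [|n IH] x //=; under eq_bigr do rewrite IH.
by rewrite -mulr_suml p1 mul1r.
Qed.

Lemma EopD n x F G : Eop n x (fun l => F l + G l) = Eop n x F + Eop n x G.
Proof.
elim: n x F G => [|n IH] x F G //=; rewrite -big_split; apply: eq_bigr => y _ /=.
by rewrite IH mulrDr.
Qed.

Lemma EopZ n x a F : Eop n x (fun l => a * F l) = a * Eop n x F.
Proof.
elim: n x F => [|n IH] x F //=; rewrite mulr_sumr; apply: eq_bigr => y _.
by rewrite IH mulrCA.
Qed.

Lemma EopB n x F G : Eop n x (fun l => F l - G l) = Eop n x F - Eop n x G.
Proof.
rewrite -mulN1r -EopZ -EopD; apply: eq_Eop => l _ _; by rewrite mulN1r.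
Qed.

Lemma Eop_cat m n x F :
  Eop (m + n) x F = Eop m x (fun l => Eop n (last x l) (fun l' => F (l ++ l'))).
Proof.
elim: m x F => [|m IH] x F //=; apply: eq_bigr => y _.
by rewrite IH.
Qed.

Lemma Eop_take m n x F : Eop (m + n) x (fun l => F (take m l)) = Eop m x F.
Proof.
rewrite Eop_cat; apply: eq_Eop => l sl _.
under eq_Eop => l' _ _ do rewrite take_size_cat //.
exact: Eop_cst.
Qed.

Variables (V : Type) (d : T -> T -> V).
Hypothesis iso : forall (G : V -> R) x1 x1' x2 x2', d x1' x1 = d x2' x2 ->
  \sum_(y <- nb x1) p x1 y * G (d x1' y) = \sum_(y <- nb x2) p x2 y * G (d x2' y).
Hypothesis dsurj : forall x v, exists y, d x y = v.
Hypothesis dxx : forall x y, d x x = d y y.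

Lemma Eop_iso_gen n x x' y y' (G : seq V -> R) : d x' x = d y' y ->
  Eop n x (fun l => G (map (d x') l)) = Eop n y (fun l => G (map (d y') l)).
Proof.
elim: n x x' y y' G => [|n IH] x x' y y' G e //=.
have /choice[r rP] := dsurj x'.
(* By the induction hypothesis the value does not depend on which chamber [r v] at distance [v]
   stands for the first position. *)
pose H v := Eop n (r v) (fun l => G (v :: map (d x') l)).
transitivity (\sum_(z <- nb x) p x z * H (d x' z)).
  apply: eq_bigr => z _; congr (_ * _); rewrite /H.
  by apply: (IH _ _ _ _ (fun l => G (d x' z :: l))); rewrite rP.
rewrite (iso H e); apply: eq_bigr => z _; congr (_ * _); rewrite /H.
by apply: (IH _ _ _ _ (fun l => G (d y' z :: l))); rewrite rP.
Qed.

Lemma Eop_iso n x y (G : seq V -> R) :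
  Eop n x (fun l => G (map (d x) l)) = Eop n y (fun l => G (map (d y) l)).
Proof. exact: Eop_iso_gen. Qed.

Section Subadditive.
Variables (phiv : V -> R) (C : R).
Local Notation phi x y := (phiv (d x y)).
Hypothesis phi0 : forall v, 0 <= phiv v.
Hypothesis phixx : forall x, phi x x = 0.
Hypothesis sub : forall x y z, phi x z <= phi x y + phi y z.
Hypothesis phiC : forall x y, y \in nb x -> phi x y <= C.
Variable o : T.

Lemma phi_path x l : path nbr x l -> phi x (last x l) <= C * (size l)%:R.
Proof.
elim: l x => [|y l IH] x /=; first by rewrite phixx mulr0.
move=> /andP[xy /IH h]; apply: le_trans (sub x y _) _.
by rewrite -natr1 mulrDr mulr1 addrC lerD // phiC.
Qed.

Let C0 : 0 <= C.
Proof.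
suff [y yo] : exists y, y \in nb o by apply: le_trans (phiC yo).
have := p1 o; case: (nb o) => [|y l _]; last by exists y; rewrite inE eqxx.
by rewrite big_nil => /esym/eqP; rewrite oner_eq0.
Qed.

Definition mean_phi n := Eop n o (fun l => phi o (last o l)).

Lemma Eop_last_iso n x (h : R -> R) :
  Eop n x (fun l => h (phi x (last x l))) = Eop n o (fun l => h (phi o (last o l))).
Proof.
have E y : Eop n y (fun l => h (phi y (last y l))) =
    Eop n y (fun l => h (phiv (last (d o o) (map (d y) l)))).
  by apply: eq_Eop => l _ _; rewrite (dxx o y) last_map.
by rewrite !E; exact: (Eop_iso n x o (fun l => h (phiv (last (d o o) l)))).
Qed.

Lemma mean_phi_ge0 n : 0 <= mean_phi n.
Proof. by rewrite -(Eop_cst n o 0); apply: ler_Eop. Qed.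

Lemma mean_phi_sub m n : mean_phi (m + n) <= mean_phi m + mean_phi n.
Proof.
rewrite /mean_phi Eop_cat -[X in _ + X](Eop_cst m o) -EopD.
apply: ler_Eop => l sl _.
rewrite -(Eop_last_iso n (last o l) id) -[X in X + _](Eop_cst n (last o l)) -EopD.
by apply: ler_Eop => l' _ _; rewrite last_cat.
Qed.

Lemma mean_phi_le n : mean_phi n <= C * n%:R.
Proof. by rewrite -[leRHS](Eop_cst n o); apply: ler_Eop => l <-; exact: phi_path. Qed.

Definition rate := inf [set mean_phi n.+1 / n.+1%:R | n in [set: nat]].

Let rate_has_inf : has_inf [set mean_phi n.+1 / n.+1%:R | n in [set: nat]].
Proof.
split; first by exists (mean_phi 1 / 1%:R), 0%N.
by exists 0 => _ [n _ <-]; rewrite divr_ge0 ?mean_phi_ge0.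
Qed.

Lemma rate_le n : (0 < n)%N -> rate * n%:R <= mean_phi n.
Proof.
case: n => // n _; rewrite -ler_pdivlMr ?ltr0n //.
by apply: ge_inf; [case: rate_has_inf|exists n].
Qed.

Lemma rate_ge0 : 0 <= rate.
Proof.
apply: lb_le_inf; first by case: rate_has_inf.
by move=> _ [n _ <-]; rewrite divr_ge0 ?mean_phi_ge0.
Qed.

Lemma rate_approx e : 0 < e -> exists2 n, (0 < n)%N & mean_phi n < (rate + e) * n%:R.
Proof.
move=> e0; have [_ [n _ <-] h] := inf_adherent e0 rate_has_inf.
by exists n.+1 => //; rewrite -ltr_pdivrMr ?ltr0n.
Qed.

Lemma mean_phi_block k n : mean_phi n <= (n %/ k)%:R * mean_phi k + C * (n %% k)%:R.
Proof.
rewrite [in leLHS](divn_eq n k); apply: le_trans (mean_phi_sub _ _) _.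
apply: lerD (mean_phi_le _); elim: (n %/ k)%N => [|j IH].
  by rewrite mul0r -[leRHS](mulr0 C) (mean_phi_le 0).
rewrite mulSn -nat1r mulrDl mul1r; apply: le_trans (mean_phi_sub _ _) _.
by rewrite lerD2l.
Qed.

(** Fekete's lemma: for a nearly optimal [k] the incomplete block costs at most the constant
    [C k]. *)
Lemma mean_phi_cvg : (fun n => n%:R^-1 * mean_phi n) @ \oo --> rate.
Proof.
apply/cvgrPdist_le => e e0.
have e2 : 0 < e / 2 by rewrite divr_gt0.
have [k k0 ek] := rate_approx e2.
have K0 : 0 <= C * k%:R by rewrite mulr_ge0.
near=> n.
have n0 : (0 < n)%N by near: n; exists 1%N.
have nR : 0 < n%:R :> R by rewrite ltr0n.
have Cn : C * k%:R <= e / 2 * n%:R.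
  rewrite -ler_pdivrMl //; near: n.
  by apply: nbhs_infty_ger.
rewrite distrC ler_distl; apply/andP; split.
  rewrite mulrC ler_pdivlMr //; apply: le_trans (rate_le n0).
  by rewrite ler_wpM2r // lerBlDr lerDl ltW.
rewrite mulrC ler_pdivrMr //; apply: le_trans (mean_phi_block k n) _.
have h1 : C * (n %% k)%:R <= C * k%:R.
  by rewrite ler_wpM2l // ler_nat ltnW // ltn_pmod.
have h2 : (n %/ k)%:R * mean_phi k <= (rate + e / 2) * n%:R.
  apply: (@le_trans _ _ ((n %/ k)%:R * ((rate + e / 2) * k%:R))).
    by rewrite ler_wpM2l // ltW.
  rewrite mulrCA ler_wpM2l ?addr_ge0 ?rate_ge0 ?(ltW e2) //.
  by rewrite -natrM ler_nat leq_divM.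
have := lerD h2 h1; lra.
Unshelve. all: by end_near.
Qed.

Let u t n := Eop n o (fun l => expR (t * phi o (last o l))).

Let u_ge0 t n : 0 <= u t n.
Proof. by rewrite -(Eop_cst n o 0); apply: ler_Eop => l _ _; exact: expR_ge0. Qed.

Lemma exp_moment_mul t m n : 0 <= t -> u t (m + n) <= u t m * u t n.
Proof.
move=> t0; rewrite /u Eop_cat mulrC -EopZ.
apply: ler_Eop => l sl _.
rewrite -(Eop_last_iso n (last o l) (fun z => expR (t * z))) mulrC -EopZ.
apply: ler_Eop => l' _ _; rewrite last_cat -expRD -mulrDr ler_expR.
by rewrite ler_wpM2l.
Qed.

Lemma exp_moment_block t j k r : 0 <= t -> u t (j * k + r) <= u t k ^+ j * u t r.
Proof.
move=> t0; elim: j => [|j IH]; first by rewrite expr0 mul1r.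
rewrite mulSn -addnA exprS -mulrA; apply: le_trans (exp_moment_mul _ _ t0) _.
by rewrite ler_wpM2l.
Qed.

(** Chernoff bound on blocks of length [k], whose mean is already below [k * (rate + e)]; for small
    [t] the exponential moment of a block is below [exp (t k (a - eta))], and moments of successive
    blocks multiply. *)
Lemma phi_upper_tail e : 0 < e -> exists A th, [/\ 0 < A, 0 < th < 1 &
  forall n, Eop n o (fun l => ((rate + e) * n%:R <= phi o (last o l))%R%:R) <= A * th ^+ n].
Proof.
move=> e0; pose eta := e / 4; pose a := rate + e.
have eta0 : 0 < eta by rewrite divr_gt0.
have [k k0 ek] := rate_approx (mulr_gt0 (ltr0n R 2) eta0).
have k1 : 1 <= k%:R :> R by rewrite ler1n.
have ak : mean_phi k <= k%:R * (a - 2 * eta).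
  by apply: le_trans (ltW ek) _; rewrite mulrC ler_wpM2l // /a /eta; lra.
pose D := C * k%:R + 1.
have K0 : 0 <= C * k%:R by rewrite mulr_ge0.
have D1 : 1 <= D by rewrite /D; lra.
(* The bound by [1] keeps the exponents below [1/2] for the quadratic estimate; the bound by [eta]
   makes the quadratic error of a block at most [t k eta]. *)
pose t := Num.min 1 eta / (2 * D ^+ 2).
have D2 : 0 < 2 * D ^+ 2 by rewrite mulr_gt0 // exprn_gt0 //; lra.
have t0 : 0 < t by rewrite divr_gt0 // lt_min ltr01.
have tD : t * (2 * D ^+ 2) = Num.min 1 eta by rewrite /t mulfVK // gt_eqF.
have tD1 : t * (2 * D ^+ 2) <= 1 by rewrite tD ge_min lexx.
have tDe : t * (2 * D ^+ 2) <= eta by rewrite tD ge_min lexx orbT.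
have tC : t * (C * k%:R) <= 2^-1.
  have : t * D <= t * D ^+ 2 by rewrite ler_pM2l // expr2 ler_peMl //; lra.
  have : t * (C * k%:R) <= t * D by rewrite ler_pM2l // /D; lra.
  lra.
have uk : u t k <= expR (t * (k%:R * (a - eta))).
  apply: le_trans (expR_ge1Dx _).
  apply: (@le_trans _ _ (1 + t * mean_phi k + 2 * t ^+ 2 * (C * k%:R) ^+ 2)).
    rewrite /u /mean_phi -EopZ -[X in X + _ + _](Eop_cst k o 1) -EopD.
    rewrite -[X in _ + X](Eop_cst k o) -EopD; apply: ler_Eop => l sl pl.
    have := phi_path pl; rewrite sl => h.
    have h0 := phi0 (d o (last o l)).
    apply: le_trans (expR_le_quadratic _) _.
      by apply: le_trans tC; rewrite ler_pM2l.
    rewrite lerD2l exprMn mulrA ler_wpM2l //; first by rewrite mulr_ge0 // sqr_ge0.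
    by rewrite lerXn2r // nnegrE.
  have : 2 * t ^+ 2 * (C * k%:R) ^+ 2 <= t * (k%:R * eta).
    have hC : (C * k%:R) ^+ 2 <= D ^+ 2 by rewrite lerXn2r ?nnegrE /D //; lra.
    have : t * (2 * D ^+ 2) <= k%:R * eta.
      by apply: le_trans tDe _; rewrite ler_peMl // ltW.
    move=> h; have : t * (t * (2 * (C * k%:R) ^+ 2)) <= t * (k%:R * eta).
      rewrite ler_pM2l //; apply: le_trans h; rewrite ler_pM2l // ler_pM2l //.
    by rewrite expr2; lra.
  have : t * mean_phi k <= t * (k%:R * (a - 2 * eta)) by rewrite ler_pM2l.
  lra.
exists (expR (t * (C * k%:R) + t * (k%:R * eta))), (expR (- (t * eta))); split.
- exact: expR_gt0.
- rewrite expR_gt0 /= -expR0 ltr_expR oppr_lt0; exact: mulr_gt0.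
move=> n; apply: (@le_trans _ _ (expR (- (t * (a * n%:R))) * u t n)).
  rewrite /u -EopZ; apply: ler_Eop => l _ _; rewrite -expRD.
  rewrite -/a; have [h|h] := lerP (a * n%:R) (phi o (last o l)); last exact: expR_ge0.
  rewrite -[leLHS]expR0 ler_expR addrC -mulrBr mulr_ge0 ?(ltW t0) // subr_ge0.
  exact: h.
have ur : u t (n %% k) <= expR (t * (C * k%:R)).
  rewrite -[leRHS](Eop_cst (n %% k) o); apply: ler_Eop => l sl pl.
  rewrite ler_expR ler_pM2l //; apply: le_trans (phi_path pl) _.
  by rewrite sl ler_wpM2l // ler_nat ltnW // ltn_pmod.
have un : u t n <= expR (t * (k%:R * (a - eta))) ^+ (n %/ k) * expR (t * (C * k%:R)).
  rewrite [in leLHS](divn_eq n k); apply: le_trans (exp_moment_block _ _ _ (ltW t0)) _.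
  by apply: ler_pM; rewrite ?exprn_ge0 // lerXn2r ?nnegrE ?expR_ge0.
apply: (@le_trans _ _ (expR (- (t * (a * n%:R))) *
   (expR (t * (k%:R * (a - eta))) ^+ (n %/ k) * expR (t * (C * k%:R))))).
  by rewrite ler_wpM2l // expR_ge0.
rewrite -!expRM_natl -!expRD ler_expR.
have jn : (n %/ k)%:R * k%:R <= n%:R :> R by rewrite -natrM ler_nat leq_divM.
have jn' : n%:R <= (n %/ k)%:R * k%:R + k%:R :> R.
  by rewrite -natrM -natrD ler_nat [leqLHS](divn_eq n k) leq_add2l ltnW // ltn_pmod.
have a0 : 0 <= a by rewrite addr_ge0 ?rate_ge0 // ltW.
have h1 : a * ((n %/ k)%:R * k%:R) <= a * n%:R by rewrite ler_wpM2l.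
have h2 : eta * n%:R <= eta * ((n %/ k)%:R * k%:R + k%:R) by rewrite ler_pM2l.
have := lerD h1 h2; rewrite -(ler_pM2l t0); lra.
Qed.

(** Some time [j] with [a < j <= a + b] has [phi <= c j]: index [k] of [l] holds the position at
    time [k + 1]. *)
Definition hit c a b x l :=
  has (fun k => (k < size l)%N && (phi x (nth x l k) <= c * k.+1%:R)) (iota a b).

Lemma hit_iso c a b n x :
  Eop n x (fun l => (hit c a b x l)%:R) = Eop n o (fun l => (hit c a b o l)%:R).
Proof.
pose G vs : R := (has (fun k => (k < size vs)%N &&
  (phiv (nth (d o o) vs k) <= c * k.+1%:R)) (iota a b))%:R.
have E y : Eop n y (fun l => (hit c a b y l)%:R) = Eop n y (fun l => G (map (d y) l)).
  apply: eq_Eop => l _ _; rewrite /G /hit; congr (nat_of_bool _)%:R.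
  by apply: eq_has => k; rewrite size_map; case: ltnP => //= kl; rewrite (nth_map y).
by rewrite !E; exact: Eop_iso.
Qed.

Lemma hit_take c M x l : hit c 0 M x (take M l) = hit c 0 M x l.
Proof.
apply: eq_in_has => k; rewrite mem_iota add0n => /andP[_ kM].
by rewrite size_take_min leq_min kM nth_take.
Qed.

Definition hit_prob c M := Eop M o (fun l => (hit c 0 M o l)%:R).

Lemma hit_prob_le1 c M : hit_prob c M <= 1.
Proof.
rewrite -[leRHS](Eop_cst M o); apply: ler_Eop => l _ _.
by rewrite -[leRHS]/(true%:R) ler_nat leq_b1.
Qed.

(** Counts the times with more than [M] steps left from which there is no hit within [M] steps; the
    last [M] times are paid for separately in [phi_covering]. *)
Fixpoint misses c M x l : R :=
  if l is y :: l' then ((M <= size l')%N && ~~ hit c 0 M x l)%:R + misses c M y l'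
  else 0.

Lemma misses_ge0 c M x l : 0 <= misses c M x l.
Proof. by elim: l x => [|y l IH] x //=; rewrite addr_ge0. Qed.

Lemma misses_drop c M x l k : misses c M (last x (take k l)) (drop k l) <= misses c M x l.
Proof.
elim: k x l => [|k IH] x l; first by rewrite take0 drop0.
case: l => [|y l] //=; apply: le_trans (IH y l) _.
by rewrite lerDr.
Qed.

(* Katznelson-Weiss covering: jump along hits at cost [c] per step, pay [C] for
   each time without hit and for the last [M] times. *)
Lemma phi_covering c M x l : 0 <= c -> path nbr x l ->
  phi x (last x l) <= c * (size l)%:R + C * misses c M x l + C * M%:R.
Proof.
move=> c0; have [n] := ubnP (size l); elim: n x l => // n IH x l; rewrite ltnS => ln pl.
have [lM|Ml] := leqP (size l) M.
  apply: le_trans (phi_path pl) _; rewrite -[leLHS]add0r lerD //.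
    by rewrite addr_ge0 ?mulr_ge0 ?misses_ge0.
  by rewrite ler_wpM2l // ler_nat.
have [hitl|nhit] := boolP (hit c 0 M x l).
  have [k] := hasP hitl; rewrite mem_iota add0n /= => kM /andP[kl hk].
  have lastk : last x (take k.+1 l) = nth x l k.
    by rewrite (take_nth x kl) last_rcons.
  rewrite -{1}(cat_take_drop k.+1 l) last_cat.
  apply: le_trans (sub _ (last x (take k.+1 l)) _) _.
  move: pl; rewrite -{1}(cat_take_drop k.+1 l) cat_path => /andP[_ pl].
  have szlt : (size (drop k.+1 l) < n)%N by rewrite size_drop; lia.
  have := IH _ _ szlt pl; rewrite size_drop => h.
  have sz : c * (size l)%:R = c * k.+1%:R + c * (size l - k.+1)%:R.
    by rewrite -mulrDr -natrD subnKC.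
  have hm := ler_wpM2l C0 (misses_drop c M x l k.+1).
  rewrite lastk in h hm *; rewrite sz; lra.
case: l pl ln Ml nhit => // y l /andP[xy pl] ln Ml nhit.
apply: le_trans (sub x y _) _.
have := IH y l ln pl; have := phiC xy; rewrite /= (Ml : (M <= size l)%N) nhit /=.
rewrite -(natr1 (size l)) !mulrDr !mulr1; lra.
Qed.

(** By [hit_iso] every time with enough steps left is a miss with the same probability
    [1 - hit_prob c M], wherever the walk is. *)
Lemma mean_misses c M n : Eop n o (misses c M o) <= n%:R * (1 - hit_prob c M).
Proof.
suff H x : Eop n x (misses c M x) <= n%:R * (1 - hit_prob c M) by [].
elim: n x => [|n IH] x; first by rewrite /= mul0r.
have b1 := hit_prob_le1 c M.
rewrite -nat1r mulrDl mul1r.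
have -> : Eop n.+1 x (misses c M x) =
    Eop n.+1 x (fun l => ((M < size l)%N && ~~ hit c 0 M x l)%:R) +
    Eop n.+1 x (fun l => misses c M (head x l) (behead l)).
  rewrite -EopD; apply: eq_Eop => -[|y l] //= _ _.
apply: lerD.
  have [Mn|nM] := ltnP M n.+1; last first.
    rewrite (@eq_Eop _ _ _ (fun=> 0)) ?Eop_cst ?subr_ge0 // => l -> _.
    by rewrite ltnNge nM.
  rewrite /hit_prob -(hit_iso c 0 M M x) -(Eop_take M (n.+1 - M)) subnKC; last exact: ltnW.
  rewrite -[X in _ <= X - _](Eop_cst n.+1 x) -EopB; apply: ler_Eop => l -> _.
  by rewrite Mn hit_take /=; case: hit; rewrite ?subrr ?subr0.
rewrite /= -[leRHS]mul1r -[X in _ <= X * _](p1 x) mulr_suml; apply: ler_sum => y _.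
by apply: ler_wpM2l => //; exact: IH.
Qed.

Lemma mean_phi_covering c M n : 0 <= c ->
  mean_phi n <= c * n%:R + C * (n%:R * (1 - hit_prob c M)) + C * M%:R.
Proof.
move=> c0.
apply: (@le_trans _ _ (c * n%:R + C * Eop n o (misses c M o) + C * M%:R)); last first.
  by rewrite lerD2r lerD2l ler_wpM2l // mean_misses.
rewrite -EopZ -[X in _ <= X + _ + _](Eop_cst n o) -EopD -[X in _ <= _ + X](Eop_cst n o) -EopD.
by apply: ler_Eop => l <- pl; exact: phi_covering.
Qed.

(* The event [hit c n0 n1] for the walk restarted at time [M] is independent of
   the past, and forces a hit of slope [c'] for the whole walk. *)
Lemma hit_indep c c' M n0 n1 : 0 <= c -> C * M%:R <= (c' - c) * n0%:R -> c <= c' ->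
  (1 - hit_prob c' M) * Eop n1 o (fun l => (hit c n0 (n1 - n0) o l)%:R) <=
  hit_prob c' (M + n1) - hit_prob c' M.
Proof.
move=> c0 Mn0 cc'.
rewrite /hit_prob -{2}(Eop_take M n1) -EopB Eop_cat.
rewrite -[X in (X - _) * _](Eop_cst M o) -EopB mulrC -EopZ.
apply: ler_Eop => l sl pl.
rewrite -(hit_iso c n0 (n1 - n0) n1 (last o l)) mulrC -EopZ.
apply: ler_Eop => l' sl' pl'; rewrite take_size_cat //.
have [hM|nM] := boolP (hit c' 0 M o l).
  rewrite subrr mul0r subr_ge0 ler_nat lt0b.
  have [k] := hasP hM; rewrite mem_iota add0n /= => kM /andP[kl hk].
  apply/hasP; exists k; first by rewrite mem_iota; lia.
  by rewrite size_cat nth_cat kl hk andbT ltn_addr.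
rewrite subr0 mul1r subr0 ler_nat.
have [hE|//] := boolP (hit c n0 (n1 - n0) (last o l) l').
have [k] := hasP hE; rewrite mem_iota /= => /andP[n0k kn1] /andP[kl' hk]; rewrite lt0b.
apply/hasP; exists (M + k)%N; first by rewrite mem_iota; lia.
rewrite size_cat sl ltn_add2l kl' /= nth_cat sl ltnNge leq_addr /= addKn.
rewrite (set_nth_default (last o l)) //.
apply: le_trans (sub o (last o l) _) _.
have := phi_path pl; rewrite sl => h.
have hn : (c' - c) * n0%:R <= (c' - c) * k.+1%:R.
  by rewrite ler_wpM2l ?subr_ge0 // ler_nat; lia.
have hM : 0 <= c' * M%:R by rewrite mulr_ge0 // (le_trans c0).
rewrite -addnS natrD; lra.
Qed.

(** By contradiction. If late hits of slope [c] kept a probability above [al], each restart would by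
    [hit_indep] close a fixed proportion of the gap between [hit_prob c' M] and [1]. So misses would
    become rare, and [mean_phi_covering] would give a mean slope below [rate]. *)
Lemma phi_lower_tail c : 0 <= c -> c < rate -> forall al, 0 < al ->
  exists n0, forall n1, Eop n1 o (fun l => (hit c n0 (n1 - n0) o l)%:R) <= al.
Proof.
move=> c0 cr al al0; apply: contrapT => none.
have {}none n0 : exists n1, al < Eop n1 o (fun l => (hit c n0 (n1 - n0) o l)%:R).
  apply: contrapT => h; apply: none; exists n0 => n1; rewrite leNgt; apply/negP => h1.
  by apply: h; exists n1.
pose c' := (c + rate) / 2.
have cc' : c < c' by rewrite /c'; lra.
have c'r : c' < rate by rewrite /c'; lra.
have c'0 : 0 <= c' by rewrite /c'; lra.
have gain M : exists n1, al * (1 - hit_prob c' M) <= hit_prob c' (M + n1) - hit_prob c' M.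
  have [n0 Mn0] : exists n0 : nat, C * M%:R <= (c' - c) * n0%:R.
    exists (Num.bound (C * M%:R / (c' - c))).
    rewrite -ler_pdivrMl ?subr_gt0 // mulrC; apply: ltW; apply: archi_boundP.
    by rewrite divr_ge0 ?mulr_ge0 // subr_ge0 ltW.
  have [n1 h] := none n0; exists n1.
  apply: (le_trans _ (@hit_indep c c' M n0 n1 c0 Mn0 (ltW cc'))); rewrite mulrC.
  by rewrite ler_wpM2l ?subr_ge0 ?hit_prob_le1 // ltW.
pose S := [set hit_prob c' M | M in [set: nat]].
have supS : has_sup S.
  by split; [exists (hit_prob c' 0), 0%N|exists 1 => _ [M _ <-]; exact: hit_prob_le1].
(* A miss probability below [e] costs at most half of the margin [rate - c']; the other half absorbs
   [C * M] through the choice of [n]. *)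
pose e := (rate - c') / (2 * (C + 1)).
have C1 : 0 < C + 1 by have := C0; lra.
have e0 : 0 < e by rewrite divr_gt0 ?subr_gt0 // mulr_gt0.
(* Within [al * e] of the supremum the gain [al * (1 - hit_prob c' M)] has to be below [al * e]. *)
have [_ [M _ <-] hM] := sup_adherent (mulr_gt0 al0 e0) supS.
have small : 1 - hit_prob c' M < e.
  have [n1 h] := gain M; rewrite -(ltr_pM2l al0); apply: le_lt_trans h _.
  have : hit_prob c' (M + n1) <= sup S.
    by apply: ub_le_sup; [case: supS|exists (M + n1)%N].
  lra.
pose n := (Num.bound (C * M%:R / ((rate - c') / 2))).+1.
have hn : C * M%:R < (rate - c') / 2 * n%:R.
  rewrite -ltr_pdivrMl ?divr_gt0 ?subr_gt0 // mulrC.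
  apply: (@lt_trans _ _ (Num.bound (C * M%:R / ((rate - c') / 2)))%:R).
    by apply: archi_boundP; apply: divr_ge0; [rewrite mulr_ge0|lra].
  by rewrite ltr_nat.
have := mean_phi_covering M n c'0; have := rate_le (ltn0Sn _ : 0 < n)%N.
have n0 : 0 < n%:R :> R by rewrite ltr0n.
have : C * (n%:R * (1 - hit_prob c' M)) <= (rate - c') / 2 * n%:R.
  rewrite mulrCA mulrC ler_pM2r //.
  apply: (@le_trans _ _ (C * e)); first by rewrite ler_wpM2l // ltW.
  have -> : (rate - c') / 2 = (C + 1) * e by rewrite /e; field; rewrite gt_eqF.
  by rewrite ler_pM2r // lerDl.
lra.
Qed.

End Subadditive.
End PathExpectation.

(** * From path weights to the probability space *)

Section ChainLaw.
Variables (R : realType) (T : choiceType) (nb : T -> seq T) (p : T -> T -> R).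
Hypothesis p0 : forall x y, 0 <= p x y.
Hypothesis p1 : forall x, \sum_(y <- nb x) p x y = 1.
Hypothesis nb_uniq : forall x, uniq (nb x).
Variables (d : measure_display) (Omega : measurableType d) (P : probability Omega R).
Variables (o : T) (X : nat -> Omega -> T).
Hypothesis chain : markov_chain P p o X.

Local Notation Eop := (Eop nb p).

Let mX n (A : set T) : measurable (X n @^-1` A).
Proof. by case: chain. Qed.

Definition traj n (w : Omega) : seq T := mkseq (fun j => X j.+1 w) n.

Lemma trajS n w : traj n.+1 w = rcons (traj n w) (X n.+1 w).
Proof. by rewrite /traj mkseqS. Qed.

Lemma size_traj n w : size (traj n w) = n. Proof. by rewrite size_mkseq. Qed.

Lemma nth_traj n w k x : (k < n)%N -> nth x (traj n w) k = X k.+1 w.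
Proof. exact: nth_mkseq. Qed.

Fixpoint wt x (l : seq T) : R := if l is y :: l' then p x y * wt y l' else 1.

Lemma wt_rcons x l y : wt x (rcons l y) = wt x l * p (last x l) y.
Proof. by elim: l x => [|z l IH] x /=; [rewrite mulr1 mul1r|rewrite IH mulrA]. Qed.

Definition cyl l : set Omega := [set w | X 0 w = o /\ traj (size l) w = l].

Lemma cylE l : cyl l = [set w | forall j, (j <= size l)%N -> X j w = nth o (o :: l) j].
Proof.
apply/seteqP; split=> w /=.
  by move=> [X0 tl] [|j] jl //=; rewrite -tl nth_traj.
move=> h; split; first exact: (h 0%N).
apply: (@eq_from_nth _ o); first by rewrite size_traj.
by move=> j; rewrite size_traj => jl; rewrite nth_traj // (h j.+1).
Qed.

Lemma measurable_cyl l : measurable (cyl l).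
Proof.
rewrite cylE (_ : [set w | _] =
  \bigcap_(j in [set j | (j <= size l)%N]) (X j @^-1` [set nth o (o :: l) j])).
  by apply: bigcap_measurable; [exists 0%N|move=> j _; exact: mX].
by apply/seteqP; split.
Qed.

Lemma prob_cyl l : P (cyl l) = (wt o l)%:E.
Proof.
elim/last_ind: l => [|l y IH].
  have [_ PX0 _] := chain; rewrite -PX0; congr (P _).
  by apply/seteqP; split=> w //= [].
have [_ _ step] := chain; rewrite wt_rcons cylE size_rcons step EFinM -IH cylE.
congr (P _ * (p _ _)%:E)%E.
- apply/seteqP; split=> w /= h j jl; have := h j jl; rewrite -rcons_cons nth_rcons /=;
    by rewrite ltnS jl.
- by rewrite -rcons_cons nth_rcons /= ltnS leqnn -[size l]/((size (o :: l)).-1) nth_last.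
- by rewrite -rcons_cons nth_rcons /= ltnn eqxx.
Qed.

Fixpoint paths n x : seq (seq T) :=
  if n is n'.+1 then flatten [seq [seq y :: l | l <- paths n' y] | y <- nb x] else [:: [::]].

Lemma Eop_paths n x F : Eop n x F = \sum_(l <- paths n x) wt x l * F l.
Proof.
elim: n x F => [|n IH] x F /=; first by rewrite big_seq1 mul1r.
rewrite big_flatten big_map /=; apply: eq_bigr => y _.
rewrite big_map IH mulr_sumr; apply: eq_bigr => l _ /=.
by rewrite mulrA.
Qed.

Lemma paths_size n x l : l \in paths n x -> size l = n.
Proof.
elim: n x l => [|n IH] x l /=; first by rewrite inE => /eqP ->.
by move=> /flatten_mapP[y _ /mapP[l' /IH <- ->]].
Qed.

Lemma paths_uniq n x : uniq (paths n x).
Proof.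
elim: n x => [|n IH] x //=; elim: (nb x) (nb_uniq x) => [|y l IHl] //= /andP[yl /IHl ul].
rewrite cat_uniq ul andbT map_inj_uniq ?IH; last by move=> a b [].
apply/hasPn => _ /flatten_mapP[z zl /mapP[l1 _ ->]].
by apply/negP => /mapP[l2 _ [zy _]]; rewrite -zy zl in yl.
Qed.

Lemma prob_ge_cyl n (ls : seq (seq T)) (A : set Omega) : measurable A -> uniq ls ->
  (forall l, l \in ls -> size l = n) -> (forall l, l \in ls -> cyl l `<=` A) ->
  (\sum_(l <- ls) (wt o l)%:E <= P A)%E.
Proof.
elim: ls A => [|l ls IH] A mA uls sls lsA; first by rewrite big_nil.
move: uls => /= /andP[lls uls]; rewrite big_cons -prob_cyl.
have -> : P A = (P (cyl l) + P (A `\` cyl l))%E.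
  rewrite -{1}(setIidr (lsA l (mem_head _ _))) addeC.
  by rewrite -measureDI //; exact: measurable_cyl.
rewrite leeD2lE ?fin_num_measure //; last exact: measurable_cyl.
apply: IH => //.
- by apply: measurableD => //; exact: measurable_cyl.
- by move=> l' l'l; apply: sls; rewrite inE l'l orbT.
move=> l' l'ls w wl'; split; first by apply: (lsA l') => //; rewrite inE l'ls orbT.
move=> [_ tl]; case: wl' => [_ tl'].
rewrite (sls l (mem_head _ _)) in tl.
rewrite (sls l') ?inE ?l'ls ?orbT // in tl'.
by move: lls; rewrite -tl tl' l'ls.
Qed.

Lemma prob_path n (C : pred (seq T)) : measurable [set w | C (traj n w)] ->
  P [set w | C (traj n w)] = (Eop n o (fun l => (C l)%:R))%:E.
Proof.
move=> mC.
(* Disjoint cylinders give a lower bound; applied to the complement it becomes the upper bound,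
   since the path weights add up to [1]. *)
have ge (D : pred (seq T)) : measurable [set w | D (traj n w)] ->
    ((Eop n o (fun l => (D l)%:R))%:E <= P [set w | D (traj n w)])%E.
  move=> mD; rewrite Eop_paths -sumEFin.
  rewrite (_ : (\sum_(l <- paths n o) (wt o l * (D l)%:R)%:E)%E =
     (\sum_(l <- [seq l <- paths n o | D l]) (wt o l)%:E)%E); last first.
    rewrite big_filter [RHS]big_mkcond; apply: eq_bigr => l _.
    by case: (D l); rewrite ?mulr1 ?mulr0.
  apply: (@prob_ge_cyl n) => //; rewrite ?filter_uniq ?paths_uniq //.
    by move=> l; rewrite mem_filter => /andP[_ /paths_size].
  move=> l; rewrite mem_filter => /andP[Dl /paths_size sl] w [_]; rewrite sl /= => ->.
  exact: Dl.
apply/eqP; rewrite eq_le ge // andbT.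
have mN : measurable [set w | (predC C) (traj n w)].
  rewrite (_ : [set w | _] = ~` [set w | C (traj n w)]); first exact: measurableC.
  by apply/seteqP; split=> w /= /negP.
have := ge _ mN.
rewrite (_ : [set w | (predC C) (traj n w)] = ~` [set w | C (traj n w)]); last first.
  by apply/seteqP; split=> w /= /negP.
rewrite probability_setC // (_ : Eop n o _ = 1 - Eop n o (fun l => (C l)%:R)); last first.
  rewrite -[X in X - _](Eop_cst p1 n o) -EopB //.
  apply: eq_Eop => // l _ _ /=; by case: (C l); rewrite ?subrr ?subr0.
rewrite -(fineK (fin_num_measure P _ mC)) -EFinB !lee_fin.
by rewrite lerD2l lerN2.
Qed.

Lemma prob_at n (A : pred T) : P [set w | A (X n w)] = (Eop n o (fun l => (A (last o l))%:R))%:E.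
Proof.
(* [traj] starts at time [1], and [X 0 = o] holds only almost surely. *)
case: n => [|n].
  have [_ PX0 _] := chain; rewrite /=; have mA := mX 0%N A.
  have [Ao|nAo] := boolP (A o).
    apply/eqP; rewrite eq_le probability_le1 //= -PX0 le_measure ?inE //.
    by move=> w /= Xo; rewrite Xo.
  suff -> : P [set w | A (X 0%N w)] = 0%E by [].
  apply/eqP; rewrite eq_le measure_ge0 andbT.
  have -> : 0%E = P (~` (X 0%N @^-1` [set o])).
    by rewrite probability_setC ?PX0 ?subee //; exact: mX.
  rewrite le_measure ?inE //; last by move=> w /= Aw Xo; move: nAo; rewrite -Xo Aw.
  by apply: measurableC; exact: mX.
have E : [set w | A (last o (traj n.+1 w))] = X n.+1 @^-1` A.
  by apply/funext => w; rewrite /mkset /preimage /mkset trajS last_rcons.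
rewrite -(prob_path (C := fun l => A (last o l))); first by rewrite E.
by rewrite E; exact: mX.
Qed.

Lemma Eop_sum (I : Type) (r : seq I) n x (F : I -> seq T -> R) :
  \sum_(i <- r) Eop n x (F i) = Eop n x (fun l => \sum_(i <- r) F i l).
Proof.
under eq_bigr do rewrite Eop_paths.
rewrite exchange_big Eop_paths; apply: eq_bigr => l _ /=.
by rewrite mulr_sumr.
Qed.

(** Almost surely [X n] lies in the finite set [B] of endpoints of paths, so [psi (X n)] is almost
    surely a finite combination of indicators. *)
Lemma expectation_at n (psi : T -> R) :
  ('E_P[fun w => psi (X n w)])%E = (Eop n o (fun l => psi (last o l)))%:E.
Proof.
pose B := undup [seq last o l | l <- paths n o].
have lastB l : l \in paths n o -> last o l \in B.
  by move=> lp; rewrite mem_undup; apply/mapP; exists l.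
have PB : P [set w | X n w \in B] = 1%E.
  rewrite (prob_at n (mem B)) Eop_paths big_seq.
  rewrite (eq_bigr (fun l => wt o l * 1)) => [|l lp]; last by rewrite /= lastB.
  by rewrite -big_seq -(Eop_paths n o (fun=> 1)) Eop_cst.
have mf (h : T -> R) : measurable_fun [set: Omega] (fun w => h (X n w)).
  by move=> _ Y mY; rewrite setTI; exact: (mX n (h @^-1` Y)).
have mE (x : T) : measurable (X n @^-1` [set x]) by exact: mX.
rewrite unlock.
rewrite (@ae_eq_integral _ _ _ P [set: Omega]
  (fun w => \sum_(x <- B) (psi x)%:E * (\1_(X n @^-1` [set x]) w)%:E)%E) //.
- rewrite integral_sum //; last first.
    by move=> x; apply: integrableZl => //; exact: integrable_indic.
  rewrite (eq_bigr (fun x => (psi x * Eop n o (fun l => (last o l == x)%:R))%:E)); last first.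
    move=> x _; rewrite integralZl //; last exact: integrable_indic.
    rewrite integral_indic // setIT EFinM; congr (_ * _)%E.
    rewrite -(prob_at n (pred1 x)); congr (P _).
    by apply/seteqP; split=> w /= /eqP.
  rewrite sumEFin; congr EFin.
  under eq_bigr do rewrite -EopZ.
  rewrite Eop_sum !Eop_paths big_seq [RHS]big_seq; apply: eq_bigr => l lp.
  congr (_ * _); rewrite (perm_big _ (perm_to_rem (lastB l lp))) big_cons eqxx mulr1.
  rewrite big_seq big1 => [|x]; first exact: addr0.
  rewrite mem_rem_uniq ?undup_uniq // inE => /andP[xl _].
  by rewrite eq_sym (negbTE xl) mulr0.
- exact/measurable_EFinP/mf.
- rewrite (_ : (fun w => _) = fun w => (\sum_(x <- B) psi x * (X n w == x)%:R)%:E).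
    exact/measurable_EFinP/(mf (fun y => \sum_(x <- B) psi x * (y == x)%:R)).
  apply/funext => w; rewrite -sumEFin; apply: eq_bigr => x _.
  rewrite EFinM; congr (_ * (_)%:E)%E; rewrite indicE; congr (nat_of_bool _)%:R.
  by apply/idP/eqP; rewrite inE.
have mB : measurable [set w | X n w \in B] by exact: (mX n [set x | x \in B]).
have PB0 : P (~` [set w | X n w \in B]) = 0%E by rewrite probability_setC // PB subee.
have mBC : measurable (~` [set w | X n w \in B]) by exact: measurableC.
apply: (@negligibleS _ _ _ P (~` [set w | X n w \in B])); last exact/negligibleP.
move=> w /= h wB; apply: h => _.
rewrite (perm_big _ (perm_to_rem wB)) big_cons indicE mem_set //= mule1.
rewrite big_seq big1 => [|x]; first exact/esym/adde0.
rewrite mem_rem_uniq ?undup_uniq // inE => /andP[/eqP xl _].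
by rewrite indicE memNset ?mule0 // => /= e; apply: xl.
Qed.

Section Rate.
Variables (V : Type) (dl : T -> T -> V).
Hypothesis iso : forall (G : V -> R) x1 x1' x2 x2', dl x1' x1 = dl x2' x2 ->
  \sum_(y <- nb x1) p x1 y * G (dl x1' y) = \sum_(y <- nb x2) p x2 y * G (dl x2' y).
Hypothesis dsurj : forall x v, exists y, dl x y = v.
Hypothesis dxx : forall x y, dl x x = dl y y.
Variables (phiv : V -> R) (C : R).
Local Notation phi x y := (phiv (dl x y)).
Hypothesis phi0 : forall v, 0 <= phiv v.
Hypothesis phixx : forall x, phi x x = 0.
Hypothesis sub : forall x y z, phi x z <= phi x y + phi y z.
Hypothesis phiC : forall x y, y \in nb x -> phi x y <= C.

Local Notation rate := (rate nb p dl phiv o).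

(** Borel-Cantelli with the geometric tail of [phi_upper_tail]. *)
Lemma ae_upper e : 0 < e ->
  {ae P, forall w, \forall n \near \oo, phi o (X n w) < (rate + e) * n%:R}.
Proof.
move=> e0; pose F n : set Omega := [set w | (rate + e) * n%:R <= phi o (X n w)].
have mF n : measurable (F n) by exact: (mX n [set y | (rate + e) * n%:R <= phi o y]).
have [A [th [A0 /andP[th0 th1] tail]]] :=
  phi_upper_tail p0 p1 iso dsurj dxx phi0 phixx sub phiC o e0.
have PF n : (P (F n) <= (A * th ^+ n)%:E)%E.
  rewrite (prob_at n (fun y => (rate + e) * n%:R <= phi o y)) lee_fin.
  exact: tail.
have : P (lim_sup_set F) = 0%E.
  apply: lim_sup_set_cvg0 => //.
  apply: (@le_lt_trans _ _ (\sum_(n <oo) (A * th ^+ n)%:E)%E).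
    by apply: lee_nneseries => // n _; exact: PF.
  have h : series (geometric A th) @ \oo --> A * (1 - th)^-1.
    by apply: cvg_geometric_series; rewrite ger0_norm // ltW.
  suff -> : (\sum_(n <oo) (A * th ^+ n)%:E)%E = (A * (1 - th)^-1)%:E by rewrite ltry.
  apply/cvg_lim => //; rewrite (_ : (fun n => _) = EFin \o series (geometric A th)).
    by apply: cvg_EFin; [exact: nearW|].
  by apply/funext => n /=; rewrite sumEFin.
move=> PF0; have mL : measurable (lim_sup_set F).
  by apply: bigcap_measurable => // k _; exact: bigcup_measurable.
apply: (@negligibleS _ _ _ P (lim_sup_set F)); last exact/negligibleP.
move=> w /= nev k _; apply: contrapT => none; apply: nev.
exists k => // j /= kj; rewrite ltNge; apply/negP => h; apply: none.
by exists j.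
Qed.

(** [phi_lower_tail] has no rate to sum. It bounds instead the probability of any hit between [n0]
    and [n] uniformly in [n], and continuity from below along [G n] extends this to all later
    times. *)
Lemma ae_lower c : 0 <= c -> c < rate ->
  {ae P, forall w, \forall n \near \oo, c * n%:R <= phi o (X n w)}.
Proof.
move=> c0 cr; pose F n : set Omega := [set w | phi o (X n.+1 w) <= c * n.+1%:R].
have mF n : measurable (F n) by exact: (mX n.+1 [set y | phi o y <= c * n.+1%:R]).
have PF0 : P (lim_sup_set F) = 0%E.
  apply/eqP; rewrite eq_le measure_ge0 andbT; apply/lee_addgt0Pr => al al0.
  rewrite add0e.
  have [n0 tail] := phi_lower_tail p0 p1 iso dsurj dxx phi0 phixx sub phiC (o:=o) c0 cr al0.
  apply: le_trans (lim_sup_set_ub P n0 mF) _.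
  pose G n : set Omega := [set w | hit dl phiv c n0 (n - n0) o (traj n w)].
  have GE n : G n = \bigcup_(k in [set k | (n0 <= k < n)%N]) F k.
    apply/seteqP; split=> w /=.
      move=> /hasP[k]; rewrite mem_iota size_traj => h /andP[kn].
      by rewrite nth_traj // => hk; exists k => //=; lia.
    move=> [k /= /andP[n0k kn] hk]; apply/hasP; exists k; first by rewrite mem_iota; lia.
    by rewrite size_traj kn nth_traj.
  have mG n : measurable (G n).
    by rewrite GE; apply: bigcup_measurable => k _; exact: mF.
  have PG n : (P (G n) <= al%:E)%E.
    by rewrite (prob_path (mG n)) lee_fin; exact: tail.
  have UG : \bigcup_(k in [set k | (n0 <= k)%N]) F k = \bigcup_n G n.
    apply/seteqP; split=> w.
      by move=> [k /= n0k Fk]; exists k.+1 => //; rewrite GE; exists k => //=; rewrite n0k ltnSn.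
    by move=> [n _]; rewrite GE => -[k /= /andP[n0k _] Fk]; exists k.
  rewrite UG; have cv : P \o G @ \oo --> P (\bigcup_n G n).
    apply: nondecreasing_cvg_mu => //; first exact: bigcup_measurable.
    move=> m n mn; apply/subsetPset; rewrite !GE => w [k /= /andP[n0k kn] Fk].
    by exists k => //=; rewrite n0k (leq_trans kn).
  have E : lim (P \o G @ \oo) = P (\bigcup_n G n) by apply/cvg_lim.
  have h : (limn (P \o G) <= al%:E)%E.
    apply: lime_le; first by apply/cvg_ex; exists (P (\bigcup_n G n)).
    by apply: nearW => n; exact: PG.
  by rewrite E in h; exact: h.
have mL : measurable (lim_sup_set F).
  by apply: bigcap_measurable => // k _; exact: bigcup_measurable.
apply: (@negligibleS _ _ _ P (lim_sup_set F)); last exact/negligibleP.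
move=> w /= nev k _; apply: contrapT => none; apply: nev.
exists k.+1 => // -[//|j] /= kj; rewrite leNgt; apply/negP => h; apply: none.
by exists j => //; rewrite /F /= ltW.
Qed.

Lemma ae_rate : {ae P, forall w, (fun n => n%:R^-1 * phi o (X n w)) @ \oo --> rate}.
Proof.
pose e k : R := k.+1%:R^-1.
have e0 k : 0 < e k by rewrite invr_gt0.
have up : {ae P, forall w, forall k, \forall n \near \oo, phi o (X n w) < (rate + e k) * n%:R}.
  by apply: ae_foralln => k; exact: ae_upper.
have lo : {ae P, forall w, forall k, \forall n \near \oo,
    (rate - e k) * n%:R <= phi o (X n w)}.
  apply: ae_foralln => k; have [h|h] := leP 0 (rate - e k).
    by apply: ae_lower => //; rewrite ltrBlDr ltrDl.
  apply: aeW => w; apply: nearW => n; apply: le_trans (phi0 _).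
  by rewrite mulr_le0_ge0 // ltW.
apply: filterS2 up lo => w up lo.
apply/cvgrPdist_le => eps eps0.
have [k ek] : exists k, e k <= eps.
  exists (Num.bound eps^-1); rewrite /e -[leRHS]invrK lef_pV2 ?posrE ?invr_gt0 //.
  apply: ltW; apply: lt_trans (_ : (Num.bound eps^-1)%:R < _); last by rewrite ltr_nat.
  by apply: archi_boundP; rewrite invr_ge0 ltW.
near=> n.
have n0 : 0 < n%:R :> R by rewrite ltr0n; near: n; exists 1%N.
have h1 : phi o (X n w) < (rate + e k) * n%:R by near: n; exact: up.
have h2 : (rate - e k) * n%:R <= phi o (X n w) by near: n; exact: lo.
rewrite distrC ler_distl; apply/andP; split.
  rewrite mulrC ler_pdivlMr //; apply: le_trans h2.
  by rewrite ler_pM2r // lerD2l lerN2.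
rewrite mulrC ler_pdivrMr //; apply: le_trans (ltW h1) _.
by rewrite ler_pM2r // lerD2l.
Unshelve. all: by end_near.
Qed.

End Rate.
End ChainLaw.

(** * The Green function and the entropy *)

Section WalkOnBuilding.
Variables (R : realType) (N : nat) (W : groupType) (s : 'I_N -> W).
Hypothesis cox : fuchsian_coxeter_system s.
Variables (Delta : choiceType) (delta : Delta -> Delta -> W).
Hypothesis bld : building s delta.
Hypothesis reg : regular_building s delta.
Variables (o : Delta) (p : Delta -> Delta -> R) (L0 : nat).
Hypothesis kern : transition_kernel p.
Hypothesis iso : isotropic delta p.
Hypothesis range : forall x y, 0 < p x y -> (word_length s (delta x y) <= L0)%N.

Local Notation sph := (sph delta).
Local Notation cball := (cball s delta).
Local Notation ballW := (ballW s).
Local Notation pk := (pk s delta p L0).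
Local Notation Eop := (Eop (cball L0) p).

Let pk_ge0 := pk_ge0 s delta L0 kern.

Lemma Eop_pk n x (h : Delta -> R) :
  Eop n x (fun l => h (last x l)) = \sum_(y <- cball (n * L0) x) pk n x y * h y.
Proof.
elim: n x => [|n IH] x.
  rewrite /= (@big_supp _ _ _ [:: x]) ?(cball_uniq cox bld reg) //.
  - by rewrite big_seq1 eqxx mul1r.
  - by move=> y _; rewrite inE (eq_sym y); case: (x =P y) => //; rewrite mul0r eqxx.
  - by move=> y; rewrite inE => /eqP -> _;
    rewrite (mem_cball cox bld reg) (delta_refl bld) (ell1 cox).
rewrite /=; under [RHS]eq_bigr do rewrite mulr_suml.
rewrite exchange_big /= big_seq [RHS]big_seq; apply: eq_bigr => z zin.
rewrite IH mulr_sumr; under [RHS]eq_bigr do rewrite -mulrA.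
apply: big_supp; rewrite ?(cball_uniq cox bld reg) // => y.
  rewrite !(mem_cball cox bld reg) => h1 _.
  apply: leq_trans (ell_delta_triangle cox bld x z y) _.
  by rewrite mulSn leq_add // -(mem_cball cox bld reg).
rewrite !(mem_cball cox bld reg) => _ nz; apply: (pk_supp cox bld reg (p := p)).
by move: nz; apply: contra_neq => ->; rewrite mul0r mulr0.
Qed.

Definition green_max w : R := sup [set pk k o (chamber_at delta o w) | k in [set: nat]].

Lemma pk_chamber k x y : pk k x y = pk k o (chamber_at delta o (delta x y)).
Proof. by apply: (pk_iso cox bld reg o kern iso range); rewrite (delta_chamber_at cox bld). Qed.

Lemma green_max_has_sup w : has_sup [set pk k o (chamber_at delta o w) | k in [set: nat]].
Proof.
split; first by exists (pk 0 o (chamber_at delta o w)), 0%N.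
by exists 1 => _ [k _ <-]; apply: (pk_le1 cox bld reg kern range).
Qed.

Lemma le_green_max k x y : pk k x y <= green_max (delta x y).
Proof.
rewrite pk_chamber; apply: ub_le_sup; first by case: (green_max_has_sup (delta x y)).
by exists k.
Qed.

Lemma green_max_le1 w : green_max w <= 1.
Proof.
apply: ge_sup; first by case: (green_max_has_sup w).
by move=> _ [k _ <-]; apply: (pk_le1 cox bld reg kern range).
Qed.

Hypothesis irr : irreducible_kernel p.

Lemma green_max_gt0 w : 0 < green_max w.
Proof.
have [k] := irr o (chamber_at delta o w).
rewrite (kstep_pk cox bld reg kern range) lte_fin => /lt_le_trans; apply.
by have := le_green_max k o (chamber_at delta o w); rewrite (delta_chamber_at cox bld).
Qed.

Lemma green_max_mul x y z :
  green_max (delta x y) * green_max (delta y z) <= green_max (delta x z).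
Proof.
have supmul (w : W) b c : 0 < b ->
    (forall k, pk k o (chamber_at delta o w) * b <= c) -> green_max w * b <= c.
  move=> b0 le; rewrite -ler_pdivlMr //.
  apply: ge_sup; first by case: (green_max_has_sup w).
  by move=> _ [k _ <-]; rewrite ler_pdivlMr.
apply: (supmul); first exact: green_max_gt0.
move=> j; rewrite -pk_chamber.
have [->|nz] := eqVneq (pk j x y) 0; first by rewrite mul0r ltW // green_max_gt0.
have pj : 0 < pk j x y by rewrite lt_def nz pk_ge0.
rewrite mulrC; apply: supmul => // k; rewrite -pk_chamber mulrC.
apply: le_trans (pk_mul cox bld reg L0 kern j k x y z) _.
exact: le_green_max.
Qed.

Definition log_green w : R := - ln (green_max w).
Definition log_q w : R := ln (size (sph o w))%:R.

Lemma log_green_ge0 w : 0 <= log_green w.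
Proof. by rewrite oppr_ge0 ln_le0 // green_max_le1. Qed.

Lemma log_green_refl x : log_green (delta x x) = 0.
Proof.
rewrite /log_green (_ : green_max _ = 1) ?ln1 ?oppr0 //; apply/eqP.
rewrite eq_le green_max_le1; have := le_green_max 0 x x.
by rewrite /= eqxx.
Qed.

Lemma log_green_triangle x y z :
  log_green (delta x z) <= log_green (delta x y) + log_green (delta y z).
Proof.
rewrite /log_green -opprD lerN2 -lnM ?posrE ?green_max_gt0 //.
by rewrite ler_ln ?posrE ?mulr_gt0 ?green_max_gt0 // green_max_mul.
Qed.

Let q1 x w : 1 <= (size (sph x w))%:R :> R.
Proof. by rewrite ler1n (size_sph_gt0 cox bld reg). Qed.

Lemma log_q_ge0 w : 0 <= log_q w.
Proof. by rewrite ln_ge0. Qed.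

Lemma log_q_refl x : log_q (delta x x) = 0.
Proof. by rewrite /log_q (delta_refl bld) (sph_1 cox bld reg) ln1. Qed.

Lemma log_q_triangle x y z : log_q (delta x z) <= log_q (delta x y) + log_q (delta y z).
Proof.
have q0 a b : 0 < (size (sph a b))%:R :> R by exact: lt_le_trans (q1 a b).
rewrite /log_q -lnM ?posrE // ler_ln ?posrE ?mulr_gt0 // -natrM ler_nat.
exact: (size_sph_triangle cox bld reg R).
Qed.

Definition max_step (f : W -> R) := \sum_(w <- ballW L0) f w.

Lemma le_max_step f x y : (forall w, 0 <= f w) -> y \in cball L0 x ->
  f (delta x y) <= max_step f.
Proof.
move=> f0; rewrite (mem_cball cox bld reg) -(mem_ballW cox) => win.
rewrite /max_step (perm_big _ (perm_to_rem win)) big_cons lerDl.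
by apply: sumr_ge0 => w _; exact: f0.
Qed.

Lemma log_green_supp n x y : pk n x y != 0 ->
  log_green (delta x y) <= max_step log_green * n%:R.
Proof.
elim: n x => [|n IH] x /=.
  by case: (x =P y) => [->|]; rewrite ?eqxx // log_green_refl mulr0.
move=> nz; have [z /andP[zin h]] : exists z, (z \in cball L0 x) && (pk n z y != 0).
  apply: contrapT => none; move: nz; rewrite big_seq big1 ?eqxx // => z zin.
  by apply/eqP; rewrite mulf_eq0; apply/orP; right; apply/negPn/negP => h;
    apply: none; exists z; rewrite zin.
apply: le_trans (log_green_triangle x z y) _.
rewrite -natr1 mulrDr mulr1 addrC lerD // ?IH //.
exact: le_max_step log_green_ge0 zin.
Qed.

Hypothesis thick : thick_building s delta.

Lemma pk_exp_decay : exists B b : R, [/\ 0 < B, 0 < b &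
  forall k x y, pk k x y <= B * expR (- (b * k%:R))].
Proof.
have [eta [m [/andP[e0 e1] m0 dec]]] :=
  pk_decay cox bld reg thick o kern iso range irr.
pose a := - ln eta.
have a0 : 0 < a by rewrite oppr_gt0 ln_lt0 // e0.
have mR : 0 < m%:R :> R by rewrite ltr0n.
(* The square in [pk_decay] halves the exponent, and [exp (a / 2)] makes up for the rounding in
   [k %/ m]. *)
exists (expR (a / 2)), (a / (2 * m%:R)); split; first exact: expR_gt0.
  by rewrite divr_gt0 // mulr_gt0.
move=> k x y; rewrite -expRD.
rewrite -ler_sqr ?nnegrE ?pk_ge0 ?expR_ge0 //; apply: le_trans (dec k x y) _.
have -> : eta = expR (- a) by rewrite /a opprK lnK.
rewrite -!expRM_natl ler_expR.
have kd : k%:R <= (k %/ m)%:R * m%:R + m%:R :> R.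
  by rewrite -natrM -natrD ler_nat {1}(divn_eq k m) leq_add2l ltnW // ltn_pmod.
have -> : 2 * (a / 2 - a / (2 * m%:R) * k%:R) = a / m%:R * (m%:R - k%:R).
  by field; rewrite gt_eqF.
rewrite mulrN -mulNr -subr_ge0.
have -> : a / m%:R * (m%:R - k%:R) - - (k %/ m)%:R * a =
    a / m%:R * ((k %/ m)%:R * m%:R + m%:R - k%:R) by field; rewrite gt_eqF.
by rewrite mulr_ge0 ?subr_ge0 // ltW // divr_gt0.
Qed.

(* Beyond a time [K (n + 1)] the transition probabilities are smaller than
   [green_max] at every point that can be reached in [n] steps. *)
Lemma green_comparison : exists (K : nat) (c : R), [/\ (0 < K)%N, 0 <= c &
  forall n x y, log_green (delta x y) <= max_step log_green * n%:R ->
    green_max (delta x y) <= \sum_(k < K * n.+1) pk k x y /\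
    forall M, \sum_(k < M) pk k x y <= ((K * n.+1)%:R + c) * green_max (delta x y)].
Proof.
have [B [b [B0 b0 dec]]] := pk_exp_decay.
set C := max_step log_green.
have C0 : 0 <= C by apply: sumr_ge0 => w _; exact: log_green_ge0.
(* With this [K] the decay bound at time [K (n + 1)] is below [exp (- C n)], which is at most
   [green_max] at the points considered. *)
have [K [K0 bK]] : exists K, (0 < K)%N /\ C + `|ln B| < b * K%:R.
  exists (Num.bound ((C + `|ln B|) / b)).+1; split=> //.
  rewrite mulrC -ltr_pdivrMr //.
  apply: lt_trans (archi_boundP _) _; last by rewrite ltr_nat.
  by rewrite divr_ge0 ?addr_ge0 // ltW.
pose tau := expR (- b).
have tau0 : 0 < tau by exact: expR_gt0.
have tau1 : tau < 1 by rewrite /tau -expR0 ltr_expR oppr_lt0.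
exists K, (1 - tau)^-1; split=> //; first by rewrite invr_ge0 subr_ge0 ltW.
move=> n x y Dn; set T := (K * n.+1)%N; set M0 := green_max (delta x y).
have M00 : 0 < M0 by exact: green_max_gt0.
have DM : expR (- (C * n%:R)) <= M0.
  by rewrite -[leRHS]lnK ?posrE // ler_expR lerNl.
have BT : B * expR (- (b * T%:R)) < M0.
  apply: lt_le_trans DM; rewrite -{1}(lnK (B0 : B \is Num.pos)) -expRD ltr_expR.
  rewrite /T natrM mulrA.
  have h1 : ln B <= `|ln B| by exact: ler_norm.
  have nn : 1 <= n.+1%:R :> R by rewrite ler1n.
  have h2 : (C + `|ln B|) * n.+1%:R < b * K%:R * n.+1%:R by rewrite ltr_pM2r // ltr0n.
  have h3 : `|ln B| <= `|ln B| * n.+1%:R by rewrite ler_peMr.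
  have h4 : C * n%:R <= C * n.+1%:R by rewrite ler_wpM2l // ler_nat.
  rewrite mulrDl in h2; lra.
split.
  (* Otherwise some [pk k x y] would exceed both the sum and the decay bound at time [T]: the first
     is impossible for [k < T], the second for [k >= T]. *)
  rewrite leNgt; apply/negP => lt.
  have : Num.max (\sum_(k < T) pk k x y) (B * expR (- (b * T%:R))) < M0.
    by rewrite gt_max lt BT.
  rewrite -subr_gt0 => e0.
  have [_ [k _ <-]] := sup_adherent e0 (green_max_has_sup (delta x y)).
  rewrite -pk_chamber -/(green_max _) -/M0 subKr gt_max => /andP[k1 k2].
  have [kT|Tk] := ltnP k T.
    move: k1; rewrite (bigD1 (Ordinal kT)) //= ltNge => /negP; apply.
    by rewrite lerDl; apply: sumr_ge0.
  move: k2; rewrite ltNge => /negP; apply; apply: le_trans (dec k x y) _.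
  by rewrite ler_pM2l // ler_expR lerN2 ler_pM2l // ler_nat.
move=> M.
apply: (@le_trans _ _ (\sum_(k < T + M) pk k x y)).
  rewrite [leRHS](_ : _ = \sum_(k < M + T) pk k x y); last by rewrite addnC.
  by rewrite big_split_ord /= lerDl; apply: sumr_ge0.
rewrite big_split_ord [leRHS]mulrDl; apply: lerD => /=.
  rewrite mulr_natl -[T in leRHS]card_ord -sumr_const.
  by apply: ler_sum => k _; exact: le_green_max.
(* Beyond [T] the terms are at most [green_max] times a geometric series of ratio [tau], whose sum
   is the constant [c] of the statement. *)
apply: (@le_trans _ _ (\sum_(k < M) B * expR (- (b * T%:R)) * tau ^+ k)).
  apply: ler_sum => k _; apply: le_trans (dec _ x y) _.
  rewrite -mulrA ler_pM2l // /tau -expRM_natl -expRD ler_expR natrD.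
  by rewrite le_eqVlt; apply/orP; left; apply/eqP; ring.
rewrite -mulr_sumr mulrC; apply: ler_pM; rewrite ?(ltW BT) //.
- by apply: sumr_ge0 => k _; rewrite exprn_ge0 // ltW.
- by rewrite mulr_ge0 ?expR_ge0 // ltW.
have nt : `|tau| < 1 by rewrite ger0_norm // ltW.
have := geometric_le_lim M ler01 tau0 nt; rewrite !mul1r /series /= big_mkord.
by apply: le_trans; apply: ler_sum => k _; rewrite mul1r.
Qed.

End WalkOnBuilding.

Lemma cvg_ln_affine (R : realType) (K : nat) (c : R) : (0 < K)%N -> 0 <= c ->
  (fun n => n%:R^-1 * ln ((K * n.+1)%:R + c)) @ \oo --> (0 : R).
Proof.
move=> K0 c0; apply/cvgrPdist_le => eps eps0.
pose D : R := K%:R + c.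
have D1 : 1 <= D.
  have : 1 <= K%:R :> R by rewrite ler1n.
  by rewrite /D; lra.
pose e := eps / 2 / D.
have e0 : 0 < e by rewrite !divr_gt0 //; lra.
near=> n.
have n0 : 0 < n%:R :> R by rewrite ltr0n; near: n; exists 1%N.
have big : (eps / 2 + `|ln e|) <= eps / 2 * n%:R.
  rewrite -ler_pdivrMl ?divr_gt0 //; near: n; exact: nbhs_infty_ger.
set y := (K * n.+1)%:R + c.
have y1 : 1 <= y.
  have : 1 <= (K * n.+1)%:R :> R by rewrite ler1n muln_gt0 K0.
  rewrite /y; lra.
have yD : y <= D * n.+1%:R.
  by rewrite /y /D natrM mulrDl lerD2l ler_peMr // ler1n.
have y0 : 0 < y by lra.
rewrite sub0r normrN ger0_norm; last by rewrite mulr_ge0 ?invr_ge0 ?ln_ge0 // ltW.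
rewrite mulrC ler_pdivrMr //.
have := ln_sublinear (mulr_gt0 e0 y0); rewrite lnM ?posrE // => h.
have h1 : e * y <= eps / 2 * n.+1%:R.
  have -> : eps / 2 * n.+1%:R = e * (D * n.+1%:R).
    by rewrite /e; field; lra.
  by rewrite ler_pM2l.
have h2 : - ln e <= `|ln e| by rewrite -normrN ler_norm.
move: h1; rewrite -(natr1 n); lra.
Unshelve. all: by end_near.
Qed.

(** * Entropy and Green speed of the walk and of its retraction *)

Section Entropy.
Variables (R : realType) (N : nat) (W : groupType) (s : 'I_N -> W).
Hypothesis cox : fuchsian_coxeter_system s.
Variables (Delta : choiceType) (delta : Delta -> Delta -> W).
Hypothesis bld : building s delta.
Hypothesis reg : regular_building s delta.
Hypothesis thick : thick_building s delta.
Variables (o : Delta) (p : Delta -> Delta -> R) (L0 : nat).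
Hypothesis kern : transition_kernel p.
Hypothesis irr : irreducible_kernel p.
Hypothesis iso : isotropic delta p.
Hypothesis range : forall x y, 0 < p x y -> (word_length s (delta x y) <= L0)%N.
Variables (d : measure_display) (Omega : measurableType d) (P : probability Omega R).
Variable X : nat -> Omega -> Delta.
Hypothesis chain : markov_chain P p o X.

Local Notation sph := (sph delta).
Local Notation cball := (cball s delta).
Local Notation pk := (pk s delta p L0).
Local Notation green_max := (green_max s delta o p L0).
Local Notation lgreen := (log_green s delta o p L0).
Local Notation lq := (log_q R delta o).
Local Notation rate f := (rate (cball L0) p delta f o).
Local Notation mean f := (mean_phi (cball L0) p delta f o).

Let pk_ge0 := pk_ge0 s delta L0 kern.
Let p0 := p_ge0 kern.
Let p1 := p_row cox bld reg kern range.
Let nbu := cball_uniq cox bld reg L0.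
Let isoE := sum_isotropic cox bld reg o L0 iso.
Let dsurj := sphere_nonempty cox bld.

Let dxx x y : delta x x = delta y y.
Proof. by rewrite !(delta_refl bld). Qed.

Let lg_ge0 := log_green_ge0 cox bld reg o kern range.
Let lg_refl := log_green_refl cox bld reg o kern iso range.
Let lg_tri := log_green_triangle cox bld reg o kern iso range irr.
Let lq_ge0 := log_q_ge0 R cox bld reg o.
Let lq_refl := log_q_refl R cox bld reg o.
Let lq_tri := log_q_triangle R cox bld reg o.
Let lgC x y : y \in cball L0 x -> lgreen (delta x y) <= max_step s L0 lgreen.
Proof. exact: (le_max_step cox bld reg lg_ge0). Qed.

Let lqC x y : y \in cball L0 x -> lq (delta x y) <= max_step s L0 lq.
Proof. exact: (le_max_step cox bld reg lq_ge0). Qed.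

Lemma ae_log_green :
  {ae P, forall w, (fun n => n%:R^-1 * lgreen (delta o (X n w))) @ \oo --> rate lgreen}.
Proof. exact: (ae_rate p0 p1 nbu chain isoE dsurj dxx lg_ge0 lg_refl lg_tri lgC). Qed.

Lemma ae_log_q :
  {ae P, forall w, (fun n => n%:R^-1 * lq (delta o (X n w))) @ \oo --> rate lq}.
Proof. exact: (ae_rate p0 p1 nbu chain isoE dsurj dxx lq_ge0 lq_refl lq_tri lqC). Qed.

Lemma mean_log_green : (fun n => n%:R^-1 * mean lgreen n) @ \oo --> rate lgreen.
Proof. exact: (mean_phi_cvg p0 p1 isoE dsurj dxx lg_ge0 lg_refl lg_tri lgC). Qed.

Lemma mean_log_q : (fun n => n%:R^-1 * mean lq n) @ \oo --> rate lq.
Proof. exact: (mean_phi_cvg p0 p1 isoE dsurj dxx lq_ge0 lq_refl lq_tri lqC). Qed.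

Lemma prob_sum n (A : pred Delta) : P [set w | A (X n w)] =
  (\sum_(y <- cball (n * L0) o) pk n o y * (A y)%:R)%:E.
Proof.
rewrite (prob_at p0 p1 nbu chain n A).
by rewrite (Eop_pk cox bld reg p L0 n o (fun y => (A y)%:R)).
Qed.

Lemma mass_X n x : mass P (X n) x = pk n o x.
Proof.
rewrite /mass (_ : _ @^-1` _ = [set w | pred1 x (X n w)]); last first.
  by apply/seteqP; split=> w /= /eqP.
rewrite prob_sum /=; have [xin|xout] := boolP (x \in cball (n * L0) o).
  rewrite (perm_big _ (perm_to_rem xin)) big_cons eqxx mulr1 big_seq big1 => [|y].
    exact: addr0.
  rewrite mem_rem_uniq ?(cball_uniq cox bld reg) // inE => /andP[/negbTE -> _].
  by rewrite mulr0.
rewrite big_seq big1 => [|y yin]; last first.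
  by case: (y =P x) yin xout => [-> ->|_ _ _] //; rewrite mulr0.
apply/esym/eqP/negPn/negP => /(pk_supp cox bld reg).
by rewrite -(mem_cball cox bld reg); apply/negP.
Qed.

Lemma mass_Xbar n x : mass P (fun w => delta o (X n w)) (delta o x) =
  (size (sph o (delta o x)))%:R * pk n o x.
Proof.
rewrite /mass (_ : _ @^-1` _ = [set w | delta o (X n w) == delta o x]); last first.
  by apply/seteqP; split=> w /= /eqP.
rewrite (prob_sum n (fun y => delta o y == delta o x)) /=.
rewrite (eq_bigr (fun y => pk n o x * (delta o y == delta o x)%:R)) => [|y _]; last first.
  case: eqP => [e|_]; last by rewrite !mulr0.
  by rewrite (pk_iso cox bld reg o kern iso range n e).
rewrite -mulr_sumr mulrC.
have [->|nz] := eqVneq (pk n o x) 0; first by rewrite !mulr0.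
congr (_ * _).
rewrite (@big_supp _ _ _ (sph o (delta o x))) ?(cball_uniq cox bld reg) ?sph_uniq //.
- rewrite big_seq (eq_bigr (fun=> 1)) => [|z]; last by rewrite (mem_sph cox bld reg) => ->.
  by rewrite -big_seq big_const_seq count_predT iter_addr_0.
- move=> y _; rewrite (mem_sph cox bld reg); case: (delta o y == delta o x) => //.
  by rewrite eqxx.
- move=> y; rewrite (mem_sph cox bld reg) (mem_cball cox bld reg) => /eqP -> _.
  exact: (pk_supp cox bld reg nz).
Qed.

Definition entropy n : R := \sum_(y <- cball (n * L0) o) pk n o y * - ln (pk n o y).

Lemma mean_entropy_X n : mean_entropy P X n = (n%:R^-1 * entropy n)%:E.
Proof.
rewrite /mean_entropy (expectation_at p0 p1 nbu chain n (fun y => ln (mass P (X n) y))).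
rewrite (Eop_pk cox bld reg p L0 n o (fun y => ln (mass P (X n) y))) -EFinM; congr EFin.
rewrite mulNr -mulrN -sumrN; congr (_ * _); apply: eq_bigr => y _.
by rewrite mass_X mulrN.
Qed.

Lemma mean_entropy_Xbar n : mean_entropy P (fun n w => delta o (X n w)) n =
  (n%:R^-1 * entropy n - n%:R^-1 * mean lq n)%:E.
Proof.
rewrite /mean_entropy (expectation_at p0 p1 nbu chain n
  (fun y => ln (mass P (fun w => delta o (X n w)) (delta o y)))).
rewrite (Eop_pk cox bld reg p L0 n o
  (fun y => ln (mass P (fun w => delta o (X n w)) (delta o y)))) -EFinM; congr EFin.
rewrite /mean_phi (Eop_pk cox bld reg p L0 n o (fun y => lq (delta o y))).
rewrite mulNr -mulrN -mulrBr -sumrN -sumrB; congr (_ * _); apply: eq_bigr => y _.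
rewrite mass_Xbar; have [->|nz] := eqVneq (pk n o y) 0; first by rewrite !mul0r oppr0 addr0.
have pos : 0 < pk n o y by rewrite lt_def nz pk_ge0.
rewrite lnM ?posrE // ?ltr0n ?(size_sph_gt0 cox bld reg) // /log_q.
ring.
Qed.

Lemma entropy_ge n : mean lgreen n <= entropy n.
Proof.
rewrite /mean_phi (Eop_pk cox bld reg p L0 n o (fun y => lgreen (delta o y))).
apply: ler_sum => y _; have [->|nz] := eqVneq (pk n o y) 0; first by rewrite !mul0r.
have pos : 0 < pk n o y by rewrite lt_def nz pk_ge0.
rewrite ler_pM2l // lerN2 ler_ln ?posrE // ?(green_max_gt0 cox bld reg o kern iso range irr) //.
exact: (le_green_max cox bld reg o kern iso range).
Qed.

(* Gibbs' inequality with respect to the average of the first [T] distributions. *)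
Lemma entropy_le K c : (0 < K)%N -> (forall n x y,
    lgreen (delta x y) <= max_step s L0 lgreen * n%:R ->
    green_max (delta x y) <= \sum_(k < K * n.+1) pk k x y /\
    forall M, \sum_(k < M) pk k x y <= ((K * n.+1)%:R + c) * green_max (delta x y)) ->
  forall n, entropy n <= mean lgreen n + ln (K * n.+1)%:R.
Proof.
move=> K0 cmp n; set T := (K * n.+1)%N.
have T0 : 0 < T%:R :> R by rewrite ltr0n muln_gt0 K0.
rewrite /mean_phi (Eop_pk cox bld reg p L0 n o (fun y => lgreen (delta o y))).
have one : \sum_(y <- cball (n * L0) o) pk n o y = 1.
  exact: (pk_row cox bld reg kern range).
rewrite -[X in _ + X]mul1r -[X in _ + X * _]one mulr_suml -big_split /=.
rewrite -subr_ge0 -sumrB.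
pose g y := \sum_(k < T) pk k o y.
apply: (@le_trans _ _ (\sum_(y <- cball (n * L0) o) (pk n o y - g y / T%:R))).
  rewrite sumrB one -mulr_suml subr_ge0 ler_pdivrMr // mul1r exchange_big /=.
  rewrite -[leRHS]mulr1 -[T in leRHS]card_ord mulr_natl -sumr_const; apply: ler_sum => k _.
  rewrite -(pk_row cox bld reg kern range o (leqnn (k * L0))).
  apply: le_sum_supp; rewrite ?(cball_uniq cox bld reg) // => y _.
  by move=> /(pk_supp cox bld reg); rewrite (mem_cball cox bld reg).
apply: ler_sum => y _; have g0 : 0 <= g y by apply: sumr_ge0.
have [->|nz] := eqVneq (pk n o y) 0.
  by rewrite !mul0r addr0 subr0 sub0r oppr_le0 divr_ge0 // ltW.
have pos : 0 < pk n o y by rewrite lt_def nz pk_ge0.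
have [Mg _] := cmp n o y (log_green_supp cox bld reg o kern iso range irr nz).
have M0 : 0 < green_max (delta o y) by exact: green_max_gt0 irr _.
have gpos : 0 < g y by exact: lt_le_trans M0 Mg.
have lnMg : ln (green_max (delta o y)) <= ln (g y) by rewrite ler_ln ?posrE.
have z0 : 0 < g y / (T%:R * pk n o y) by rewrite divr_gt0 // mulr_gt0.
have : ln (1 + (g y / (T%:R * pk n o y) - 1)) <= g y / (T%:R * pk n o y) - 1.
  by apply: le_ln1Dx; rewrite ltrBrDr addNr.
rewrite addrCA subrr addr0 ln_div ?posrE ?mulr_gt0 // lnM ?posrE // => h.
have := ler_wpM2l (ltW pos) h.
have -> : pk n o y * (g y / (T%:R * pk n o y) - 1) = g y / T%:R - pk n o y.
  by field; rewrite !gt_eqF.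
have := ler_wpM2l (ltW pos) lnMg; rewrite /log_green; lra.
Qed.

Lemma entropy_cvg : (fun n => n%:R^-1 * entropy n) @ \oo --> rate lgreen.
Proof.
have [K [c [K0 c0 cmp]]] := green_comparison cox bld reg o kern iso range irr thick.
apply: (squeeze_cvgr (f := fun n => n%:R^-1 * mean lgreen n)
  (h := fun n => n%:R^-1 * mean lgreen n + n%:R^-1 * ln ((K * n.+1)%:R + 0))).
- apply: nearW => n; rewrite -mulrDr !ler_wpM2l ?invr_ge0 ?entropy_ge //=.
  by rewrite addr0; exact: entropy_le cmp n.
- exact: mean_log_green.
rewrite -[X in _ --> X]addr0; apply: cvgD; first exact: mean_log_green.
exact: cvg_ln_affine.
Qed.

Let K x y := (p x y)%:E.

Lemma kstep_ge0 k x y : (0 <= kstep K k x y)%E.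
Proof. by rewrite (kstep_pk cox bld reg kern range) lee_fin. Qed.

Lemma green_bounds m c x : 0 <= c ->
  green_max (delta o x) <= \sum_(k < m) pk k o x ->
  (forall M, \sum_(k < M) pk k o x <= (m%:R + c) * green_max (delta o x)) ->
  exists g : R, [/\ green K o x = g%:E, green_max (delta o x) <= g &
    g <= (m%:R + c) * green_max (delta o x)].
Proof.
move=> c0 lo up.
have partial M : (\sum_(0 <= k < M) kstep K k o x)%E = (\sum_(k < M) pk k o x)%:E.
  rewrite big_mkord -sumEFin; apply: eq_bigr => k _.
  exact: (kstep_pk cox bld reg kern range).
have le1 : (green K o x <= ((m%:R + c) * green_max (delta o x))%:E)%E.
  apply: lime_le; first by apply: is_cvg_nneseries => *; exact: kstep_ge0.
  by apply: nearW => M; rewrite partial lee_fin.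
have ge1 : ((green_max (delta o x))%:E <= green K o x)%E.
  apply: (@le_trans _ _ (\sum_(0 <= k < m) kstep K k o x)%E).
    by rewrite partial lee_fin.
  by apply: nneseries_lim_ge => *; exact: kstep_ge0.
have fg : green K o x \is a fin_num.
  rewrite fin_numE; apply/andP; split; apply/eqP => e.
    by rewrite e in ge1.
  by rewrite e in le1.
exists (fine (green K o x)); rewrite -!lee_fin !fineK //; split=> //.
Qed.

Let Kbar := retracted_kernel delta o p.

Lemma retracted_kernelE u v : Kbar u v =
  (\sum_(y <- cball L0 (chamber_at delta o u))
     p (chamber_at delta o u) y * (delta o y == v)%:R)%:E.
Proof.
rewrite /Kbar /retracted_kernel -/(chamber_at delta o u) esum_mkcond.
rewrite (@esum_seq _ _ (cball L0 (chamber_at delta o u))) ?(cball_uniq cox bld reg) //.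
- rewrite -sumEFin; apply: eq_bigr => y _.
  have -> : (y \in sphere delta o v) = (delta o y == v).
    by apply/idP/eqP; rewrite inE.
  by case: eqP => _; rewrite ?mulr1 ?mulr0.
- by move=> y; case: ifP => // _; rewrite lee_fin.
move=> y; rewrite (mem_cball cox bld reg) => h; case: ifP => // _; congr EFin.
by apply/eqP/negPn/negP => /(p_supp kern range); apply/negP.
Qed.

(** Lumping, valid for every [x] and not only for the chamber chosen in [retracted_kernel]; [isoE]
    moves from that chamber [x0] to [x]. *)
Lemma kstep_retracted k x v :
  kstep Kbar k (delta o x) v = (\sum_(y <- sph o v) pk k x y)%:E.
Proof.
elim: k x => [|k IH] x.
  rewrite /=; case: eqP => [e|ne].
    rewrite (@big_supp _ _ _ [:: x]) ?sph_uniq //.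
    - by rewrite big_seq1 eqxx.
    - by move=> y _; rewrite inE (eq_sym y); case: (x == y) => //; rewrite eqxx.
    - by move=> y; rewrite inE => /eqP -> _; rewrite (mem_sph cox bld reg) e.
  rewrite big_seq big1 // => y; rewrite (mem_sph cox bld reg) => /eqP oy.
  by case: eqP => // xy; case: ne; rewrite xy.
pose G w := fine (kstep Kbar k w v).
have GE w : kstep Kbar k w v = (G w)%:E.
  by rewrite /G -(delta_chamber_at cox bld o w) IH.
have Gd y : G (delta o y) = \sum_(z <- sph o v) pk k y z by rewrite /G IH.
set u := delta o x; set x0 := chamber_at delta o u.
have G0 w : 0 <= G w.
  by rewrite -(delta_chamber_at cox bld o w) Gd; apply: sumr_ge0.
pose l := undup [seq delta o y | y <- cball L0 x0].
have inl y : y \in cball L0 x0 -> delta o y \in l.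
  by move=> yin; rewrite mem_undup; apply/mapP; exists y.
rewrite /= (@esum_seq _ _ l) ?undup_uniq //; first last.
- move=> w wl; rewrite retracted_kernelE big_seq big1 ?mul0e // => y yin.
  case: eqP => [e|_]; last by rewrite mulr0.
  by move: wl; rewrite -e inl.
- move=> w; rewrite retracted_kernelE GE -EFinM lee_fin mulr_ge0 //.
  by apply: sumr_ge0 => y _; rewrite mulr_ge0.
rewrite (eq_bigr (fun w =>
  ((\sum_(y <- cball L0 x0) p x0 y * (delta o y == w)%:R) * G w)%:E)); last first.
  by move=> w _; rewrite retracted_kernelE GE EFinM.
rewrite sumEFin; congr EFin.
rewrite (eq_bigr (fun w =>
  \sum_(y <- cball L0 x0) p x0 y * (delta o y == w)%:R * G w)) => [|w _]; last exact: mulr_suml.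
rewrite exchange_big /=.
transitivity (\sum_(y <- cball L0 x0) p x0 y * G (delta o y)).
  rewrite big_seq [RHS]big_seq; apply: eq_bigr => y yin.
  rewrite (perm_big _ (perm_to_rem (inl y yin))) big_cons eqxx mulr1.
  rewrite big_seq big1 => [|w]; first exact: addr0.
  rewrite mem_rem_uniq ?undup_uniq // inE => /andP[/negbTE wy _].
  by rewrite eq_sym wy mulr0 mul0r.
rewrite (isoE G (x1' := o) (x2 := x) (x2' := o)) ?(delta_chamber_at cox bld) //.
rewrite exchange_big /=; apply: eq_bigr => y _.
by rewrite Gd mulr_sumr.
Qed.

Lemma green_retracted x :
  green Kbar 1%g (delta o x) = ((size (sph o (delta o x)))%:R%:E * green K o x)%E.
Proof.
rewrite /green -nneseriesZl; last by move=> k _; exact: kstep_ge0.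
apply: eq_eseriesr => k _.
rewrite -(delta_refl bld o) kstep_retracted (kstep_pk cox bld reg kern range) -EFinM.
congr EFin; rewrite big_seq (eq_bigr (fun=> pk k o x)); last first.
  move=> y; rewrite (mem_sph cox bld reg) => /eqP e.
  exact: (pk_iso cox bld reg o kern iso range k e).
by rewrite -big_seq big_const_seq count_predT iter_addr_0 mulr_natl.
Qed.

(** Almost surely [X n] is reachable in [n] steps, for all [n] at once, so that [green_comparison]
    applies along the whole trajectory. *)
Lemma ae_log_green_le :
  {ae P, forall w, forall n, lgreen (delta o (X n w)) <= max_step s L0 lgreen * n%:R}.
Proof.
apply: ae_foralln => n.
pose A y := lgreen (delta o y) <= max_step s L0 lgreen * n%:R.
have [mX _ _] := chain.
have mA : measurable [set w | A (X n w)] by exact: (mX n [set y | A y]).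
have PA : P [set w | A (X n w)] = 1%E.
  rewrite prob_sum -[RHS](congr1 EFin (pk_row cox bld reg kern range o (leqnn (n * L0)))).
  congr EFin.
  apply: eq_bigr => y _; have [->|nz] := eqVneq (pk n o y) 0; first by rewrite mul0r.
  by rewrite /A (log_green_supp cox bld reg o kern iso range irr nz) /= mulr1.
have PA0 : P (~` [set w | A (X n w)]) = 0%E by rewrite probability_setC // PA subee.
by exists (~` [set w | A (X n w)]); split=> //; exact: measurableC.
Qed.

Lemma ae_green_speed :
  {ae P, forall w, green_speed K o X w @ \oo --> (rate lgreen)%:E /\
    green_speed Kbar 1%g (fun n w => delta o (X n w)) w @ \oo -->
      (rate lgreen - rate lq)%:E}.
Proof.
have [T [c [T0 c0 cmp]]] := green_comparison cox bld reg o kern iso range irr thick.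
move: ae_log_green ae_log_q ae_log_green_le; apply: filterS3 => w cvgG cvgq supp.
have bound n : exists g : R, [/\ green K o (X n w) = g%:E,
    green_max (delta o (X n w)) <= g &
    g <= ((T * n.+1)%:R + c) * green_max (delta o (X n w))].
  by have [lo up] := cmp n o (X n w) (supp n); exact: green_bounds lo up.
pose g n := projT1 (cid (bound n)).
have gP n : [/\ green K o (X n w) = (g n)%:E,
    green_max (delta o (X n w)) <= g n &
    g n <= ((T * n.+1)%:R + c) * green_max (delta o (X n w))].
  exact: projT2 (cid (bound n)).
have M0 n : 0 < green_max (delta o (X n w)) by exact: green_max_gt0 irr _.
have g0 n : 0 < g n by have [_ Mg _] := gP n; exact: lt_le_trans (M0 n) Mg.
have cvgg : (fun n => n%:R^-1 * - ln (g n)) @ \oo --> rate lgreen.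
  apply: (squeeze_cvgr
    (f := fun n => n%:R^-1 * lgreen (delta o (X n w)) -
                   n%:R^-1 * ln ((T * n.+1)%:R + c))
    (h := fun n => n%:R^-1 * lgreen (delta o (X n w)))) => //.
    apply: nearW => n; have [_ lo up] := gP n.
    have Tc : 0 < (T * n.+1)%:R + c by rewrite ltr_wpDr // ltr0n muln_gt0 T0.
    rewrite -mulrBr; apply/andP; split; rewrite ler_wpM2l ?invr_ge0 //.
      by rewrite /log_green -opprD lerN2 addrC -lnM ?posrE // ler_ln ?posrE ?mulr_gt0.
    by rewrite lerN2 ler_ln ?posrE.
  rewrite -[X in _ --> X]subr0; apply: cvgB => //; exact: cvg_ln_affine.
split.
  rewrite (_ : green_speed _ _ _ _ = fun n => (n%:R^-1 * - ln (g n))%:E).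
    by apply: cvg_EFin => //; exact: nearW.
  apply/funext => n; have [e _ _] := gP n.
  by rewrite /green_speed e lne_EFin // -EFinM mulNr mulrN.
rewrite (_ : green_speed _ _ _ _ =
    fun n => (n%:R^-1 * - ln (g n) - n%:R^-1 * lq (delta o (X n w)))%:E).
  by apply: cvg_EFin; [exact: nearW|exact: cvgB].
apply/funext => n; have [e _ _] := gP n.
have q0 : 0 < (size (sph o (delta o (X n w))))%:R :> R.
  by rewrite ltr0n (size_sph_gt0 cox bld reg).
rewrite /green_speed green_retracted e -EFinM lne_EFin ?mulr_gt0 // -EFinM; congr EFin.
by rewrite lnM ?posrE // /log_q; ring.
Qed.

End Entropy.

Theorem theorem1p1 (R : realType) (N : nat) (W : groupType) (s : 'I_N -> W)
    (Delta : choiceType) (delta : Delta -> Delta -> W) (o : Delta)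
    (p : Delta -> Delta -> R)
    (d : measure_display) (Omega : measurableType d) (P : probability Omega R)
    (X : nat -> Omega -> Delta) :
  fuchsian_coxeter_system s -> irreducible_coxeter_system s ->
  building s delta -> regular_building s delta -> thick_building s delta ->
  transition_kernel p -> irreducible_kernel p ->
  isotropic delta p -> bounded_range s delta p ->
  markov_chain P p o X ->
  let Xbar := fun n w => delta o (X n w) in
  let K := fun x y => (p x y)%:E in
  let Kbar := retracted_kernel delta o p in
  exists hbar h hq : R,
    (mean_entropy P Xbar @ \oo --> hbar%:E /\
     {ae P, forall w, green_speed Kbar 1%g Xbar w @ \oo --> hbar%:E}) /\
    (mean_entropy P X @ \oo --> h%:E /\
     {ae P, forall w, green_speed K o X w @ \oo --> h%:E}) /\
    {ae P, forall w,
      (fun n => n%:R^-1 * ln (sphere_card delta o (Xbar n w))%:R) @ \oo --> hq} /\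
    h = hbar + hq.
Proof.
move=> cox _ bld reg thick kern irr iso [L0 range] chain Xbar K Kbar.
have speed := ae_green_speed cox bld reg thick kern irr iso range chain.
have cvgE := entropy_cvg cox bld reg thick (o := o) kern irr iso range.
have cvgq := mean_log_q cox bld reg (o := o) kern iso range.
pose h := rate (cball s delta L0) p delta (log_green s delta o p L0) o.
pose hq := rate (cball s delta L0) p delta (log_q R delta o) o.
exists (h - hq), h, hq; split; [split|split; [split|split]].
- rewrite (funext (mean_entropy_Xbar cox bld reg kern iso range chain)).
  by apply: cvg_EFin; [exact: nearW|exact: cvgB].
- by move: speed; apply: filterS => w [].
- rewrite (funext (mean_entropy_X cox bld reg kern range chain)).
  by apply: cvg_EFin => //; exact: nearW.
- by move: speed; apply: filterS => w [].
- exact: (ae_log_q cox bld reg kern iso range chain).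
- by rewrite subrK.
Qed.
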